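(* Let $d,m,x$ be non-negative integers with $d\ge 1$. (1) If $d\mid 2m$, then $$\sum (-1)^{|\{i:\ d+1\le k_i\le 2d-1 \bmod 2d\}|}\prod_{\substack{1\le i\le m\\ k_i\equiv d\ (2d)}}k_i\prod_{\substack{1\le i<j\le m\\ k_i\equiv k_j\ (2d)}}\left(\frac{k_j-k_i}{2}\right)^2\prod_{\substack{1\le i<j\le m\\ k_i\equiv -k_j\ (2d)}}\left(\frac{k_j+k_i}{2}\right)^2$$ $$=(-1)^{\binom d2\binom{2m/d}{2}}\,d^{(2m-d)m/d}\,m!\,\prod_{l=1}^{(2m-d)/d}(l!)^d\;\triangle_{4m^2/d}\!\left(\frac{x}{2d}\right),$$ where the sum is over all tuples $(k_1,\dots,k_m,l_1,\dots,l_m)$ of odd positive integers satisfying $k_1l_1+\dots+k_ml_m=m^2+x$ and $(k_1,\dots,k_m)\simeq(1,3,5,\dots,2m-1) \bmod 2d$. (2) If $d\mid 2m$ or $d\mid 2m+2$, then $$\sum (-1)^{|\{i:\ (d+1)/2\le k_i\le d-1 \bmod d\}|}\prod_{\substack{1\le i\le m\\ k_i\equiv 0\ (d)}}2k_i^3\prod_{\substack{1\le i\le m\\ k_i\equiv d/2\ (d)}}2k_i\prod_{\substack{1\le i<j\le m\\ k_i\equiv k_j\ (d)}}(k_j-k_i)^2\prod_{\substack{1\le i<j\le m\\ k_i\equiv -k_j\ (d)}}(k_i+k_j)^2$$ $$=C\,d^{(2m+2-d)m/d}\,m!\;\triangle_{4m(m+1)/d}\!\left(\frac{x}{d}\right),$$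 where the sum is over all tuples $(k_1,\dots,k_m,l_1,\dots,l_m)$ of positive integers with all $l_i$ odd, satisfying $k_1l_1+\dots+k_ml_m=\frac12 m(m+1)+x$ and $(k_1,\dots,k_m)\simeq(1,2,\dots,m)\bmod d$, and where $$C=\begin{cases}(-1)^{\binom{d-1}2\binom{2m/d}{2}}\,(2m/d)!\,\prod_{l=1}^{(2m-d)/d}(l!)^d, & d\mid 2m,\\[4pt](-1)^{\binom{d-1}2\binom{2(m+1)/d}{2}}\,\dfrac{1}{((2m+2-d)/d)!}\,\prod_{l=1}^{(2m+2-d)/d}(l!)^d, & d\mid 2m+2.\end{cases}$$ The right-hand sides of the identities in (1) and (2) are interpreted as zero if $2d\nmid x$ and $d\nmid x$, respectively.
   Context: For integers $k,n\ge 0$, $\triangle_k(n)$ is the number of representations of $n$ as a sum of $k$ triangular numbers, where representations differing by the order of the terms are counted as different; equivalently $\left(\sum_{n\ge0}q^{n(n+1)/2}\right)^k=\sum_{n\ge 0}\triangle_k(n)q^n$ for $|q|<1$. For multi-indices of integers, $(k_1,\dots,k_m)\simeq(l_1,\dots,l_m)\bmod n$ means that there exist a permutation $\sigma\in S_m$ and signs $\varepsilon_i\in\{\pm1\}$ such that $k_{\sigma(i)}\equiv\varepsilon_i l_i \pmod n$ for $i=1,\dots,m$. The notation $a\equiv b\ (n)$ means congruence modulo $n$. The condition ''$a\le k_i\le b \bmod n$'' (with $0\le a$ and $b\le n-1$) means that the residue of $k_i$ modulo $n$ in $\{0,1,\dots,n-1\}$ lies in the interval $[a,b]$. When $d$ is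 odd, no integer satisfies $k_i\equiv d/2\ (d)$, so the corresponding product is empty. Empty products equal $1$. *)

(* Defs.v *)
From HB Require Import structures.
From mathcomp Require Import all_boot all_order all_algebra all_fingroup.
Set Implicit Arguments.
Unset Strict Implicit.
Unset Printing Implicit Defensive.
Import Order.TTheory GRing.Theory Num.Theory.
Local Open Scope ring_scope.

Definition triangular (j : nat) : nat := (j * (j + 1)) %/ 2.

(* j |-> triangular j is injective on nat, so representations are counted by
   the tuples of indices; as j <= triangular j, every index is at most n. *)
Definition ntriangle (k n : nat) : nat :=
  #|[set t : {ffun 'I_k -> 'I_n.+1} |
      (\sum_(i < k) triangular (t i) == n)%N]|.

Definition sim_mod (m n : nat) (k l : 'I_m -> int) : bool :=
  [exists s : 'S_m, exists e : {ffun 'I_m -> bool},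
    forall i, (k (s i) == (-1) ^+ e i * l i %[mod n])%Z].

(* Main.v *)
Require Import Defs.
From HB Require Import structures.
From mathcomp Require Import all_boot all_order all_algebra all_fingroup.
From mathcomp Require Import boolp classical_sets cardinality functions fsbigop.
From mathcomp Require Import zify ring lra.
Set Implicit Arguments.
Unset Strict Implicit.
Unset Printing Implicit Defensive.
Import Order.TTheory GRing.Theory Num.Theory.
Local Open Scope ring_scope.

(** Summing over the odd [l_i] first turns each of them into the factor w(k) = q^k/(1 - q^(2k)) =
    1/(q^-k - q^k), the series [wser], so the left-hand side is a coefficient of a power series.
    Both parts are then one statement modulo M = 2d, with v_i = k_i in part (1) and v_i = 2 k_i in
    part (2): the tuples are those with a prescribed number of entries in each class modulo M up to
    sign. Give v the node ±v/2 in a generic class and (v/2)^2 in the self-dual classes 0 and d. The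
    products of squares in the summand are the squared differences of nodes inside the classes
    ([node_vdmE]). Andréief's identity for classwise monomials ([class_andreief]) makes the sum m!
    times a product of Hankel determinants, one for each class. Folding v and -v together turns
    their entries into multiples of the moments c_r(s), the sums of a^s w(a) over all integers a
    congruent to r modulo M ([moment_generic], [moment_selfdual]).

    With q^-1 = exp t, w(a) is 1/(2 sinh ta), and a product of an odd number of such factors has a
    partial fraction expansion ([partial_fractions]). Inserted in the multiple sum for a Hankel
    determinant, it separates a base point from the differences of the variables: odd sizes factor
    ([hankel_odd], [hankel_shift_odd]), and even sizes reduce to a shifted determinant of class 0
    that is independent of r ([hankel_even]). In the self-dual classes the even moments vanish, and
    these determinants split into determinants A_u (class d) and B_u (class 0) of odd moments. The
    identities become A_{u+1} A_u = ±(2u+1) M p B_u^2 and B_{u+1} B_u = ±M (2u+2) A_{u+1}^2, where M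
    p = c_d(1). Positivity of coefficients fixes the signs, and induction gives closed forms
    ([odd_hankel_eval]).

    Two inputs remain. The series p is q^d psi(q^(2d))^4 with psi the generating series of the
    triangular numbers ([weighted_ser_psi]); this follows from functional equations shared by
    Lambert series and theta functions. The zeroth moments satisfy c_r(0) c_{d-r}(0) = p
    ([hser_mul]), which evaluates their product over the classes. Altogether the product of the
    determinants is a constant times a power of q times a power of psi(q^(2d)) ([prod_class_det]),
    whose coefficients are the numbers of representations by triangular numbers ([coef_psi_exp]).
    The rest counts the entries of (1, 3, ..., 2m-1) and (1, ..., m) in each class and matches
    signs, constants and exponents. *)

Record fps (R : comNzRingType) := Fps { fcoef : nat -> R }.

(** * Formal power series and the q-adic order *)

Section FpsRing.
Variable R : comNzRingType.
Implicit Types f g h : fps R.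

HB.instance Definition _ := gen_eqMixin (fps R).
HB.instance Definition _ := gen_choiceMixin (fps R).

Lemma fpsP f g : (forall n, fcoef f n = fcoef g n) -> f = g.
Proof. by case: f g => [f] [g] /= eq_fg; congr Fps; apply: funext. Qed.

Definition fps_add f g := Fps (fun n => fcoef f n + fcoef g n).
Definition fps_opp f := Fps (fun n => - fcoef f n).
Definition fps_zero : fps R := Fps (fun=> 0).
Definition fps_one : fps R := Fps (fun n => (n == 0)%:R).
Definition fps_mul f g :=
  Fps (fun n => \sum_(i < n.+1) fcoef f i * fcoef g (n - i)).

Fact fps_addA : associative fps_add.
Proof. by move=> f g h; apply: fpsP => n /=; rewrite addrA. Qed.
Fact fps_addC : commutative fps_add.
Proof. by move=> f g; apply: fpsP => n /=; rewrite addrC. Qed.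
Fact fps_add0 : left_id fps_zero fps_add.
Proof. by move=> f; apply: fpsP => n /=; rewrite add0r. Qed.
Fact fps_addN : left_inverse fps_zero fps_opp fps_add.
Proof. by move=> f; apply: fpsP => n /=; rewrite addNr. Qed.

HB.instance Definition _ :=
  GRing.isZmodule.Build (fps R) fps_addA fps_addC fps_add0 fps_addN.

Definition fps_trunc N f : {poly R} := \poly_(i < N.+1) fcoef f i.

Lemma coef_fps_trunc N f n : (n <= N)%N -> (fps_trunc N f)`_n = fcoef f n.
Proof. by move=> le_nN; rewrite coef_poly ltnS le_nN. Qed.

(** A coefficient of a product depends only on truncations of the factors; commutativity and
    associativity are inherited from polynomials this way. *)
Lemma coef_fps_mul_trunc N f g n : (n <= N)%N ->
  fcoef (fps_mul f g) n = (fps_trunc N f * fps_trunc N g)`_n.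
Proof.
move=> le_nN; rewrite coefM; apply: eq_bigr => -[i /= le_in] _.
rewrite !coef_fps_trunc ?(leq_trans _ le_nN) // leq_subr //.
Qed.

Fact fps_mulC : commutative fps_mul.
Proof.
by move=> f g; apply: fpsP => n; rewrite !(coef_fps_mul_trunc _ _ (leqnn n)) mulrC.
Qed.

Fact fps_mulA : associative fps_mul.
Proof.
move=> f g h; apply: fpsP => n.
transitivity (fps_trunc n f * (fps_trunc n g * fps_trunc n h))`_n.
  rewrite coefM; apply: eq_bigr => -[i /= le_in] _.
  by rewrite coef_fps_trunc // -coef_fps_mul_trunc ?leq_subr.
rewrite mulrA coefMr /= -[LHS](@big_mkord _ _ _ n.+1 xpredT
  (fun i => (fps_trunc n f * fps_trunc n g)`_(n - i) * (fps_trunc n h)`_i)).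
rewrite big_nat_rev /= big_mkord; apply: eq_bigr => -[i /= le_in] _.
rewrite add0n subSS subKn // coef_fps_trunc ?leq_subr //.
by rewrite -coef_fps_mul_trunc.
Qed.

Fact fps_mul1 : left_id fps_one fps_mul.
Proof.
move=> f; apply: fpsP => n /=; rewrite big_ord_recl /= mul1r subn0.
by rewrite big1 ?addr0 // => i _; rewrite mul0r.
Qed.

Fact fps_mulDl : left_distributive fps_mul fps_add.
Proof.
move=> f g h; apply: fpsP => n /=; rewrite -big_split /=.
by apply: eq_bigr => i _; rewrite mulrDl.
Qed.

Fact fps_1neq0 : fps_one != 0.
Proof. by apply/eqP => -[] /(congr1 (@^~ 0)) /= /eqP; rewrite oner_eq0. Qed.

HB.instance Definition _ := GRing.Zmodule_isComNzRing.Build (fps R)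
  fps_mulA fps_mulC fps_mul1 fps_mulDl fps_1neq0.

Lemma coef_fpsD f g n : fcoef (f + g) n = fcoef f n + fcoef g n.
Proof. by []. Qed.
Lemma coef_fpsN f n : fcoef (- f) n = - fcoef f n.
Proof. by []. Qed.
Lemma coef_fpsB f g n : fcoef (f - g) n = fcoef f n - fcoef g n.
Proof. by []. Qed.
Lemma coef_fps0 n : fcoef (0 : fps R) n = 0.
Proof. by []. Qed.
Lemma coef_fps1 n : fcoef (1 : fps R) n = (n == 0)%:R.
Proof. by []. Qed.
Lemma coef_fpsM f g n :
  fcoef (f * g) n = \sum_(i < n.+1) fcoef f i * fcoef g (n - i).
Proof. by []. Qed.
Lemma coef_fps_sum I (r : seq I) (P : pred I) (F : I -> fps R) n :
  fcoef (\sum_(i <- r | P i) F i) n = \sum_(i <- r | P i) fcoef (F i) n.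
Proof. by elim/big_rec2: _ => //= i x y _ <-. Qed.
Lemma coef_fpsMn f k n : fcoef (f *+ k) n = fcoef f n *+ k.
Proof. by elim: k => // k IHk; rewrite !mulrS coef_fpsD IHk. Qed.
Lemma coef_fpsMz f (z : int) n : fcoef (f *~ z) n = fcoef f n *~ z.
Proof.
case: z => k; first exact: coef_fpsMn.
by rewrite !NegzE !mulrNz coef_fpsN; congr (- _); apply: coef_fpsMn.
Qed.

Lemma coef_natM k f n : fcoef (k%:R * f) n = k%:R * fcoef f n.
Proof. by rewrite !mulr_natl coef_fpsMn. Qed.
Lemma coef_intM (z : int) f n : fcoef (z%:~R * f) n = z%:~R * fcoef f n.
Proof. by rewrite !mulrzl coef_fpsMz. Qed.

Definition fpsX k : fps R := Fps (fun n => (n == k)%:R).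

Lemma coef_fpsXM k f n :
  fcoef (fpsX k * f) n = if (k <= n)%N then fcoef f (n - k) else 0.
Proof.
rewrite coef_fpsM; case: leqP => [le_kn|lt_nk].
  rewrite (bigD1 (Ordinal (le_kn : k < n.+1)%N)) //= eqxx mul1r big1 ?addr0 //.
  by move=> i; rewrite -val_eqE /= => /negPf->; rewrite mul0r.
rewrite big1 // => -[i /= le_in] _; case: eqP => [eq_ik|_]; rewrite ?mul0r //.
by rewrite eq_ik ltnS leqNgt lt_nk in le_in.
Qed.

Lemma fpsXD k l : fpsX (k + l)%N = fpsX k * fpsX l.
Proof.
apply: fpsP => n; rewrite coef_fpsXM /=; case: leqP => [le_kn|lt_nk].
  by rewrite -[(n - k)%N == l](eqn_add2l k) subnKC.
by case: eqP => // n_eq; rewrite n_eq ltnNge leq_addr in lt_nk.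
Qed.

Lemma fpsX0 : fpsX 0 = 1.
Proof. by []. Qed.

Lemma fpsXM k l : fpsX (k * l)%N = fpsX k ^+ l.
Proof.
elim: l => [|l IHl]; first by rewrite muln0.
by rewrite mulnS fpsXD IHl exprS.
Qed.

Lemma prod_fpsX I (r : seq I) (P : pred I) (F : I -> nat) :
  \prod_(i <- r | P i) fpsX (F i) = fpsX (\sum_(i <- r | P i) F i)%N.
Proof. by elim/big_rec2: _ => // i x y _ ->; rewrite fpsXD. Qed.

(** Membership in the ideal generated by q^k. *)
Definition ord_ge k f := forall n, (n < k)%N -> fcoef f n = 0.

Lemma ord_ge0 f : ord_ge 0 f. Proof. by []. Qed.
Lemma ord_ge_zero k : ord_ge k 0. Proof. by []. Qed.

Lemma ord_geW k l f : (k <= l)%N -> ord_ge l f -> ord_ge k f.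
Proof. by move=> le_kl f_l n lt_nk; rewrite f_l // (leq_trans lt_nk). Qed.

Lemma ord_geD k f g : ord_ge k f -> ord_ge k g -> ord_ge k (f + g).
Proof. by move=> f_k g_k n lt_nk; rewrite coef_fpsD f_k ?g_k ?addr0. Qed.

Lemma ord_geN k f : ord_ge k f -> ord_ge k (- f).
Proof. by move=> f_k n lt_nk; rewrite coef_fpsN f_k ?oppr0. Qed.

Lemma ord_geM k l f g : ord_ge k f -> ord_ge l g -> ord_ge (k + l)%N (f * g).
Proof.
move=> f_k g_l n lt_n; rewrite coef_fpsM big1 // => -[i /= le_in] _.
have [lt_ik|le_ki] := ltnP i k; first by rewrite f_k ?mul0r.
rewrite g_l ?mulr0 // ltn_subLR //; apply: leq_trans lt_n _.
by rewrite leq_add2r.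
Qed.

Lemma ord_geMl k f g : ord_ge k g -> ord_ge k (f * g).
Proof. by move=> g_k; rewrite -[k]add0n; apply: ord_geM. Qed.

Lemma ord_geMr k f g : ord_ge k f -> ord_ge k (f * g).
Proof. by move=> f_k; rewrite mulrC; apply: ord_geMl. Qed.

Lemma ord_ge_sum I (r : seq I) (P : pred I) (F : I -> fps R) k :
  (forall i, P i -> ord_ge k (F i)) -> ord_ge k (\sum_(i <- r | P i) F i).
Proof. by move=> F_k; elim/big_ind: _ => // f g; apply: ord_geD. Qed.

Lemma ord_ge_prod I (r : seq I) (P : pred I) (F : I -> fps R) (K : I -> nat) :
  (forall i, P i -> ord_ge (K i) (F i)) ->
  ord_ge (\sum_(i <- r | P i) K i)%N (\prod_(i <- r | P i) F i).
Proof.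
by move=> F_K; elim/big_rec2: _ => // i k f Pi f_k; apply: ord_geM => //; apply: F_K.
Qed.

Lemma ord_geX k : ord_ge k (fpsX k).
Proof. by move=> n lt_nk /=; rewrite ltn_eqF. Qed.

End FpsRing.

(** The product of the two lowest nonzero coefficients is a coefficient of the product. This is what
    justifies cancelling denominators later. *)
Lemma fps_mulf_eq0 (R : idomainType) (f g : fps R) :
  f * g = 0 -> f = 0 \/ g = 0.
Proof.
move=> fg0; apply: contrapT => /not_orP [f0 g0].
have ex_coef (h : fps R) : h <> 0 -> exists n, fcoef h n != 0.
  move=> h0; apply: contrapT => /forallNP h_n; apply: h0; apply: fpsP => n.
  by have /negP := h_n n; rewrite negbK => /eqP.
have /ex_minnP [m fm min_m] := ex_coef f f0.
have /ex_minnP [n gn min_n] := ex_coef g g0.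
have := congr1 (@fcoef _ ^~ (m + n)%N) fg0; rewrite coef_fpsM /=.
rewrite (bigD1 (inord m)) //= inordK ?ltnS ?leq_addr // addKn big1 ?addr0.
  by move/eqP; rewrite mulf_eq0 (negPf fm) (negPf gn).
move=> -[i /= le_i]; rewrite -val_eqE /= inordK ?ltnS ?leq_addr // => ne_im.
have [lt_im|le_mi] := ltnP i m.
  by have [->|/min_m] := eqVneq (fcoef f i) 0; rewrite ?mul0r // leqNgt lt_im.
have [->|/min_n] := eqVneq (fcoef g (m + n - i)) 0; rewrite ?mulr0 //.
rewrite leq_subRL // leq_add2r => le_im.
by case/eqP: ne_im; apply/eqP; rewrite eqn_leq le_im le_mi.
Qed.

Lemma fps_mulfI (R : idomainType) (f g h : fps R) :
  f <> 0 -> f * g = f * h -> g = h.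
Proof.
move=> f0 /eqP; rewrite -subr_eq0 -mulrBr => /eqP /fps_mulf_eq0 [//|/eqP].
by rewrite subr_eq0 => /eqP.
Qed.

Lemma fpsX_neq0 (R : comNzRingType) k : fpsX R k <> 0.
Proof. by move/(congr1 (@fcoef _ ^~ k)) => /= /eqP; rewrite eqxx oner_eq0. Qed.

(** * Unconditional q-adic sums over arbitrary index types *)

Section InfiniteSums.
Variable R : idomainType.
Implicit Types (I J : choiceType) (f g : fps R).

Definition summable I (F : I -> fps R) :=
  forall N, exists s : seq I, forall i, i \notin s -> ord_ge N (F i).

(* Outside the summable families the coefficients of [Sum] are junk. *)
Definition Sum I (F : I -> fps R) : fps R :=
  Fps (fun n => \sum_(i \in [set: I]%classic) fcoef (F i) n).

Lemma coef_Sum I (F : I -> fps R) (s : seq I) n :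
  (forall i, i \notin s -> fcoef (F i) n = 0) ->
  fcoef (Sum F) n = fcoef (\sum_(i <- undup s) F i) n.
Proof.
move=> s_n; rewrite coef_fps_sum /= (fsbigE (undup s)) ?undup_uniq //.
  by apply: eq_bigl => i; rewrite in_setT.
by move=> i _; rewrite mem_undup => /s_n.
Qed.

Lemma eq_Sum I (F G : I -> fps R) : F =1 G -> Sum F = Sum G.
Proof. by move=> /funext->. Qed.

Lemma eq_summable I (F G : I -> fps R) : F =1 G -> summable F -> summable G.
Proof. by move=> /funext->. Qed.

Lemma summable_coef I (F : I -> fps R) n : summable F ->
  exists s : seq I, forall k, (k <= n)%N ->
    (forall i, i \notin s -> fcoef (F i) k = 0) /\
    fcoef (Sum F) k = fcoef (\sum_(i <- undup s) F i) k.
Proof.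
move=> /(_ n.+1) [s s_n]; exists s => k le_kn.
have s_k i : i \notin s -> fcoef (F i) k = 0 by move/s_n; apply.
by split=> //; apply: coef_Sum.
Qed.

Lemma Sum_ord_ge I (F : I -> fps R) N :
  (forall i, ord_ge N (F i)) -> ord_ge N (Sum F).
Proof.
move=> F_N n lt_nN; rewrite (@coef_Sum _ _ [::]) ?big_nil // => i _.
exact: F_N.
Qed.

Lemma Sum_seq I (F : I -> fps R) (s : seq I) : uniq s ->
  (forall i, i \notin s -> F i = 0) -> Sum F = \sum_(i <- s) F i.
Proof.
move=> uniq_s F0; apply: fpsP => n; rewrite -[in RHS](undup_id uniq_s).
by apply: coef_Sum => i /F0->.
Qed.

Lemma Sum0 I (F : I -> fps R) : (forall i, F i = 0) -> Sum F = 0.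
Proof. by move=> F0; rewrite (@Sum_seq _ _ [::]) ?big_nil. Qed.

Lemma Sum_single I (F : I -> fps R) (i0 : I) :
  (forall i, i != i0 -> F i = 0) -> Sum F = F i0.
Proof.
move=> F0; rewrite (@Sum_seq _ _ [:: i0]) ?big_seq1 // => i.
by rewrite inE => /F0.
Qed.

Lemma summable_sub I (F G : I -> fps R) :
  (forall i N, ord_ge N (F i) -> ord_ge N (G i)) -> summable F -> summable G.
Proof. by move=> FG sumF N; have [s s_N] := sumF N; exists s => i /s_N /FG. Qed.

Lemma summableMl I (F G : I -> fps R) :
  summable F -> summable (fun i => G i * F i).
Proof. by apply: summable_sub => i N; apply: ord_geMl. Qed.

Lemma summableMr I (F G : I -> fps R) :
  summable F -> summable (fun i => F i * G i).
Proof. by apply: summable_sub => i N; apply: ord_geMr. Qed.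

Lemma summableD I (F G : I -> fps R) :
  summable F -> summable G -> summable (fun i => F i + G i).
Proof.
move=> sumF sumG N; have [s s_N] := sumF N; have [t t_N] := sumG N.
exists (s ++ t) => i; rewrite mem_cat => /norP [/s_N iF /t_N iG].
exact: ord_geD.
Qed.

Lemma summableN I (F : I -> fps R) : summable F -> summable (fun i => - F i).
Proof. by apply: summable_sub => i N; apply: ord_geN. Qed.

Lemma summable_zero I : summable (fun _ : I => 0 : fps R).
Proof. by move=> N; exists [::]. Qed.

Lemma summable_seq I (F : I -> fps R) (s : seq I) :
  (forall i, i \notin s -> F i = 0) -> summable F.
Proof. by move=> F0 N; exists s => i /F0->. Qed.

Lemma summable_sum I (T : Type) (r : seq T) (P : pred T) (F : T -> I -> fps R) :
  (forall t, P t -> summable (F t)) -> summable (fun i => \sum_(t <- r | P t) F t i).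
Proof.
move=> sumF; elim: r => [|t r IHr].
  by apply: eq_summable (@summable_zero I) => i; rewrite big_nil.
case Pt: (P t).
  by apply: eq_summable (summableD (sumF t Pt) IHr) => i; rewrite big_cons Pt.
by apply: eq_summable IHr => i; rewrite big_cons Pt.
Qed.

Lemma SumD I (F G : I -> fps R) : summable F -> summable G ->
  Sum (fun i => F i + G i) = Sum F + Sum G.
Proof.
move=> sumF sumG; apply: fpsP => n.
have [s /(_ n (leqnn n)) [s_n _]] := summable_coef n sumF.
have [t /(_ n (leqnn n)) [t_n _]] := summable_coef n sumG.
rewrite coef_fpsD !(@coef_Sum _ _ (s ++ t)) -?coef_fpsD ?big_split //;
  by move=> i; rewrite mem_cat => /norP [i_s i_t]; rewrite ?coef_fpsD ?s_n ?t_n ?addr0.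
Qed.

Lemma Sum_sum I (T : Type) (r : seq T) (P : pred T) (F : T -> I -> fps R) :
  (forall t, P t -> summable (F t)) ->
  Sum (fun i => \sum_(t <- r | P t) F t i) = \sum_(t <- r | P t) Sum (F t).
Proof.
move=> sumF; elim: r => [|t r IHr].
  by rewrite big_nil Sum0 // => i; rewrite big_nil.
rewrite big_cons; case Pt: (P t); last first.
  by rewrite -IHr; apply: eq_Sum => i; rewrite big_cons Pt.
rewrite -IHr -SumD //; [|exact: sumF|exact: summable_sum].
by apply: eq_Sum => i; rewrite big_cons Pt.
Qed.

Lemma SumMl I (F : I -> fps R) f : summable F ->
  Sum (fun i => f * F i) = f * Sum F.
Proof.
move=> sumF; apply: fpsP => n; have [s s_n] := summable_coef n sumF.
rewrite (@coef_Sum _ _ s) -?mulr_sumr.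
  rewrite !coef_fpsM; apply: eq_bigr => i _.
  by have [_ ->] := s_n (n - i)%N (leq_subr _ _).
move=> i i_s; rewrite coef_fpsM big1 // => j _.
by have [/(_ i i_s)-> _] := s_n (n - j)%N (leq_subr _ _); rewrite mulr0.
Qed.

Lemma SumMr I (F : I -> fps R) f : summable F ->
  Sum (fun i => F i * f) = Sum F * f.
Proof. by move=> sumF; rewrite mulrC -SumMl //; apply: eq_Sum => i; rewrite mulrC. Qed.

Lemma SumN I (F : I -> fps R) : summable F -> Sum (fun i => - F i) = - Sum F.
Proof.
by move=> sumF; rewrite -mulN1r -SumMl //; apply: eq_Sum => i; rewrite mulN1r.
Qed.

Lemma SumB I (F G : I -> fps R) : summable F -> summable G ->
  Sum (fun i => F i - G i) = Sum F - Sum G.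
Proof. by move=> sumF sumG; rewrite SumD ?SumN //; apply: summableN. Qed.

Lemma reindex_Sum I J (h : I -> J) (F : J -> fps R) : bijective h ->
  Sum F = Sum (fun i => F (h i)).
Proof.
by move=> bij_h; apply: fpsP => n; apply: (reindex_fsbigT h).
Qed.

Lemma summable_reindex I J (h : I -> J) (F : J -> fps R) : bijective h ->
  summable (fun i => F (h i)) -> summable F.
Proof.
case=> h' hK h'K sumF N; have [s s_N] := sumF N; exists (map h s) => j j_s.
rewrite -[j]h'K; apply: s_N; apply: contra j_s => h'j_s.
by apply/mapP; exists (h' j); rewrite ?h'K.
Qed.

Lemma summable_comp I J (h : I -> J) (F : J -> fps R) : injective h ->
  (forall s : seq J, exists t : seq I, forall i, h i \in s -> i \in t) ->
  summable F -> summable (fun i => F (h i)).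
Proof.
move=> inj_h fin_h sumF N; have [s s_N] := sumF N; have [t t_s] := fin_h s.
by exists t => i i_t; apply: s_N; apply: contra i_t => /t_s.
Qed.

Lemma summable_bij I J (h : I -> J) (F : J -> fps R) : bijective h ->
  summable F -> summable (fun i => F (h i)).
Proof.
move=> bij_h; apply: summable_comp (bij_inj bij_h) _ => s.
case: bij_h => h' hK h'K; exists (map h' s) => i hi_s.
by apply/mapP; exists (h i); rewrite ?hK.
Qed.

(** Fubini: for a fixed coefficient everything happens in the finite rectangle spanned by the two
    projections of the exceptional list. *)
Lemma Sum_pair I J (F : I -> J -> fps R) :
  summable (fun p : I * J => F p.1 p.2) ->
  Sum (fun p : I * J => F p.1 p.2) = Sum (fun i => Sum (F i)).
Proof.
move=> sumF; apply: fpsP => n; have [s s_n] := summable_coef n sumF.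
have {}s_n i j : (i, j) \notin s -> fcoef (F i j) n = 0.
  by have [/(_ (i, j))] := s_n n (leqnn n).
set s1 := undup (map fst s); set s2 := undup (map snd s).
have F0 i j : (i \notin s1) || (j \notin s2) -> fcoef (F i j) n = 0.
  rewrite !mem_undup -negb_and => ij_s; apply: s_n; apply: contra ij_s => ij_s.
  by rewrite (map_f fst ij_s) (map_f snd ij_s).
rewrite (@coef_Sum _ (fun i => Sum (F i)) s1); last first.
  move=> i i_s; rewrite (@coef_Sum _ _ [::]) ?big_nil // => j _.
  by apply: F0; rewrite i_s.
rewrite (@coef_Sum _ _ [seq (i, j) | i <- s1, j <- s2]); last first.
  move=> [i j] ij_s; apply: F0; rewrite -negb_and; apply: contra ij_s.
  by case/andP=> i_s j_s; apply/allpairsP; exists (i, j).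
rewrite undup_id ?allpairs_uniq ?undup_uniq //; last by move=> [? ?] [? ?].
rewrite big_allpairs /= undup_id ?undup_uniq // !coef_fps_sum.
apply: eq_bigr => i _; rewrite coef_fps_sum (@coef_Sum _ _ s2) => [|j j_s].
  by rewrite undup_id ?undup_uniq // coef_fps_sum.
by apply: F0; rewrite j_s orbT.
Qed.

Lemma summable_pair I J (F : I -> fps R) (G : J -> fps R) :
  summable F -> summable G -> summable (fun p : I * J => F p.1 * G p.2).
Proof.
move=> sumF sumG N; have [s s_N] := sumF N; have [t t_N] := sumG N.
exists [seq (i, j) | i <- s, j <- t] => -[i j] ij_st /=.
have [i_s|/s_N] := boolP (i \in s); last exact: ord_geMr.
apply: ord_geMl; apply: t_N; apply: contra ij_st => j_t.
by apply/allpairsP; exists (i, j).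
Qed.

Lemma Sum_mul I J (F : I -> fps R) (G : J -> fps R) :
  summable F -> summable G ->
  Sum F * Sum G = Sum (fun p : I * J => F p.1 * G p.2).
Proof.
move=> sumF sumG; rewrite -SumMr //.
rewrite (@Sum_pair _ _ (fun i j => F i * G j)); last exact: summable_pair.
by apply: eq_Sum => i; rewrite SumMl.
Qed.

Lemma summable_inner I J (F : I -> J -> fps R) i :
  summable (fun p : I * J => F p.1 p.2) -> summable (F i).
Proof.
move=> sumF; apply: (@summable_comp _ _ (pair i) _ _ _ sumF) => [j j' []//|s].
by exists (map snd s) => j ij_s; rewrite (map_f snd ij_s).
Qed.

Lemma summable_outer I J (F : I -> J -> fps R) :
  summable (fun p : I * J => F p.1 p.2) -> summable (fun i => Sum (F i)).
Proof.
move=> sumF N; have [s s_N] := sumF N; exists (map fst s) => i i_s.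
apply: Sum_ord_ge => j; apply: (s_N (i, j)); apply: contra i_s => ij_s.
by rewrite (map_f fst ij_s).
Qed.

(** Splits off the first variable, so that multiple sums can be treated by induction on the number
    of variables. *)
Definition ffcons I n (p : I * {ffun 'I_n -> I}) : {ffun 'I_n.+1 -> I} :=
  [ffun i => oapp p.2 p.1 (unlift ord0 i)].

Lemma ffcons0 I n (p : I * {ffun 'I_n -> I}) : ffcons p ord0 = p.1.
Proof. by rewrite ffunE unlift_none. Qed.

Lemma ffconsS I n (p : I * {ffun 'I_n -> I}) i : ffcons p (lift ord0 i) = p.2 i.
Proof. by rewrite ffunE liftK. Qed.

Lemma ffcons_bij I n : bijective (@ffcons I n).
Proof.
exists (fun e : {ffun 'I_n.+1 -> I} => (e ord0, [ffun i : 'I_n => e (lift ord0 i)]))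
  => [[a e]|e].
  by rewrite ffcons0; congr pair; apply/ffunP => i; rewrite ffunE ffconsS.
apply/ffunP => i; case: (unliftP ord0 i) => [j|] ->.
  by rewrite ffconsS ffunE.
by rewrite ffcons0.
Qed.

Lemma summable_prod I n (F : 'I_n -> I -> fps R) :
  (forall i, summable (F i)) ->
  summable (fun e : {ffun 'I_n -> I} => \prod_i F i (e i)).
Proof.
elim: n F => [|n IHn] F sumF.
  have [[e0 _]|no_e] := pselect (exists e : {ffun 'I_0 -> I}, True); last first.
    by move=> N; exists [::] => e; case: no_e; exists e.
  move=> N; exists [:: e0] => e; rewrite inE => /eqP[].
  by apply/ffunP => -[].
apply: (summable_reindex (@ffcons_bij I n)).
apply: eq_summable (summable_pair (sumF ord0) (IHn _ (fun i => sumF (lift ord0 i)))).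
by move=> p; rewrite big_ord_recl ffcons0; congr (_ * _); apply: eq_bigr => i _;
  rewrite ffconsS.
Qed.

Lemma prod_Sum I n (F : 'I_n -> I -> fps R) :
  (forall i, summable (F i)) ->
  \prod_i Sum (F i) = Sum (fun e : {ffun 'I_n -> I} => \prod_i F i (e i)).
Proof.
elim: n F => [|n IHn] F sumF.
  (* The unique function out of ['I_0], written without an inhabitant of [I]. *)
  rewrite big_ord0 (@Sum_single _ _ [ffun i : 'I_0 => False_rect I (notF (ltn_ord i))]).
    by rewrite big_ord0.
  by move=> e /eqP[]; apply/ffunP => -[].
rewrite (reindex_Sum _ (@ffcons_bij I n)) big_ord_recl.
rewrite (IHn _ (fun i => sumF (lift ord0 i))) Sum_mul //;
  last exact: (summable_prod (fun i => sumF (lift ord0 i))).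
by apply: eq_Sum => p; rewrite big_ord_recl ffcons0; congr (_ * _);
  apply: eq_bigr => i _; rewrite ffconsS.
Qed.

End InfiniteSums.

Notation qser := (fps rat).

Lemma nat_fps_neq0 n : (0 < n)%N -> (n%:R : qser) <> 0.
Proof.
move=> n_gt0 /(congr1 (@fcoef _ ^~ 0%N)); rewrite coef_fpsMn /= => /eqP.
by rewrite pnatr_eq0 => /eqP n0; rewrite n0 in n_gt0.
Qed.

Lemma int_fps_neq0 (z : int) : z != 0 -> (z%:~R : qser) <> 0.
Proof.
move=> z0 /(congr1 (@fcoef _ ^~ 0%N)); rewrite coef_fpsMz /= => /eqP.
by rewrite intr_eq0 (negPf z0).
Qed.

Lemma fps_natI n (f g : qser) : (0 < n)%N -> n%:R * f = n%:R * g -> f = g.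
Proof. by move=> /nat_fps_neq0; apply: fps_mulfI. Qed.

(** * Partial fractions for products of reciprocal hyperbolic sines *)

Section PartialFractions.
Variables (W V : int -> qser).
Hypothesis W_odd : forall a, W (- a) = - W a.
Hypothesis W_mul : forall a b, a != 0 -> b != 0 -> a != b ->
  2%:R * (W a * W b) = W (b - a) * (V a - V b).

Let C (s : seq int) i := \prod_(j <- s | j != i) W (j - i).

Let C_shift s b i : C [seq x - b | x <- s] (i - b) = C s i.
Proof.
rewrite /C big_map; apply: eq_big => [j|j _]; first by rewrite (inj_eq (addIr _)).
by congr W; ring.
Qed.

Let sum_shift (f : int -> qser) b s :
  \sum_(i <- [seq x - b | x <- s])
     f i * \prod_(j <- [seq x - b | x <- s] | j != i) W (j - i)
  = \sum_(i <- s) f (i - b) * C s i.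
Proof. by rewrite big_map; apply: eq_bigr => i _; rewrite -(C_shift s b). Qed.

Let sum_cons (f : int -> qser) b s : b \notin s ->
  \sum_(i <- b :: s) f i * C (b :: s) i
  = f b * \prod_(j <- s) W (j - b) + \sum_(i <- s) f i * W (b - i) * C s i.
Proof.
move=> b_s; rewrite big_cons /C; congr (_ * _ + _).
  rewrite big_cons eqxx [LHS]big_seq_cond [RHS]big_seq_cond; apply: eq_bigl => j.
  by case: (boolP (j \in s)) => // j_s; rewrite (memPn b_s).
rewrite [LHS]big_seq_cond [RHS]big_seq_cond.
apply: eq_bigr => i /andP[i_s _]; rewrite big_cons ifT ?mulrA //.
by rewrite eq_sym (memPn b_s).
Qed.

(** Here W a models 1/(2 sinh ta) and V a models coth ta; [W_mul] is the subtraction formula for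
    coth. The two parities are proved together: removing one element b turns a statement of one
    parity into two of the other, one for the rest of the list and one for the rest translated by
    -b. The correction term concerns the empty list only and cancels in the difference of two even
    statements. *)
Lemma partial_fractions_seq (s : seq int) : uniq s -> 0 \notin s ->
  if odd (size s) then
    \sum_(i <- s) W i * \prod_(j <- s | j != i) W (j - i) = \prod_(i <- s) W i
  else \sum_(i <- s) V i * \prod_(j <- s | j != i) W (j - i)
       = 2%:R * \prod_(i <- s) W i - 2%:R * (size s == 0%N)%:R.
Proof.
have [n] := ubnP (size s); elim: n s => // n IHn [|b s] size_s uniq_bs nz_bs.
  by rewrite /= !big_nil mulr1 subrr.
move: uniq_bs; rewrite cons_uniq => /andP[b_s uniq_s].
move: nz_bs; rewrite inE negb_or eq_sym => /andP[b0 nz_s].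
have {}IHn t : (size t <= size s)%N -> uniq t -> 0 \notin t -> _ :=
  fun le_ts => IHn t (leq_ltn_trans le_ts (ltnSE size_s)).
have := IHn s (leqnn _) uniq_s nz_s.
have := IHn [seq x - b | x <- s].
rewrite size_map leqnn map_inj_uniq; last exact: addIr.
have -> : 0 \notin [seq x - b | x <- s].
  by apply: contra b_s => /mapP [x x_s /eqP]; rewrite eq_sym subr_eq0 => /eqP <-.
move=> /(_ isT uniq_s isT); rewrite oddS !(sum_cons _ b_s).
rewrite !sum_shift !big_map.
have mem_s i : i \in s -> [/\ i != 0, i - b != 0 & i != b].
  move=> i_s; rewrite subr_eq0; have ib : i != b by rewrite (memPn b_s).
  by split=> //; apply: contra nz_s => /eqP <-.
rewrite big_cons /=; case: (boolP (odd (size s))) => _ /= IHb IH0.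
  rewrite mulr0 subr0.
  (* [W_mul] for i and b trades V i W(b - i) for 2 W i W b + V b W(b - i). *)
  have -> : \sum_(i <- s) V i * W (b - i) * C s i =
     2%:R * W b * (\sum_(i <- s) W i * C s i) + V b * \sum_(i <- s) W (b - i) * C s i.
    rewrite !mulr_sumr -big_split /= big_seq [RHS]big_seq.
    apply: eq_bigr => i /mem_s[i0 _ ib].
    have := W_mul i0 b0 ib; rewrite mulrBr => /eqP; rewrite eq_sym subr_eq => /eqP e.
    by rewrite [V i * _]mulrC e; ring.
  have -> : \sum_(i <- s) W (b - i) * C s i = - \prod_(j <- s) W (j - b).
    rewrite -IHb -sumrN; apply: eq_bigr => i _.
    by rewrite -mulNr -W_odd opprB.
  by rewrite (IH0 : \sum_(i <- s) W i * C s i = _); ring.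
apply: (@fps_natI 2) => //; rewrite mulrDr.
(* [W_mul] is applied to i and i - b, whose difference does not depend on i. *)
have -> : 2%:R * (\sum_(i <- s) W i * W (b - i) * C s i) =
   W b * (\sum_(i <- s) V i * C s i - \sum_(i <- s) V (i - b) * C s i).
  rewrite -sumrB !mulr_sumr big_seq [RHS]big_seq.
  apply: eq_bigr => i /mem_s[i0 ib0 ib].
  have := W_mul i0 ib0; rewrite -subr_eq0 opprB addrC subrK => /(_ b0).
  have -> : i - b - i = - b by ring.
  rewrite W_odd => e; have -> : W (b - i) = - W (i - b) by rewrite -W_odd opprB.
  have -> : 2%:R * (W i * - W (i - b) * C s i) = - (2%:R * (W i * W (i - b))) * C s i.
    by ring.
  by rewrite e; ring.
by rewrite (IH0 : \sum_(i <- s) V i * C s i = _) IHb; ring.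
Qed.

Lemma partial_fractions n (e : 'I_n -> int) : odd n -> injective e ->
  (forall i, e i != 0) ->
  \prod_i W (e i) = \sum_i W (e i) * \prod_(j | j != i) W (e j - e i).
Proof.
move=> odd_n inj_e nz_e; have := @partial_fractions_seq (map e (index_enum 'I_n)).
have -> : size [seq e i | i <- index_enum 'I_n] = n.
  by rewrite size_map -[index_enum _]enumT size_enum_ord.
rewrite odd_n map_inj_uniq ?index_enum_uniq //.
have -> : 0 \notin [seq e i | i <- index_enum 'I_n].
  by apply/mapP => -[i _ /esym/eqP]; apply/negP.
move=> /(_ isT isT); rewrite !big_map => <-.
apply: eq_bigr => i _; rewrite big_map.
by congr (_ * _); apply: eq_bigl => j; rewrite (inj_eq inj_e).
Qed.

End PartialFractions.

(** * The series for 1/(q^-e - q^e), 1/(q^-e + q^e), coth and tanh, and their product formulas *)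

Notation qX := (fpsX rat).

(* [1 / (q^-e - q^e)], expanded at q = 0. *)
Definition wser (e : int) : qser :=
  Fps (fun n => (sgz e)%:~R * ((`|e| %| n) && odd (n %/ `|e|))%N%:R).

(* [(q^-e + q^e) / (q^-e - q^e) = sgz e + 2 * vtail e]. *)
Definition vtail (e : int) : qser :=
  Fps (fun n => (sgz e)%:~R * ((0 < n) && (2 * `|e| %| n))%N%:R).

(* [1 / (q^-e + q^e)], expanded at q = 0. *)
Definition xser (e : int) : qser :=
  Fps (fun n => if e == 0 then (n == 0)%N%:R / 2 else
    ((`|e| %| n) && odd (n %/ `|e|))%N%:R * (-1) ^+ (n %/ `|e|)./2).

(* [(q^-e - q^e) / (q^-e + q^e) = sgz e + 2 * ytail e]. *)
Definition ytail (e : int) : qser :=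
  Fps (fun n => (sgz e)%:~R * ((0 < n) && (2 * `|e| %| n))%N%:R
                * (-1) ^+ (n %/ (2 * `|e|))).

Lemma wserN e : wser (- e) = - wser e.
Proof. by apply: fpsP => n /=; rewrite sgzN abszN mulrNz mulNr. Qed.

Lemma vtailN e : vtail (- e) = - vtail e.
Proof. by apply: fpsP => n /=; rewrite sgzN abszN mulrNz mulNr. Qed.

Lemma xserN e : xser (- e) = xser e.
Proof. by apply: fpsP => n /=; rewrite oppr_eq0 abszN. Qed.

Lemma ytailN e : ytail (- e) = - ytail e.
Proof. by apply: fpsP => n /=; rewrite sgzN abszN mulrNz !mulNr. Qed.

Lemma wser_ord e : ord_ge `|e|%N (wser e).
Proof.
move=> n lt_ne /=; have [->|e0] := eqVneq e 0; first by rewrite sgz0 mul0r.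
by rewrite divn_small // andbF mulr0.
Qed.

Lemma vtail_ord e : ord_ge `|e|%N (vtail e).
Proof.
move=> n lt_ne /=; case: n lt_ne => [|n] lt_ne; first by rewrite mulr0.
by rewrite gtnNdvd ?mulr0 //; lia.
Qed.

Lemma xser_ord e : ord_ge `|e|%N (xser e).
Proof.
move=> n lt_ne /=; have [e0|e0] := eqVneq e 0; first by rewrite e0 in lt_ne.
by rewrite divn_small // andbF mul0r.
Qed.

Lemma ytail_ord e : ord_ge `|e|%N (ytail e).
Proof.
move=> n lt_ne /=; case: n lt_ne => [|n] lt_ne; first by rewrite mulr0 mul0r.
by rewrite gtnNdvd ?mulr0 ?mul0r //; lia.
Qed.

(** This lemma and the next three express the four series as fractions with cleared denominators,
    the form needed for the product formulas. *)
Lemma wser_inv k : (0 < k)%N -> wser k%:Z * (1 - qX (2 * k)%N) = qX k.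
Proof.
move=> k_gt0; apply: fpsP => n; rewrite mulrBr mulr1 mulrC coef_fpsB coef_fpsXM /=.
rewrite gtr0_sgz ?ltz_nat // !mul1r.
have [le_kn|lt_nk] := leqP (2 * k) n; last first.
  rewrite subr0; have [/dvdnP[c n_eq]|n_k] := boolP (k %| n)%N.
    rewrite n_eq mulnK //=; move: lt_nk; rewrite n_eq ltn_pmul2r //.
    by case: c {n_eq} => [|[|c]] // _; rewrite ?mul1n ?eqxx // mul0n; case: k k_gt0.
  by case: eqP n_k => // ->; rewrite dvdnn.
have -> : (n == k) = false by lia.
rewrite dvdn_subl ?dvdn_mull //; have [/dvdnP[c n_eq]|//] := boolP (k %| n)%N.
  by rewrite n_eq -mulnBl !mulnK //= oddB ?addbF ?subrr //; nia.
Qed.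

Lemma vser_inv k : (0 < k)%N ->
  (1 + 2%:R * vtail k%:Z) * (1 - qX (2 * k)%N) = 1 + qX (2 * k)%N.
Proof.
move=> k_gt0; suff vk : vtail k%:Z * (1 - qX (2 * k)%N) = qX (2 * k)%N.
  by rewrite mulrDl mul1r -mulrA vk; ring.
apply: fpsP => n; rewrite mulrBr mulr1 mulrC coef_fpsB coef_fpsXM /=.
rewrite gtr0_sgz ?ltz_nat // !mul1r.
have [le_kn|lt_nk] := leqP (2 * k) n; last first.
  rewrite subr0 ltn_eqF //; case: n lt_nk => // n lt_nk.
  by rewrite gtnNdvd.
rewrite dvdn_subl ?dvdnn // subn_gt0.
have -> : (0 < n)%N by lia.
have [->|ne_n] := eqVneq n (2 * k)%N; first by rewrite dvdnn ltnn subr0.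
by have -> : (2 * k < n)%N by [rewrite ltn_neqAle eq_sym ne_n]; rewrite subrr.
Qed.

Lemma xser_inv k : xser k%:Z * (1 + qX (2 * k)%N) = qX k.
Proof.
apply: fpsP => n; rewrite mulrDr mulr1 mulrC coef_fpsD coef_fpsXM /=.
have [[->]|k0] := eqVneq k%:Z 0.
  by rewrite muln0 leq0n subn0; field.
have {}k_gt0 : (0 < k)%N by lia.
have [le_kn|lt_nk] := leqP (2 * k) n; last first.
  rewrite addr0; have [/dvdnP[c n_eq]|n_k] := boolP (k %| n)%N.
    rewrite n_eq mulnK //=; move: lt_nk; rewrite n_eq ltn_pmul2r //.
    case: c {n_eq} => [|[|c]] // _; rewrite ?mul1n ?eqxx ?mulr1 //.
    by rewrite mul0n; case: k k_gt0 {k0}.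
  by case: eqP n_k => [->|_]; rewrite ?dvdnn // mul0r.
have -> : (n == k) = false by lia.
rewrite dvdn_subl ?dvdn_mull //; have [/dvdnP[c n_eq]|//] := boolP (k %| n)%N; last first.
  by rewrite !mul0r addr0.
rewrite n_eq -mulnBl !mulnK //= oddB ?addbF; last by nia.
have -> : c./2 = (c - 2)./2.+1 by nia.
by rewrite exprS; ring.
Qed.

Lemma yser_inv k :
  ((sgz k%:Z)%:~R + 2%:R * ytail k%:Z) * (1 + qX (2 * k)%N) = 1 - qX (2 * k)%N.
Proof.
have [->|k_gt0] := posnP k.
  have -> : ytail 0%:Z = 0 by apply: fpsP => n /=; rewrite mul0r mul0r.
  by rewrite sgz0 muln0 fpsX0 subrr; ring.
rewrite gtr0_sgz ?ltz_nat //.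
suff yk : ytail k%:Z * (1 + qX (2 * k)%N) = - qX (2 * k)%N.
  by rewrite mulrDl -mulrA yk; ring.
apply: fpsP => n; rewrite mulrDr mulr1 mulrC coef_fpsD coef_fpsXM /=.
rewrite gtr0_sgz ?ltz_nat // !mul1r.
have [le_kn|lt_nk] := leqP (2 * k) n; last first.
  rewrite addr0 ltn_eqF //; case: n lt_nk => [|n] lt_nk; first by rewrite mul0r oppr0.
  by rewrite gtnNdvd // mul0r oppr0.
rewrite dvdn_subl ?dvdnn // subn_gt0.
have -> : (0 < n)%N by lia.
have [->|ne_n] := eqVneq n (2 * k)%N.
  by rewrite dvdnn ltnn divnn muln_gt0 k_gt0 mul0r; ring.
have -> : (2 * k < n)%N by [rewrite ltn_neqAle eq_sym ne_n].
have [/dvdnP[c n_eq]|_] := boolP (2 * k %| n)%N; last first.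
  by rewrite !mul0r addr0 oppr0.
have -> : ((n - 2 * k) %/ (2 * k))%N = c.-1.
  by rewrite n_eq -[X in (_ - X)%N]mul1n -mulnBl mulnK ?subn1 // muln_gt0.
rewrite n_eq mulnK ?muln_gt0 //; case: c n_eq => [|c] n_eq; first by lia.
by rewrite exprS /=; ring.
Qed.

Lemma fps_coef0_neq0 (f : qser) : fcoef f 0 != 0 -> f <> 0.
Proof. by move=> f0 /(congr1 (@fcoef _ ^~ 0%N)) /eqP; apply/negP. Qed.

Lemma one_sub_qX_neq0 k : (0 < k)%N -> 1 - qX k <> 0.
Proof.
by move=> k_gt0; apply: fps_coef0_neq0; 
  rewrite coef_fpsB /= (ltn_eqF k_gt0) subr0 oner_eq0.
Qed.

Section ProductToDifference.
Variables (c : qser) (S T : int -> qser) (ok : pred nat).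
Hypothesis c_sq : c * c = 1.
Hypothesis S_opp : forall a, S (- a) = - c * S a.
Hypothesis T_opp : forall a, T (- a) = - T a.
Hypothesis ok_neq0 : forall k, ok k -> 1 - c * qX (2 * k)%N <> 0.
Hypothesis S_inv : forall k, ok k -> S k%:Z * (1 - c * qX (2 * k)%N) = qX k.
Hypothesis T_inv : forall k, ok k ->
  T k%:Z * (1 - c * qX (2 * k)%N) = 1 + c * qX (2 * k)%N.

Let mul_lt (k l : nat) : ok k -> ok l -> (k < l)%N ->
  2%:R * (S k * S l) = c * (wser (l%:Z - k%:Z) * (T k - T l)).
Proof.
move=> ok_k ok_l lt_kl; have -> : l%:Z - k%:Z = (l - k)%N%:Z by lia.
have [m_gt0 l_eq] : (0 < l - k)%N /\ l = (k + (l - k))%N by split; lia.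
have := wser_inv m_gt0; have := S_inv ok_k; have := S_inv ok_l.
have := T_inv ok_k; have := T_inv ok_l; have nz_m : 1 - qX (2 * (l - k))%N <> 0.
  by apply: one_sub_qX_neq0; rewrite muln_gt0.
move=> Tl Tk Sl Sk Wm.
apply: (fps_mulfI (ok_neq0 ok_k)); apply: (fps_mulfI (ok_neq0 ok_l)).
apply: (fps_mulfI nz_m).
transitivity (2%:R * (1 - qX (2 * (l - k))%N)
  * (S k * (1 - c * qX (2 * k)%N)) * (S l * (1 - c * qX (2 * l)%N))); first by ring.
transitivity (c * (wser (l - k)%N * (1 - qX (2 * (l - k))%N))
  * ((T k * (1 - c * qX (2 * k)%N)) * (1 - c * qX (2 * l)%N)
     - (T l * (1 - c * qX (2 * l)%N)) * (1 - c * qX (2 * k)%N))); last by ring.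
rewrite Tl Tk Sl Sk Wm.
have -> : qX l = qX k * qX (l - k)%N by rewrite -fpsXD -l_eq.
have -> : qX (2 * l)%N = qX (2 * k)%N * qX (2 * (l - k))%N by rewrite -fpsXD; congr fpsX; lia.
rewrite ![(2 * _)%N]mulnC !fpsXM.
rewrite [RHS](_ : _ = 2%:R * (c * c) * qX k ^+ 2 * qX (l - k)%N * (1 - qX (l - k)%N ^+ 2)).
  by rewrite c_sq; ring.
by ring.
Qed.

Let mul_neg (k l : nat) : ok k -> ok l -> (0 < k + l)%N ->
  2%:R * (S (- k%:Z) * S l) = c * (wser (l%:Z + k%:Z) * (T (- k%:Z) - T l)).
Proof.
move=> ok_k ok_l kl_gt0; rewrite -PoszD.
have lk_gt0 : (0 < l + k)%N by rewrite addnC.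
have := wser_inv lk_gt0; have := S_inv ok_k; have := S_inv ok_l.
have := T_inv ok_k; have := T_inv ok_l; have nz_m : 1 - qX (2 * (l + k))%N <> 0.
  by apply: one_sub_qX_neq0; rewrite muln_gt0.
move=> Tl Tk Sl Sk Wm; rewrite S_opp T_opp.
apply: (fps_mulfI (ok_neq0 ok_k)); apply: (fps_mulfI (ok_neq0 ok_l)).
apply: (fps_mulfI nz_m).
transitivity (- c * (2%:R * (1 - qX (2 * (l + k))%N)
  * (S k * (1 - c * qX (2 * k)%N)) * (S l * (1 - c * qX (2 * l)%N)))); first by ring.
transitivity (- c * (wser (l + k)%N * (1 - qX (2 * (l + k))%N))
  * ((T k * (1 - c * qX (2 * k)%N)) * (1 - c * qX (2 * l)%N)
     + (T l * (1 - c * qX (2 * l)%N)) * (1 - c * qX (2 * k)%N))); last by ring.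
rewrite Tl Tk Sl Sk Wm mulnDr [qX (l + _)%N]fpsXD [qX (2 * l + _)%N]fpsXD.
rewrite ![(2 * _)%N]mulnC !fpsXM.
rewrite [RHS](_ : _ = - c * (2%:R * (qX k * qX l) * (1 - (c * c) * (qX l ^+ 2 * qX k ^+ 2)))).
  by rewrite c_sq; ring.
by ring.
Qed.

(** One formula for both hyperbolic cases: c = 1 is 1/(q^-a - q^a) with coth, c = -1 is 1/(q^-a +
    q^a) with tanh. Parity of S and T reduces to arguments of the form |a|, |b|; after cancelling
    the denominators what remains is a polynomial identity in powers of q. For c = 1 the predicate
    [ok] has to exclude 0, where 1 - q^0 vanishes. *)
Lemma product_to_difference a b : a != b -> ok `|a|%N -> ok `|b|%N ->
  2%:R * (S a * S b) = c * (wser (b - a) * (T a - T b)).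
Proof.
wlog lt_ab : a b / a < b => [IH|] ne_ab ok_a ok_b.
  have [lt_ab|lt_ba|/eqP] := ltgtP a b; [exact: IH| |by rewrite (negPf ne_ab)].
  rewrite [S a * _]mulrC IH // 1?eq_sym //; congr (c * _).
  by rewrite -opprB wserN mulNr -mulrN opprB.
have S2 x y : S (- x) * S (- y) = S x * S y.
  by rewrite !S_opp mulrACA mulrNN c_sq mul1r.
have [a0|a0] := leP 0 a.
  have [ea eb] : a = `|a|%N%:Z /\ b = `|b|%N%:Z by split; lia.
  by rewrite ea eb; apply: mul_lt => //; lia.
have [b0|b0] := leP 0 b.
  have [ea eb] : a = - `|a|%N%:Z /\ b = `|b|%N%:Z by split; lia.
  by rewrite ea eb opprK; apply: mul_neg => //; lia.
have [ea eb] : a = - `|a|%N%:Z /\ b = - `|b|%N%:Z by split; lia.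
rewrite ea eb S2 [S _ * _]mulrC mul_lt //; last by lia.
by rewrite !T_opp; congr (c * (wser _ * _)); ring.
Qed.

End ProductToDifference.

Definition vser (e : int) : qser := (sgz e)%:~R + 2%:R * vtail e.
Definition yser (e : int) : qser := (sgz e)%:~R + 2%:R * ytail e.

Lemma vserN e : vser (- e) = - vser e.
Proof. by rewrite /vser vtailN sgzN mulrNz mulrN opprD. Qed.

Lemma yserN e : yser (- e) = - yser e.
Proof. by rewrite /yser ytailN sgzN mulrNz mulrN opprD. Qed.

Lemma wser_mul a b : a != 0 -> b != 0 -> a != b ->
  2%:R * (wser a * wser b) = wser (b - a) * (vser a - vser b).
Proof.
move=> a0 b0 ne_ab.
rewrite (@product_to_difference 1 wser vser (fun k => 0 < k)%N) ?mul1r ?absz_gt0 //.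
- by move=> e; rewrite wserN mulN1r.
- exact: vserN.
- by move=> k k_gt0; rewrite mul1r; apply: one_sub_qX_neq0; rewrite muln_gt0.
- by move=> k k_gt0; rewrite mul1r wser_inv.
- by move=> k k_gt0; rewrite !mul1r /vser gtr0_sgz ?ltz_nat // vser_inv.
Qed.

Lemma xser_mul a b : a != b ->
  2%:R * (xser a * xser b) = - (wser (b - a) * (yser a - yser b)).
Proof.
move=> ne_ab; rewrite (@product_to_difference (- 1) xser yser xpredT) ?mulN1r //.
- by rewrite opprK.
- by move=> e; rewrite xserN opprK mul1r.
- exact: yserN.
- move=> k _; apply: fps_coef0_neq0; rewrite mulN1r opprK coef_fpsD /=.
  by rewrite -natrD pnatr_eq0.
- by move=> k _; rewrite mulN1r opprK xser_inv.
- by move=> k _; rewrite mulN1r opprK yser_inv.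
Qed.

(** * Sums over residue classes and their convolutions *)

Lemma summable_int (F : int -> qser) :
  (forall a, ord_ge `|a|%N (F a)) -> summable F.
Proof.
move=> F_ord N; exists ([seq n%:Z | n <- iota 0 N] ++ [seq - n%:Z | n <- iota 0 N]).
move=> a; rewrite mem_cat => /norP[a_pos a_neg]; apply: ord_geW (F_ord a).
rewrite leqNgt; apply/negP => lt_aN.
have [a0|a0] := leP 0 a.
  by case/mapP: a_pos; exists `|a|%N; rewrite ?mem_iota //; lia.
by case/mapP: a_neg; exists `|a|%N; rewrite ?mem_iota //; lia.
Qed.

Lemma dvdz_addl_eq (M a b : int) : (M %| b)%Z -> (M %| a + b)%Z = (M %| a)%Z.
Proof. by move=> dvd_b; rewrite rpredDr //; apply: dvd_b. Qed.

Lemma dvdz_oppr (M a : int) : (M %| - a)%Z = (M %| a)%Z.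
Proof. by rewrite !dvdzE abszN. Qed.

Lemma shift_bij (g : int) : bijective (fun a : int => a + g).
Proof. by exists (fun a => a - g) => a; rewrite ?addrK ?subrK. Qed.

Lemma opp_bij : bijective (fun a : int => - a).
Proof. by exists (fun a => - a) => a; rewrite opprK. Qed.

Section ResidueClassSums.
Variable M : nat.
Implicit Types (r s g a : int) (F : int -> qser).

(** Extension by zero keeps [int] as index type, so that translating a class is a mere
    reindexing. *)
Definition on_class r F a : qser := if (M %| a - r)%Z then F a else 0.

Lemma on_class_ord r F k a : ord_ge k (F a) -> ord_ge k (on_class r F a).
Proof. by rewrite /on_class; case: ifP. Qed.

Lemma summable_on_class r F : summable F -> summable (on_class r F).
Proof. by apply: summable_sub => a N; apply: on_class_ord. Qed.

Lemma on_class_mod r s F : (M %| r - s)%Z -> on_class r F = on_class s F.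
Proof.
move=> rs; apply: funext => a; rewrite /on_class.
have -> : a - s = (a - r) + (r - s) by ring.
by rewrite [in RHS](dvdz_addl_eq _ rs).
Qed.

Lemma on_classE r F G : (forall a, (M %| a - r)%Z -> F a = G a) ->
  on_class r F = on_class r G.
Proof. by move=> FG; apply: funext => a; rewrite /on_class; case: ifP => // /FG. Qed.

Lemma on_class_shift r g F a :
  on_class r (fun a => F (a + g)) a = on_class (r + g) F (a + g).
Proof. by rewrite /on_class opprD addrACA subrr addr0. Qed.

Lemma Sum_on_class_shift r g F :
  Sum (on_class r (fun a => F (a + g))) = Sum (on_class (r + g) F).
Proof.
rewrite [RHS](reindex_Sum _ (shift_bij g)); apply: eq_Sum => a.
exact: on_class_shift.
Qed.

Lemma Sum_on_class_odd r F : (forall a, F (- a) = - F a) -> summable F ->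
  Sum (on_class (- r) F) = - Sum (on_class r F).
Proof.
move=> F_odd sumF; rewrite (reindex_Sum _ opp_bij) -SumN.
  apply: eq_Sum => a; rewrite /on_class -opprD dvdz_oppr F_odd.
  by case: ifP => //; rewrite oppr0.
exact: summable_on_class.
Qed.

(** The functions coth and tanh have leading terms ±1 and are not summable over a class, but their
    differences T a - T (a + g) are. This finite sum collects what the leading terms contribute; it
    is a cocycle in g ([sgn_shiftD]). *)
Definition sgn_shift r g := Sum (on_class r (fun a => (sgz a - sgz (a + g))%:~R)).

Lemma summable_sgn_shift g :
  summable (fun a : int => (sgz a - sgz (a + g))%:~R : qser).
Proof.
apply: (@summable_seq _ _ _ ([seq n%:Z | n <- iota 0 `|g|.+1] ++
                    [seq - n%:Z | n <- iota 0 `|g|.+1])).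
move=> a; rewrite mem_cat => /norP[a_pos a_neg].
suff -> : sgz a = sgz (a + g) by rewrite subrr.
have lt_ga : (`|g| < `|a|)%N.
  rewrite ltnNge; apply/negP => le_aN; have [a0|a0] := leP 0 a.
    by case/mapP: a_pos; exists `|a|%N; rewrite ?mem_iota //; lia.
  by case/mapP: a_neg; exists `|a|%N; rewrite ?mem_iota //; lia.
have [a0|a0|a0] := ltgtP 0 a; last by lia.
  by rewrite !gtr0_sgz //; lia.
by rewrite !ltr0_sgz //; lia.
Qed.

Lemma sgn_shiftD r g g' : sgn_shift r (g + g') = sgn_shift r g + sgn_shift (r + g) g'.
Proof.
rewrite /sgn_shift -Sum_on_class_shift -SumD.
- apply: eq_Sum => a; rewrite /on_class; case: ifP => _; last by rewrite addr0.
  by rewrite -intrD addrA; congr (_%:~R); ring.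
- exact: (summable_on_class _ (@summable_sgn_shift _)).
exact: (summable_on_class _ (summable_bij (shift_bij g) (@summable_sgn_shift _))).
Qed.

Lemma sgn_shift_mod r s g : (M %| r - s)%Z -> sgn_shift r g = sgn_shift s g.
Proof. by move=> rs; rewrite /sgn_shift (on_class_mod _ rs). Qed.

Lemma sgn_shift0 r : sgn_shift r 0 = 0.
Proof.
by apply: Sum0 => a; rewrite /on_class addr0 subrr mulr0z; case: ifP.
Qed.

Lemma sgn_shift_small r g : (0 < r)%R -> (0 <= g)%R -> (r + g < M)%R ->
  sgn_shift r g = 0.
Proof.
move=> r_gt0 g_ge0 rg_lt; apply: Sum0 => a; rewrite /on_class; case: ifP => //.
move=> /dvdzP[k a_eq].
have [k_ge0|k_lt0] := leP 0 k.
  by rewrite !gtr0_sgz ?subrr //; nia.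
by rewrite !ltr0_sgz ?subrr //; nia.
Qed.

(** In a class not containing 0, translation by M carries exactly one element across 0, namely r0 -
    M with r0 the residue in (0, M); its term is -1 - 1. *)
Lemma sgn_shift_period r : (0 < M)%N -> ~~ (M %| r)%Z -> sgn_shift r M = - 2%:R.
Proof.
move=> M_gt0 ndvd_r; have M0 : M%:Z != 0 by lia.
set r0 := (r %% M)%Z.
have r0_ge0 : 0 <= r0 by apply: modz_ge0.
have r0_lt : r0 < M by apply: ltz_pmod.
have r0_neq0 : r0 != 0 by apply: contra ndvd_r => /eqP/dvdz_mod0P.
have r_r0 : (M %| r - r0)%Z.
  by rewrite {1}(divz_eq r M) addrK dvdz_mull.
rewrite (sgn_shift_mod _ r_r0) /sgn_shift (@Sum_single _ _ _ (r0 - M%:Z)).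
  rewrite /on_class addrAC subrr add0r dvdz_oppr dvdzz subrK.
  by rewrite ltr0_sgz ?gtr0_sgz //; lia.
move=> a ne_a; rewrite /on_class; case: ifP => // /dvdzP[k a_eq].
have [k_ge0|k_lt0] := leP 0 k.
  by rewrite !gtr0_sgz ?subrr //; nia.
have [k_eq|k_ne] := eqVneq k (- 1).
  by case/eqP: ne_a; rewrite k_eq in a_eq; lia.
by rewrite !ltr0_sgz ?subrr //; nia.
Qed.

Lemma sgn_shift_multiple r (k : int) : (0 < M)%N -> ~~ (M %| r)%Z ->
  sgn_shift r (k * M%:Z) = - (2%:R * k%:~R).
Proof.
move=> M_gt0 ndvd_r.
have shift_nat s n : ~~ (M %| s)%Z -> sgn_shift s (n%:Z * M) = - (2%:R * n%:R).
  elim: n => [|n IHn] ndvd_s; first by rewrite mul0r sgn_shift0 mulr0 oppr0.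
  rewrite -addn1 PoszD mulrDl mul1r sgn_shiftD IHn //.
  rewrite sgn_shift_period // ?natrD; first by ring.
  by rewrite dvdz_addl_eq ?dvdz_mull.
have [k_ge0|k_lt0] := leP 0 k.
  have -> : k = `|k|%N by lia.
  exact: shift_nat.
have k_eq : k = - `|k|%N%:Z by lia.
have := sgn_shiftD r (`|k|%N%:Z * M) (k * M).
rewrite {2}k_eq mulNr subrr sgn_shift0 shift_nat //.
rewrite (@sgn_shift_mod (r + _) r); last by rewrite addrAC subrr add0r dvdz_mull.
move/esym/eqP; rewrite addrC addr_eq0 opprK => /eqP ->.
by rewrite {2}k_eq mulrNz mulrN opprK.
Qed.

Section DifferenceSum.
Variables (T U : int -> qser).
Hypothesis T_split : forall a, T a = (sgz a)%:~R + 2%:R * U a.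
Hypothesis U_summable : summable U.

Lemma summable_difference g : summable (fun a => T a - T (a + g)).
Proof.
apply: (@eq_summable _ _ (fun a => (sgz a - sgz (a + g))%:~R
                                   + 2%:R * (U a - U (a + g)))).
  by move=> a; rewrite !T_split intrB; ring.
apply: summableD; first exact: summable_sgn_shift.
apply: (summableMl (fun=> 2%:R)); apply: summableD => //; apply: summableN.
exact: summable_bij (shift_bij g) U_summable.
Qed.

Lemma Sum_difference r g :
  Sum (on_class r (fun a => T a - T (a + g))) =
  sgn_shift r g + 2%:R * (Sum (on_class r U) - Sum (on_class (r + g) U)).
Proof.
have sumUg := summable_bij (shift_bij g) U_summable.
rewrite -Sum_on_class_shift -SumB; [|exact: summable_on_class..].
rewrite -SumMl; last first.
  by apply: summableD; [|apply: summableN]; apply: summable_on_class.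
rewrite -SumD.
- apply: eq_Sum => a; rewrite /on_class; case: ifP => _; last by rewrite subrr mulr0 addr0.
  by rewrite !T_split intrB; ring.
- exact: (summable_on_class _ (@summable_sgn_shift _)).
apply: (summableMl (fun=> 2%:R)).
by apply: summableD; [|apply: summableN]; apply: summable_on_class.
Qed.

End DifferenceSum.

End ResidueClassSums.

Lemma summable_wser : summable wser.
Proof. exact: summable_int wser_ord. Qed.

Lemma summable_vtail : summable vtail.
Proof. exact: summable_int vtail_ord. Qed.

Lemma summable_xser : summable xser.
Proof. exact: summable_int xser_ord. Qed.

Lemma summable_ytail : summable ytail.
Proof. exact: summable_int ytail_ord. Qed.

Lemma fps_eq_opp0 (f : qser) : f = - f -> f = 0.
Proof.
move/eqP; rewrite -addr_eq0 -mulr2n => /eqP f2; apply: (@fps_natI 2) => //.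
by rewrite mulr0 mulr_natl.
Qed.

Lemma dvdz_subr (M a b : int) : (M %| a)%Z -> (M %| b)%Z -> (M %| a - b)%Z.
Proof. by move=> dvd_a dvd_b; apply: (rpredB dvd_a dvd_b). Qed.

Section Convolutions.
Variable M : nat.
Hypothesis M_gt0 : (0 < M)%N.

(** By the product formula the terms are w(kM) (V a - V (a + kM)) / 2. The tails of V cancel because
    the shift preserves the class, which leaves the sign contribution -2k. *)
Lemma Sum_wser_shift (r k : int) : ~~ (M %| r)%Z -> k != 0 ->
  Sum (fun a => on_class M r wser a * wser (a + k * M)) = - (k%:~R * wser (k * M)).
Proof.
move=> ndvd_r k0; apply: (@fps_natI 2) => //.
have sum2 : summable (fun a => on_class M r wser a * wser (a + k * M)).
  by apply: summableMr; apply: summable_on_class; apply: summable_wser.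
have kM0 : k * M%:Z != 0 by nia.
rewrite -SumMl //.
transitivity (Sum (fun a => wser (k * M) *
  on_class M r (fun a => vser a - vser (a + k * M)) a)).
  apply: eq_Sum => a; rewrite /on_class; case: ifP => [ar|_]; last by rewrite !(mul0r, mulr0).
  have nz s : (M %| s - r)%Z -> s != 0.
    by apply: contraTneq => ->; rewrite sub0r dvdz_oppr.
  rewrite wser_mul ?nz //; [by congr (wser _ * _); ring| |].
    by rewrite addrAC dvdz_addl_eq ?dvdz_mull.
  by rewrite -subr_eq0 opprD addNKr oppr_eq0.
have sumd := @summable_difference vser vtail (fun=> erefl) summable_vtail (k * M).
rewrite SumMl; last exact: summable_on_class.
rewrite (@Sum_difference M vser vtail (fun=> erefl) summable_vtail).
rewrite sgn_shift_multiple // (@on_class_mod M (r + k * M) r) ?subrr; first by ring.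
by rewrite addrAC subrr add0r dvdz_mull.
Qed.

(** After substituting b = a + g the product formula pulls out w(g); the remaining sum over a is a
    sign contribution plus a constant that depends only on the two classes. *)
Lemma Sum_on_class_mul (c : qser) (S T U : int -> qser) (r s : int) :
  summable S -> summable U -> (forall a, T a = (sgz a)%:~R + 2%:R * U a) ->
  (forall a b, (M %| a - r)%Z -> (M %| b - s)%Z ->
     2%:R * (S a * S b) = c * (wser (b - a) * (T a - T b))) ->
  2%:R * (Sum (on_class M r S) * Sum (on_class M s S)) =
  c * Sum (on_class M (s - r) (fun g => wser g *
     (sgn_shift M r g + 2%:R * (Sum (on_class M r U) - Sum (on_class M s U))))).
Proof.
move=> sumS sumU TU mulS.
have sumSr := summable_on_class M r sumS; have sumSs := summable_on_class M s sumS.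
have bij_h : bijective (fun p : int * int => (p.2, p.2 + p.1)).
  by exists (fun p => (p.2 - p.1, p.1)) => -[a b] /=; rewrite ?addrK ?subrKC // addrC addKr.
rewrite Sum_mul // (reindex_Sum _ bij_h) /=.
have sumP := summable_bij bij_h (summable_pair sumSr sumSs).
pose P g a := on_class M r S a * on_class M s S (a + g).
rewrite (@Sum_pair _ _ _ P) //.
rewrite -SumMl; last exact: (summable_outer (F := P) sumP).
rewrite -SumMl; last first.
  by apply: summable_on_class; apply: summableMr; apply: summable_wser.
apply: eq_Sum => g; rewrite -SumMl; last exact: (summable_inner (F := P) g sumP).
rewrite [on_class M (s - r) _ g]/on_class; case: ifP => [gsr|gsr]; last first.
  rewrite mulr0; apply: Sum0 => a; rewrite /P /on_class; case: ifP => ar; last by ring.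
  case: ifP => ags; last by ring.
  have : (M %| (a + g - s) - (a - r))%Z by apply: dvdz_subr.
  by have -> : a + g - s - (a - r) = g - (s - r) by [ring]; rewrite gsr.
transitivity (Sum (fun a => c * wser g * on_class M r (fun a => T a - T (a + g)) a)).
  apply: eq_Sum => a; rewrite /P /on_class; case: (boolP (M %| a - r)%Z) => ar; last by ring.
  have ags : (M %| a + g - s)%Z.
    have -> : a + g - s = (g - (s - r)) + (a - r) by ring.
    by rewrite dvdz_addl_eq.
  by rewrite ags mulS // [a + g]addrC addrK mulrA.
rewrite SumMl; last by apply: summable_on_class; apply: (summable_difference TU).
rewrite (Sum_difference _ TU) // mulrA; congr (_ * (_ + 2%:R * (_ - Sum _))).
apply: on_class_mod; have -> : r + g - s = g - (s - r) by ring.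
exact: gsr.
Qed.

End Convolutions.

Section HalfPeriod.
Variable d : nat.
Hypothesis d_gt0 : (0 < d)%N.

(** The class of d modulo 2d is its own opposite. *)
Lemma Sum_on_class_half (F : int -> qser) : (forall a, F (- a) = - F a) ->
  summable F -> Sum (on_class (2 * d)%N d F) = 0.
Proof.
move=> F_odd sumF; apply: fps_eq_opp0; rewrite -Sum_on_class_odd //.
rewrite (@on_class_mod (2 * d)%N (- d%:Z) d) //.
by rewrite -opprD dvdz_oppr; apply/dvdzP; exists 1; lia.
Qed.

Lemma Sum_on_class_zero (F : int -> qser) : (forall a, F (- a) = - F a) ->
  summable F -> Sum (on_class (2 * d)%N 0 F) = 0.
Proof.
move=> F_odd sumF; apply: fps_eq_opp0.
by rewrite -Sum_on_class_odd // oppr0.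
Qed.

Definition hser (r : int) := Sum (on_class (2 * d)%N r wser).

Lemma summable_id_wser : summable (fun a => a%:~R * wser a : qser).
Proof. by apply: summable_int => a; apply: ord_geMl; apply: wser_ord. Qed.

(** Since d - r is opposite to r + d modulo 2d, the left-hand side is a convolution of the classes r
    and r + d up to sign. For g = d + 2dk the sign contribution is -2k = 1 - g/d, so the coefficient
    of w(g) is affine in g, and its constant part disappears by [Sum_on_class_half]. The result does
    not depend on r. *)
Lemma hser_mul (r : int) : 0 < r -> r < d ->
  (2 * d)%:R * (hser r * hser (d%:Z - r)) =
  Sum (on_class (2 * d)%N d (fun a => a%:~R * wser a)).
Proof.
move=> r_gt0 r_lt; have d2_gt0 : (0 < 2 * d)%N by rewrite muln_gt0.
have -> : hser (d%:Z - r) = - hser (r + d).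
  rewrite -(Sum_on_class_odd _ _ wserN summable_wser).
  congr Sum; apply: on_class_mod.
  by apply/dvdzP; exists 1; lia.
have ndvd s : 0 < s -> s < 2 * d%:Z -> ~~ ((2 * d)%N %| s)%Z.
  move=> s0 sd; apply/negP => /dvdzP[k s_eq].
  by have [k_gt0|k_le0] := ltrP 0 k; nia.
have := @Sum_on_class_mul (2 * d)%N 1 wser vser vtail r (r + d)
  summable_wser summable_vtail (fun=> erefl).
have -> : r + d - r = d by ring.
rewrite !mul1r -!/(hser _) => conv.
have {}conv : 2%:R * (hser r * hser (r + d)) =
  Sum (on_class (2 * d)%N d (fun g => wser g *
     (sgn_shift (2 * d)%N r g + 2%:R * (Sum (on_class (2 * d)%N r vtail)
                    - Sum (on_class (2 * d)%N (r + d) vtail))))).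
  apply: conv => a b ar bs; rewrite mul1r wser_mul //.
  - by apply: contraTneq ar => ->; rewrite sub0r dvdz_oppr ndvd //; lia.
  - by apply: contraTneq bs => ->; rewrite sub0r dvdz_oppr ndvd //; lia.
  apply: contraTneq ar => ->; apply/negP => br.
  have : ((2 * d)%N %| (b - r) - (b - (r + d)))%Z by apply: dvdz_subr.
  by have -> : b - r - (b - (r + d)) = d by [ring]; apply/negP/ndvd; lia.
set cst := 2%:R * (_ - _) in conv.
have -> : (2 * d)%:R * (hser r * - hser (r + d)) =
          - (d%:R * (2%:R * (hser r * hser (r + d)))) by rewrite natrM; ring.
rewrite conv.
rewrite -SumMl; last first.
  by apply: summable_on_class; apply: summableMr; apply: summable_wser.
rewrite -SumN; last first.
  apply: (summableMl (fun=> d%:R)).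
  by apply: summable_on_class; apply: summableMr; apply: summable_wser.
transitivity (Sum (fun a => on_class (2 * d)%N d (fun a => a%:~R * wser a) a
   + (- (d%:R * (1 + cst))) * on_class (2 * d)%N d wser a)).
  apply: eq_Sum => g; rewrite /on_class; case: ifP => [/dvdzP[k]|_]; last by ring.
  move/eqP; rewrite subr_eq => /eqP ->.
  rewrite [k * _ + _]addrC sgn_shiftD sgn_shift_small //; [|lia..].
  rewrite sgn_shift_multiple //; last by apply: ndvd; lia.
  by rewrite intrD intrM -!pmulrn natrM; ring.
rewrite SumD; first last.
- by apply: (summableMl (fun=> _)); apply: summable_on_class; apply: summable_wser.
- by apply: summable_on_class; apply: summable_id_wser.
rewrite SumMl ?(Sum_on_class_half wserN summable_wser) ?mulr0 ?addr0 //.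
by apply: summable_on_class; apply: summable_wser.
Qed.

End HalfPeriod.

(** * Andréief's identity, Vandermonde products and Hankel determinants as multiple sums *)

Section Andreief.
Variables (R : idomainType) (I : choiceType) (n : nat).
Implicit Types (F G : 'I_n -> I -> fps R) (w : I -> fps R).

Definition ffperm (s : 'S_n) (e : {ffun 'I_n -> I}) : {ffun 'I_n -> I} :=
  [ffun i => e (s i)].

Lemma ffperm_bij s : bijective (ffperm s).
Proof.
by exists (ffperm s^-1) => e; apply/ffunP => i; rewrite !ffunE ?permK ?permKV.
Qed.

(** In the expansion of the first determinant each permutation only relabels the summation
    variables, which gives n! equal sums. In one of them the terms of the second determinant factor
    over the variables. *)
Lemma andreief F G w : summable w ->
  Sum (fun e : {ffun 'I_n -> I} =>
    \det (\matrix_(i, j) F j (e i)) * \det (\matrix_(i, j) G j (e i))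
    * \prod_i w (e i))
  = n`!%:R * \det (\matrix_(i, j) Sum (fun a => F i a * G j a * w a)).
Proof.
move=> sum_w.
have sum_prod (H : 'I_n -> I -> fps R) :
    summable (fun e : {ffun 'I_n -> I} => \prod_i (H i (e i) * w (e i))).
  by apply: (@summable_prod _ _ _ (fun i a => H i a * w a)) => i; apply: summableMl.
pose T (e : {ffun 'I_n -> I}) := \prod_k F k (e k) * \det (\matrix_(i, j) G j (e i)) * \prod_i w (e i).
have T_expand (e : {ffun 'I_n -> I}) :
    T e = \sum_(t : 'S_n) (-1) ^+ t * \prod_k (F k (e k) * G (t k) (e k) * w (e k)).
  rewrite /T /determinant mulr_sumr mulr_suml; apply: eq_bigr => t _.
  rewrite !big_split /=.
  have -> : \prod_i (\matrix_(i0, j) G j (e i0)) i (t i) = \prod_k G (t k) (e k).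
    by apply: eq_bigr => k _; rewrite mxE.
  by rewrite [X in X * _]mulrCA -!mulrA.
have sum_T : summable T.
  apply: eq_summable (fun e => esym (T_expand e)) _; apply: summable_sum => t _.
  by apply: (summableMl (fun=> _)); apply: (sum_prod (fun k a => F k a * G (t k) a)).
transitivity (\sum_(s : 'S_n) Sum (fun e => T (ffperm s^-1 e))).
  rewrite -Sum_sum => [|s _]; last exact: summable_bij (ffperm_bij _) sum_T.
  apply: eq_Sum => e; rewrite {1}/determinant !mulr_suml; apply: eq_bigr => s _.
  rewrite /T.
  have -> : \prod_i w (ffperm s^-1 e i) = \prod_i w (e i).
    by rewrite [RHS](reindex_perm s^-1); apply: eq_bigr => i _; rewrite ffunE.
  have -> : \prod_k F k (ffperm s^-1 e k) =
            \prod_i (\matrix_(i0, j) F j (e i0)) i (s i).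
    rewrite (reindex_perm s); apply: eq_bigr => i _.
    by rewrite ffunE permK mxE.
  have -> : \matrix_(i, j) G j (ffperm s^-1 e i) =
            row_perm s^-1 (\matrix_(i, j) G j (e i)).
    by apply/matrixP => i j; rewrite !mxE ffunE.
  by rewrite row_permE det_mulmx det_perm odd_permV mulrA [_ ^+ _ * _]mulrC.
rewrite (eq_bigr (fun=> Sum T)) => [|s _]; last first.
  by rewrite [RHS](reindex_Sum _ (ffperm_bij s^-1)).
rewrite sumr_const card_Sn mulr_natl; congr (_ *+ _).
rewrite (eq_Sum T_expand) Sum_sum => [|t _]; last first.
  by apply: (summableMl (fun=> _)); apply: (sum_prod (fun k a => F k a * G (t k) a)).
rewrite /determinant; apply: eq_bigr => t _; rewrite SumMl; last first.
  exact: (sum_prod (fun k a => F k a * G (t k) a)).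
congr (_ * _); rewrite -(@prod_Sum _ _ _ (fun k a => F k a * G (t k) a * w a)).
  by apply: eq_bigr => i _; rewrite mxE.
by move=> i; apply: summableMl.
Qed.

End Andreief.

Section VandermondeProducts.
Variable R : comNzRingType.

Definition vdm n (e : 'I_n -> R) : R :=
  \prod_(i < n) \prod_(j < n | (i < j)%N) (e j - e i).

Lemma det_vdm n (e : 'I_n -> R) : \det (\matrix_(i, j) e i ^+ (j : 'I_n)) = vdm e.
Proof.
rewrite -det_tr; transitivity (\det (Vandermonde n (\row_i e i))).
  by congr (\det _); apply/matrixP => i j; rewrite !mxE.
rewrite det_Vandermonde; apply: eq_bigr => i _; apply: eq_bigr => j _.
by rewrite !mxE.
Qed.

Lemma vdm_recl n (e : 'I_n.+1 -> R) :
  vdm e = \prod_i (e (lift ord0 i) - e ord0) * vdm (fun i => e (lift ord0 i)).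
Proof.
rewrite /vdm big_ord_recl; congr (_ * _).
  by rewrite big_mkcond big_ord_recl /= mul1r.
apply: eq_bigr => i _.
by rewrite big_mkcond big_ord_recl /= mul1r -big_mkcond.
Qed.

Lemma vdm_shift n (e : 'I_n -> R) c : vdm (fun i => e i + c) = vdm e.
Proof.
by do 2!(apply: eq_bigr => ? _); rewrite opprD addrACA subrr addr0.
Qed.

Lemma vdm_sqr_perm n (e : 'I_n -> R) (s : 'S_n) : vdm (fun i => e (s i)) ^+ 2 = vdm e ^+ 2.
Proof.
rewrite -!det_vdm; have -> : \matrix_(i, j) e (s i) ^+ (j : 'I_n) =
   row_perm s (\matrix_(i, j) e i ^+ (j : 'I_n)).
  by apply/matrixP => i j; rewrite !mxE.
by rewrite row_permE det_mulmx det_perm exprMn -exprM muln2 -addnn -signr_odd oddD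
  addbb expr0 mul1r.
Qed.

Lemma vdm_sqr_inj n (e : 'I_n -> R) : ~ injective e -> vdm e ^+ 2 = 0.
Proof.
move=> not_inj; suff [i [j [lt_ij eq_e]]] : exists i j : 'I_n, (i < j)%N /\ e i = e j.
  by rewrite /vdm (bigD1 i) //= (bigD1 j) //= eq_e subrr !mul0r expr0n.
apply: contrapT => no_ij; apply: not_inj => i j eq_e.
apply/val_inj; case: (ltngtP i j) => // lt_ij.
  by case: no_ij; exists i, j.
by case: no_ij; exists j, i.
Qed.

(* The column of n-th powers is the linear combination of the lower ones given
   by the coefficients of \prod_i (X - e i). *)
Lemma det_vdm_last n (e : 'I_n.+1 -> R) :
  \det (\matrix_(i, j < n.+1) e i ^+ (j + (j == n :> nat))) = (\sum_i e i) * vdm e.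
Proof.
pose p := \prod_(x <- [seq e i | i <- enum 'I_n.+1]) ('X - x%:P).
have size_s : size [seq e i | i <- enum 'I_n.+1] = n.+1 by rewrite size_map size_enum_ord.
pose C : 'M[R]_n.+1 := \matrix_(i, j) if j == n :> nat then - p`_i else (i == j)%:R.
have p_monic : p \is monic by apply: monic_prod_XsubC.
have size_p : size p = n.+2 by rewrite /p size_prod_XsubC size_s.
have -> : \matrix_(i, j < n.+1) e i ^+ (j + (j == n :> nat)) =
          \matrix_(i, j) e i ^+ (j : 'I_n.+1) *m C.
  apply/matrixP => i j; rewrite !mxE; case: (eqVneq (j : nat) n) => [jn|jn].
    have : p.[e i] = 0.
      rewrite /p horner_prod (big_rem (e i)) /=; last by rewrite map_f ?mem_enum.
      by rewrite hornerXsubC subrr mul0r.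
    rewrite horner_coef size_p big_ord_recr /=.
    have -> : p`_n.+1 = 1 by have := monicP p_monic; rewrite lead_coefE size_p.
    rewrite mul1r => /eqP; rewrite addrC addr_eq0 jn addn1 => /eqP ->.
    by rewrite -sumrN; apply: eq_bigr => k _; rewrite !mxE jn eqxx mulrN mulrC.
  rewrite addn0 (bigD1 j) //= !mxE (negPf jn) eqxx mulr1 big1 ?addr0 // => k /negPf ne_kj.
  by rewrite !mxE (negPf jn) ne_kj mulr0.
rewrite det_mulmx det_vdm mulrC; congr (_ * _).
rewrite -det_tr det_trig; last first.
  apply/is_trig_mxP => i j lt_ij; rewrite !mxE.
  have [i_n|_] := eqVneq (i : nat) n.
    by have := leq_trans lt_ij (ltnSE (ltn_ord j)); rewrite i_n ltnn.
  by case: eqP lt_ij => // ->; rewrite ltnn.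
rewrite big_ord_recr /= big1 ?mul1r => [|i _]; last first.
  by rewrite !mxE /= (ltn_eqF (ltn_ord i)) eqxx.
rewrite !mxE /= eqxx; have := @coefPn_prod_XsubC _ [seq e i | i <- enum 'I_n.+1].
rewrite size_s => /(_ isT) /= ->.
by rewrite opprK big_map big_enum.
Qed.

End VandermondeProducts.

Lemma vdm_int n (e : 'I_n -> int) : vdm (fun i => (e i)%:~R) = (vdm e)%:~R :> qser.
Proof. by rewrite /vdm !rmorph_prod; do 2!(apply: eq_bigr => ? _; rewrite ?rmorph_prod); rewrite rmorphB. Qed.

Definition mom (w : int -> qser) s := Sum (fun a => a%:~R ^+ s * w a).

Lemma summable_mom (w : int -> qser) s : summable w -> summable (fun a : int => a%:~R ^+ s * w a).
Proof. exact: summableMl. Qed.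

(** Andréief's identity for the monomials of degree less than n. *)
Lemma hankel_sum n (w : int -> qser) : summable w ->
  Sum (fun e : {ffun 'I_n -> int} => (vdm e ^+ 2)%:~R * \prod_i w (e i))
  = n`!%:R * \det (\matrix_(i < n, j < n) mom w (i + j)).
Proof.
move=> sumw; have := @andreief _ _ n (fun j a => a%:~R ^+ j) (fun j a => a%:~R ^+ j) w sumw.
have -> : \matrix_(i < n, j < n) mom w (i + j) =
   \matrix_(i, j) Sum (fun a : int => a%:~R ^+ i * a%:~R ^+ j * w a).
  by apply/matrixP => i j; rewrite !mxE; apply: eq_Sum => a; rewrite exprD.
move=> <-; apply: eq_Sum => e.
by rewrite det_vdm vdm_int rmorphXn.
Qed.

(** As [hankel_sum], with the last monomial raised by one degree in one of the two determinants; by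
    [det_vdm_last] this inserts the factor [\sum_i e i]. *)
Lemma hankel_shift_sum n (w : int -> qser) : summable w ->
  Sum (fun e : {ffun 'I_n.+1 -> int} =>
    (\sum_i e i)%:~R * (vdm e ^+ 2)%:~R * \prod_i w (e i))
  = n.+1`!%:R * \det (\matrix_(i < n.+1, j < n.+1) mom w (i + (j + (j == n :> nat)))).
Proof.
move=> sumw; have := @andreief _ _ n.+1 (fun j a => a%:~R ^+ j)
  (fun j a => a%:~R ^+ (j + (j == n :> nat))) w sumw.
have -> : \matrix_(i < n.+1, j < n.+1) mom w (i + (j + (j == n :> nat))) =
   \matrix_(i, j) Sum (fun a : int => a%:~R ^+ i * a%:~R ^+ (j + (j == n :> nat)) * w a).
  by apply/matrixP => i j; rewrite !mxE; apply: eq_Sum => a; rewrite [in LHS]exprD.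
move=> <-; apply: eq_Sum => e; rewrite det_vdm det_vdm_last vdm_int.
by rewrite -rmorph_sum /= rmorphXn mulrCA mulrA [X in X * _]mulrC -!mulrA mulrCA.
Qed.

(** * Relations between Hankel determinants of class moments *)

Section HankelReduction.
Variable M : nat.
Hypothesis M_gt0 : (0 < M)%N.

Let w r := on_class M r wser.
Let w2 a : qser := a%:~R ^+ 2 * w 0 a.

Let summable_w r : summable (w r).
Proof. by apply: summable_on_class; apply: summable_wser. Qed.

Let summable_w2 : summable w2.
Proof. exact: summableMl. Qed.

(** Both sides vanish unless all entries lie in the class of r: if e_i does and another entry does
    not, their difference is outside class 0. Inside the class no entry is 0, because M does not
    divide r. *)
Lemma prod_on_class (n : nat) (r : int) (e : 'I_n.+1 -> int) : odd n.+1 ->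
  ~~ (M %| r)%Z -> injective e ->
  \prod_i w r (e i) = \sum_i w r (e i) * \prod_(j | j != i) w 0 (e j - e i).
Proof.
move=> odd_n ndvd_r inj_e.
have [/forallP in_r|] := boolP [forall i, (M %| e i - r)%Z]; last first.
  rewrite negb_forall => /existsP [i0 /negPf i0_r].
  rewrite (bigD1 i0) //= {1}/w /on_class i0_r mul0r big1 // => i _.
  rewrite /w /on_class; case: ifP => [i_r|]; last by rewrite mul0r.
  have ne_i : i0 != i by apply: contraTneq i_r => <-; rewrite i0_r.
  rewrite (bigD1 i0) //= subr0; case: ifP => [i0i|]; last by rewrite mul0r mulr0.
  have : (M %| (e i0 - e i) + (e i - r))%Z by rewrite dvdz_addl_eq.
  by rewrite addrA subrK i0_r.
have wE i : w r (e i) = wser (e i) by rewrite /w /on_class in_r.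
have w0E i j : w 0 (e j - e i) = wser (e j - e i).
  rewrite /w /on_class subr0; have -> : e j - e i = (e j - r) - (e i - r) by ring.
  by rewrite dvdz_subr.
under eq_bigr do rewrite wE.
rewrite (partial_fractions wserN wser_mul odd_n inj_e).
  by apply: eq_bigr => i _; rewrite wE; congr (_ * _); apply: eq_bigr => j _.
move=> i; have := in_r i; apply: contraTneq => ->.
by rewrite sub0r dvdz_oppr.
Qed.

(** Coordinates centred at the first entry: (a, f) stands for (a, a + f_1, ..., a + f_n). *)
Definition cons_shift n (p : int * {ffun 'I_n -> int}) : {ffun 'I_n.+1 -> int} :=
  ffcons (p.1, [ffun j => p.2 j + p.1]).

Lemma cons_shift_bij n : bijective (@cons_shift n).
Proof.
pose h (p : int * {ffun 'I_n -> int}) := (p.1, [ffun j => p.2 j + p.1]).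
suff bij_h : bijective h by exact: bij_comp (@ffcons_bij _ n) bij_h.
exists (fun p : int * {ffun 'I_n -> int} => (p.1, [ffun j : 'I_n => p.2 j - p.1]))
  => -[a f] /=;
  by congr pair; apply/ffunP => j; rewrite !ffunE ?addrK ?subrK.
Qed.

Lemma vdm_cons_shift n (p : int * {ffun 'I_n -> int}) :
  vdm (cons_shift p) = \prod_j p.2 j * vdm p.2.
Proof.
rewrite vdm_recl ffcons0; congr (_ * _).
  by apply: eq_bigr => j _; rewrite ffconsS ffunE addrK.
rewrite -[RHS](vdm_shift _ p.1); apply: eq_bigr => i _; apply: eq_bigr => j _.
by rewrite !ffconsS !ffunE.
Qed.

(** The summand in centred coordinates. The squares of the f_j, which come from the Vandermonde
    product, are absorbed in the weight [w2]. *)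
Definition pair_summand n r (phi : {ffun 'I_n.+1 -> int} -> int)
    (p : int * {ffun 'I_n -> int}) : qser :=
  (phi (cons_shift p))%:~R * (w r p.1 * ((vdm p.2 ^+ 2)%:~R * \prod_j w2 (p.2 j))).

Lemma summable_pair_summand n r (phi : {ffun 'I_n.+1 -> int} -> int) :
  summable (pair_summand r phi).
Proof.
apply: summableMl; apply: (@summable_pair _ _ _ (w r) (fun f : {ffun 'I_n -> int} =>
  (vdm f ^+ 2)%:~R * \prod_j w2 (f j))) => //; apply: summableMl.
exact: (@summable_prod _ _ _ (fun=> w2)).
Qed.

Lemma Sum_odd_reduction n r (phi : {ffun 'I_n.+1 -> int} -> int) : odd n.+1 ->
  ~~ (M %| r)%Z -> (forall s e, phi (ffperm s e) = phi e) ->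
  Sum (fun e : {ffun 'I_n.+1 -> int} =>
    (phi e)%:~R * (vdm e ^+ 2)%:~R * \prod_i w r (e i))
  = n.+1%:R * Sum (pair_summand r phi).
Proof.
move=> odd_n ndvd_r phi_sym.
pose T i (e : {ffun 'I_n.+1 -> int}) : qser := (phi e)%:~R * (vdm e ^+ 2)%:~R *
  (w r (e i) * \prod_(j | j != i) w 0 (e j - e i)).
have T0_pair p : T ord0 (cons_shift p) = pair_summand r phi p.
  rewrite /T /pair_summand -mulrA; congr (_ * _).
  rewrite ffcons0 mulrCA; congr (_ * _).
  rewrite vdm_cons_shift exprMn rmorphM /= [X in X * _]mulrC -mulrA; congr (_ * _).
  rewrite rmorphXn rmorph_prod -prodrXl [X in _ * X = _]big_mkcond big_ord_recl /=.
  rewrite mul1r -big_split /=.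
  by apply: eq_bigr => j _; rewrite ffconsS ffunE addrK.
have sumT0 : summable (T ord0).
  apply: (summable_reindex (@cons_shift_bij n)).
  by apply: eq_summable (summable_pair_summand r phi) => p; rewrite T0_pair.
have T_perm i e : T i e = T ord0 (ffperm (tperm ord0 i) e).
  rewrite /T phi_sym ffunE tpermL; congr (_ * _ * _).
    rewrite -(vdm_sqr_perm e (tperm ord0 i)); congr (vdm _ ^+ 2)%:~R.
    by apply: funext => j; rewrite ffunE.
  congr (_ * _); rewrite (reindex_perm (tperm ord0 i)) /=.
  apply: eq_big => j; last by rewrite !ffunE.
  by rewrite (canF_eq (tpermK ord0 i)) tpermR.
transitivity (Sum (fun e => \sum_i T i e)).
  apply: eq_Sum => e; have [inj_e|not_inj] := pselect (injective e).
    by rewrite (prod_on_class odd_n ndvd_r inj_e) mulr_sumr.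
  rewrite (vdm_sqr_inj not_inj) mulr0z mulr0 mul0r big1 // => i _.
  by rewrite /T (vdm_sqr_inj not_inj) mulr0z mulr0 mul0r.
have sumT i : summable (T i).
  apply: eq_summable (fun e => esym (T_perm i e)) _.
  exact: (summable_bij (ffperm_bij _ (tperm ord0 i)) sumT0).
rewrite Sum_sum // (eq_bigr (fun=> Sum (T ord0))) => [|i _].
  rewrite sumr_const card_ord mulr_natl (reindex_Sum _ (@cons_shift_bij n)).
  by congr (_ *+ _); apply: eq_Sum.
by rewrite (eq_Sum (T_perm i)) -(reindex_Sum _ (ffperm_bij _ _)).
Qed.

Lemma Sum_first n (u : int -> qser) : summable u ->
  n.+1%:R * Sum (fun e : {ffun 'I_n.+1 -> int} =>
    (e ord0)%:~R * ((vdm e ^+ 2)%:~R * \prod_i u (e i)))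
  = Sum (fun e : {ffun 'I_n.+1 -> int} =>
    (\sum_i e i)%:~R * (vdm e ^+ 2)%:~R * \prod_i u (e i)).
Proof.
move=> sumu; pose T i (e : {ffun 'I_n.+1 -> int}) : qser :=
  (e i)%:~R * ((vdm e ^+ 2)%:~R * \prod_i u (e i)).
have sumT i : summable (T i).
  by do 2!apply: summableMl; apply: (@summable_prod _ _ _ (fun=> u)).
transitivity (Sum (fun e => \sum_i T i e)).
  rewrite Sum_sum // (eq_bigr (fun=> Sum (T ord0))) => [|i _].
    by rewrite sumr_const card_ord mulr_natl.
  rewrite [RHS](reindex_Sum _ (ffperm_bij _ (tperm ord0 i))); apply: eq_Sum => e.
  rewrite /T ffunE tpermL; congr (_ * (_ * _)).
    rewrite -(vdm_sqr_perm e (tperm ord0 i)); congr (vdm _ ^+ 2)%:~R.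
    by apply: funext => j; rewrite ffunE.
  by rewrite (reindex_perm (tperm ord0 i)); apply: eq_bigr => j _; rewrite ffunE.
by apply: eq_Sum => e; rewrite -mulr_suml -rmorph_sum mulrA.
Qed.

End HankelReduction.

Definition cmom M r s := mom (on_class M r wser) s.
Definition hankel (c : nat -> qser) n := \det (\matrix_(i < n, j < n) c (i + j)%N).
(* The Hankel determinant with its last column moved one step to the right. *)
Definition hankel_shift (c : nat -> qser) n :=
  \det (\matrix_(i < n, j < n) c (i + (j + (j.+1 == n)))%N).

Section HankelIdentities.
Variable M : nat.
Hypothesis M_gt0 : (0 < M)%N.

Let w r := on_class M r wser.
Let w2 a : qser := a%:~R ^+ 2 * w 0 a.

Let summable_w r : summable (w r).
Proof. by apply: summable_on_class; apply: summable_wser. Qed.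

Let summable_w2 : summable w2.
Proof. exact: summableMl. Qed.

Let mom_w2 s : mom w2 s = cmom M 0 (s + 2).
Proof. by apply: eq_Sum => a; rewrite mulrA -exprD. Qed.

Let sum_f n := Sum (fun f : {ffun 'I_n -> int} => (vdm f ^+ 2)%:~R * \prod_j w2 (f j)).

Let summable_f n :
  summable (fun f : {ffun 'I_n -> int} => (vdm f ^+ 2)%:~R * \prod_j w2 (f j)).
Proof. by apply: summableMl; apply: (@summable_prod _ _ _ (fun=> w2)). Qed.

Let sum_fE n : sum_f n = n`!%:R * hankel (fun s => cmom M 0 s.+2) n.
Proof.
rewrite /sum_f (hankel_sum _ summable_w2); congr (_ * \det _).
by apply/matrixP => i j; rewrite !mxE mom_w2 addn2.
Qed.

(** [Sum_odd_reduction] with [phi] constant: the sum over the base point and the sum over the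
    differences separate completely. *)
Lemma hankel_odd n r : odd n.+1 -> ~~ (M %| r)%Z ->
  hankel (cmom M r) n.+1 = hankel (fun s => cmom M 0 s.+2) n * cmom M r 0.
Proof.
move=> odd_n ndvd_r; apply: (@fps_natI n.+1`!); first exact: fact_gt0.
rewrite -[LHS](hankel_sum _ (summable_w r)).
have := @Sum_odd_reduction M n r (fun=> 1) odd_n ndvd_r (fun _ _ => erefl).
under eq_Sum do rewrite mulr1z mul1r.
move=> ->; rewrite factS natrM -!mulrA; congr (_ * _).
rewrite mulrA -sum_fE mulrC (Sum_mul (summable_mom 0 (summable_w r)) (@summable_f n)).
by apply: eq_Sum => -[a f]; rewrite /pair_summand /= mulr1z !mul1r.
Qed.

(** In centred coordinates the sum of the entries is (n + 1) a plus the sum of the f_j; the second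
    summand comes with the factor [cmom M r 0], which vanishes by hypothesis. *)
Lemma hankel_shift_odd n r : odd n.+1 -> ~~ (M %| r)%Z -> cmom M r 0 = 0 ->
  hankel_shift (cmom M r) n.+1 =
  n.+1%:R * hankel (fun s => cmom M 0 s.+2) n * cmom M r 1.
Proof.
move=> odd_n ndvd_r h0; apply: (@fps_natI n.+1`!); first exact: fact_gt0.
transitivity (Sum (fun e : {ffun 'I_n.+1 -> int} =>
    (\sum_i e i)%:~R * (vdm e ^+ 2)%:~R * \prod_i w r (e i))).
  by rewrite (hankel_shift_sum _ (summable_w r)).
rewrite (@Sum_odd_reduction M n r (fun e => \sum_i e i) odd_n ndvd_r); last first.
  by move=> s e; rewrite [RHS](reindex_perm s); apply: eq_bigr => i _; rewrite ffunE.
rewrite factS natrM -!mulrA; congr (_ * _).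
pose G (f : {ffun 'I_n -> int}) := (vdm f ^+ 2)%:~R * \prod_j w2 (f j).
transitivity (Sum (fun p : int * {ffun 'I_n -> int} =>
  n.+1%:R * ((p.1%:~R ^+ 1 * w r p.1) * G p.2)
  + (p.1%:~R ^+ 0 * w r p.1) * ((\sum_j p.2 j)%:~R * G p.2))).
  apply: eq_Sum => -[a f]; rewrite /pair_summand /= -/(G f) -/(w r a).
  have -> : \sum_i (cons_shift (a, f)) i = n.+1%:Z * a + \sum_j f j.
    rewrite big_ord_recl ffcons0 /=.
    under eq_bigr do rewrite ffconsS ffunE.
    rewrite big_split /= sumr_const card_ord -mulr_natl -natz.
    by rewrite -[n.+1]addn1 natrD mulrDl mul1r; ring.
  rewrite intrD intrM; move: (G f) (w r a) (\sum_j f j) => x y z.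
  by rewrite -pmulrn; ring.
have sum_G : summable G by exact: summable_f.
have sum_a s : summable (fun a : int => a%:~R ^+ s * w r a) by exact: summable_mom.
rewrite SumD; first last.
- apply: (@summable_pair _ _ _ (fun a => a%:~R ^+ 0 * w r a)
    (fun f : {ffun 'I_n -> int} => (\sum_j f j)%:~R * G f)) => //.
  exact: summableMl.
- apply: (summableMl (fun=> _)).
  exact: (@summable_pair _ _ _ (fun a => a%:~R ^+ 1 * w r a)).
rewrite -(Sum_mul (sum_a 0) (summableMl (fun f : {ffun 'I_n -> int} => (\sum_j f j)%:~R) sum_G)).
rewrite -/(mom (w r) 0) -[mom (w r) 0]/(cmom M r 0) h0 mul0r addr0.
rewrite SumMl; last exact: (@summable_pair _ _ _ (fun a => a%:~R ^+ 1 * w r a)).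
rewrite -(Sum_mul (sum_a 1) sum_G) -/(sum_f n) sum_fE -/(mom (w r) 1).
rewrite -[mom (w r) 1]/(cmom M r 1).
move: (hankel _ _) (cmom _ _ _) => x y; ring.
Qed.

(** Single out one entry b and apply [Sum_odd_reduction] to the other n + 1, with base point a. What
    remains involves a and b only through g = b - a, apart from w_r(a) w_r(b), whose sum over a is
    -(g/M) w(g) by [Sum_wser_shift] when M divides a nonzero g. Thus g joins the differences f as a
    further variable with an extra factor -g/M, and symmetrizing this factor gives the shifted
    determinant. The right-hand side is the same for all r. *)
Lemma hankel_even n r : odd n.+1 -> ~~ (M %| r)%Z ->
  M%:R * n.+2%:R * hankel (cmom M r) n.+2 =
  - hankel_shift (fun s => cmom M 0 s.+2) n.+1.
Proof.
move=> odd_n ndvd_r; apply: (@fps_natI n.+1`!); first exact: fact_gt0.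
pose G (f : {ffun 'I_n -> int}) := (vdm f ^+ 2)%:~R * \prod_j w2 (f j).
have sum_G : summable G by exact: summable_f.
pose phi b (e : {ffun 'I_n.+1 -> int}) := \prod_j (e j - b) ^+ 2.
pose K b p := w r b * pair_summand M r (phi b) p.
have K_eq g (f : {ffun 'I_n -> int}) a : K (a + g) (a, f) =
    ((g * \prod_j (f j - g)) ^+ 2)%:~R * G f * (w r a * w r (a + g)).
  rewrite /K /pair_summand /= -/(G f) -/(w r a).
  have -> : phi (a + g) (cons_shift (a, f)) = (g * \prod_j (f j - g)) ^+ 2.
    rewrite /phi big_ord_recl ffcons0 /= exprMn opprD addNKr sqrrN -prodrXl.
    congr (_ * _); apply: eq_bigr => j _; rewrite ffconsS ffunE /=.
    by congr (_ ^+ 2); ring.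
  by move: (G f) (w r a) (w r (a + g)) ((_ * _) ^+ 2) => x y z t; ring.
have bij_h : bijective (fun q : (int * {ffun 'I_n -> int}) * int =>
    (q.2 + q.1.1, (q.2, q.1.2))).
  exists (fun q : int * (int * {ffun 'I_n -> int}) => ((q.1 - q.2.1, q.2.2), q.2.1)).
    by move=> [[g f] a] /=; congr (_, _, _); ring.
  by move=> [b [a f]] /=; congr (_, _); ring.
have sum_K : summable (fun q : int * (int * {ffun 'I_n -> int}) => K q.1 q.2).
  apply: (summable_reindex bij_h).
  pose L (q : (int * {ffun 'I_n -> int}) * int) : qser :=
    ((q.1.1 * \prod_j (q.1.2 j - q.1.1)) ^+ 2)%:~R
      * (w r (q.2 + q.1.1) * w r q.2 * G q.1.2).
  pose K' (q : (int * {ffun 'I_n -> int}) * int) := K (q.2 + q.1.1) (q.2, q.1.2).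
  suff sum_L : summable L.
    apply: (@eq_summable _ _ L K') => // -[[g f] a]; rewrite /L /K' /= K_eq.
    by move: (G f) (w r a) (w r (a + g)) ((_ * _) ^+ 2) => x y z t; ring.
  apply: summableMl.
  have sum_ww := summable_pair (summable_pair (summable_w r) (summable_w r)) sum_G.
  apply: (summable_comp (h := fun q : (int * {ffun 'I_n -> int}) * int =>
     ((q.2 + q.1.1, q.2), q.1.2)) _ _ sum_ww).
    move=> [[g f] a] [[g' f'] a'] /= [eq_ag eq_a ->].
    by move: eq_ag; rewrite eq_a => /eqP; rewrite (inj_eq (addrI _)) => /eqP ->.
  move=> s; exists [seq ((q.1.1 - q.1.2, q.2), q.1.2) | q <- s] => -[[g f] a] /= in_s.
  by apply/mapP; exists (a + g, a, f); rewrite //= addrC addKr.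
transitivity (M%:R * Sum (fun e : {ffun 'I_n.+2 -> int} =>
   (vdm e ^+ 2)%:~R * \prod_i w r (e i))).
  rewrite (hankel_sum _ (summable_w r)) -/(hankel (cmom M r) n.+2) [in RHS]factS natrM.
  move: (hankel _ _) => x; ring.
transitivity (M%:R * (n.+1%:R * Sum (fun q : int * (int * {ffun 'I_n -> int}) => K q.1 q.2))).
  congr (_ * _); rewrite (reindex_Sum _ (@ffcons_bij _ n.+1)).
  pose L b (e : {ffun 'I_n.+1 -> int}) :=
    w r b * ((phi b e)%:~R * (vdm e ^+ 2)%:~R * \prod_i w r (e i)).
  have L_eq p : (vdm (ffcons p) ^+ 2)%:~R * \prod_i w r (ffcons p i) = L p.1 p.2.
    rewrite vdm_recl [X in _ * X = _]big_ord_recl !ffcons0.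
    have -> : vdm (fun i => ffcons p (lift ord0 i)) = vdm p.2.
      by congr vdm; apply: funext => i; rewrite ffconsS.
    have -> : \prod_i (ffcons p (lift ord0 i) - p.1) = \prod_i (p.2 i - p.1).
      by apply: eq_bigr => i _; rewrite ffconsS.
    have -> : \prod_i w r (ffcons p (lift ord0 i)) = \prod_i w r (p.2 i).
      by apply: eq_bigr => i _; rewrite ffconsS.
    rewrite exprMn rmorphM /= -prodrXl -/(phi p.1 p.2) /L.
    by rewrite mulrCA.
  have sum_vw : summable (fun e : {ffun 'I_n.+2 -> int} =>
      (vdm e ^+ 2)%:~R * \prod_i w r (e i)).
    by apply: summableMl; apply: (@summable_prod _ _ _ (fun=> w r)).
  have sum_L := eq_summable L_eq (summable_bij (@ffcons_bij _ n.+1) sum_vw).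
  rewrite (eq_Sum L_eq) (Sum_pair sum_L) (Sum_pair sum_K).
  rewrite -SumMl; last exact: (summable_outer sum_K).
  apply: eq_Sum => b; rewrite SumMl; last first.
    by apply: summableMl; apply: (@summable_prod _ _ _ (fun=> w r)).
  rewrite Sum_odd_reduction //; last first.
    move=> s e; rewrite /phi [RHS](reindex_perm s).
    by apply: eq_bigr => j _; rewrite ffunE.
  rewrite mulrCA SumMl //; exact: summable_pair_summand.
rewrite (reindex_Sum _ bij_h) /=.
pose K' (q : int * {ffun 'I_n -> int}) a := K (a + q.1) (a, q.2).
rewrite (@Sum_pair _ _ _ K'); last exact: (summable_bij bij_h sum_K).
transitivity (- (n.+1%:R * Sum (fun e : {ffun 'I_n.+1 -> int} =>
    (e ord0)%:~R * ((vdm e ^+ 2)%:~R * \prod_i w2 (e i))))); last first.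
  rewrite (Sum_first _ summable_w2) (hankel_shift_sum _ summable_w2) mulrN; congr (- (_ * \det _)).
  by apply/matrixP => i j; rewrite !mxE mom_w2 addn2 eqSS.
rewrite mulrCA -mulrN; congr (_ * _).
have sum_K' : summable (fun q => Sum (K' q)).
  exact: (summable_outer (F := K') (summable_bij bij_h sum_K)).
rewrite -SumMl // (reindex_Sum _ (@ffcons_bij _ n)) -SumN; last first.
  have sum_e : summable (fun e : {ffun 'I_n.+1 -> int} =>
      (e ord0)%:~R * ((vdm e ^+ 2)%:~R * \prod_i w2 (e i))).
    by do 2!apply: summableMl; apply: (@summable_prod _ _ _ (fun=> w2)).
  exact: (summable_bij (@ffcons_bij _ n) sum_e).
apply: eq_Sum => -[g f]; rewrite /K' /= ffcons0 /=.
rewrite (eq_Sum (K_eq g f)) SumMl; last first.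
  apply: summableMr; exact: summable_w.
have -> : (vdm (ffcons (g, f)) ^+ 2)%:~R * \prod_i w2 (ffcons (g, f) i) =
          ((g * \prod_j (f j - g)) ^+ 2)%:~R * G f * w 0 g.
  rewrite vdm_recl [X in _ * X = _]big_ord_recl !ffcons0 /=.
  have -> : vdm (fun i => ffcons (g, f) (lift ord0 i)) = vdm f.
    by congr vdm; apply: funext => i; rewrite ffconsS.
  have -> : \prod_i (ffcons (g, f) (lift ord0 i) - g) = \prod_i (f i - g).
    by apply: eq_bigr => i _; rewrite ffconsS.
  have -> : \prod_i w2 (ffcons (g, f) (lift ord0 i)) = \prod_i w2 (f i).
    by apply: eq_bigr => i _; rewrite ffconsS.
  rewrite /G /w2 !exprMn !rmorphM /=.
  move: (\prod_i (f i - g)) (w 0 g) (vdm f) (\prod_(i < n) (_ * _)) => x y z t.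
  by ring.
have [->|g0] := eqVneq g 0; first by rewrite !(mul0r, expr0n, mulr0z, mulr0, oppr0).
suff -> : M%:R * (((g * \prod_j (f j - g)) ^+ 2)%:~R * G f *
    Sum (fun a => w r a * w r (a + g)))
  = ((g * \prod_j (f j - g)) ^+ 2)%:~R * G f * (- (g%:~R * w 0 g)).
  by move: (G f) (w 0 g) ((_ * _) ^+ 2) => x y z; ring.
rewrite mulrCA; congr (_ * _).
have [/dvdzP[k g_eq]|ndvd_g] := boolP (M %| g)%Z; last first.
  rewrite /w /on_class subr0 (negPf ndvd_g) mulr0 oppr0 Sum0 ?mulr0 // => a.
  case: ifP => ar; last by rewrite mul0r.
  case: ifP => agr; last by rewrite mulr0.
  have := dvdz_subr agr ar; have -> : a + g - r - (a - r) = g by ring.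
  by rewrite (negPf ndvd_g).
have -> : Sum (fun a => w r a * w r (a + g)) = Sum (fun a => w r a * wser (a + k * M)).
  apply: eq_Sum => a; rewrite /w /on_class; case: ifP => ar; last by rewrite !mul0r.
  by rewrite addrAC dvdz_addl_eq ?ar ?g_eq ?dvdz_mull.
rewrite Sum_wser_shift //; last by apply: contra g0 => /eqP k0; rewrite g_eq k0 mul0r.
rewrite /w /on_class subr0 g_eq dvdz_mull // intrM -[M%:~R]pmulrn.
by move: (wser _) => x; ring.
Qed.

End HankelIdentities.

(** * Block determinants and the splitting of Hankel determinants by parity *)

Lemma det_sylvester (R : comNzRingType) m n (A : 'M[R]_(m, n)) (B : 'M[R]_(n, m)) :
  \det (1%:M + A *m B) = \det (1%:M + B *m A).
Proof.
transitivity (\det (block_mx 1%:M A (- B) 1%:M)).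
  have := congr1 (@determinant _ _) (mulmx_block 1%:M A (- B) 1%:M 1%:M 0 B 1%:M).
  rewrite det_mulmx det_lblock !det1 !mulr1 => ->.
  rewrite !mulmx0 !mulmx1 !mul1mx addrC addNr !add0r.
  by rewrite det_ublock det1 mulr1 addrC.
have := congr1 (@determinant _ _) (mulmx_block 1%:M A (- B) 1%:M 1%:M (- A) 0 1%:M).
rewrite det_mulmx det_ublock !det1 !mulr1 => ->.
rewrite !mulmx0 !mulmx1 !mul1mx mulNmx mulmxN opprK addNr !addr0.
by rewrite det_lblock det1 mul1r addrC.
Qed.

Lemma det_mx2 (R : comNzRingType) (A : 'M[R]_2) (o := lift ord0 ord0 : 'I_2) :
  \det A = A ord0 ord0 * A o o - A ord0 o * A o ord0.
Proof.
rewrite (expand_det_row _ ord0) !big_ord_recl big_ord0 addr0.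
rewrite /cofactor !det_mx11 !mxE /= expr0 mul1r expr1 mulN1r mulrN.
by congr (_ * A _ _ - _ * A _ _); apply: val_inj.
Qed.

Section ClassBlocks.
Variables (R : comNzRingType) (m : nat) (L : finType) (cl : 'I_m -> L).
Variable N : 'M[R]_m.
Hypothesis N_block : forall i j, cl i != cl j -> N i j = 0.

(** The part of N - 1 supported on one class. Products of different parts are 0, so N is the product
    of the matrices 1 + X rho; no explicit reordering of the indices is needed. *)
Let X rho : 'M[R]_m := \matrix_(i, j)
  if (cl i == rho) && (cl j == rho) then N i j - (i == j)%:R else 0.

(** Writing X rho = U (B - 1) U^T with U^T U = 1, Sylvester's identity shrinks the determinant to
    the block B. *)
Lemma det_block_class rho n (h : 'I_n -> 'I_m) : injective h ->
  (forall i, (cl i == rho) = (i \in codom h)) ->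
  \det (1%:M + X rho) = \det (\matrix_(a, b) N (h a) (h b)).
Proof.
move=> inj_h codom_h; pose U : 'M[R]_(m, n) := \matrix_(i, a) (i == h a)%:R.
pose B := \matrix_(a, b) N (h a) (h b).
have clh a : cl (h a) == rho by rewrite codom_h codom_f.
have -> : X rho = U *m ((B - 1%:M) *m U^T).
  apply/matrixP => i j; rewrite !mxE.
  case: (boolP (cl i == rho)) => [|i_rho]; last first.
    rewrite big1 // => a _; rewrite !mxE; case: eqP => [i_a|_]; last by rewrite mul0r.
    by rewrite i_a clh in i_rho.
  rewrite codom_h => /codomP [a0 ->]; rewrite (bigD1 a0) //=.
  rewrite [X in _ = _ + X]big1 ?addr0 => [|a /negPf ne_a]; last first.
    by rewrite mxE (inj_eq inj_h) eq_sym ne_a mul0r.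
  rewrite !mxE eqxx mul1r.
  case: (boolP (cl j == rho)) => [|j_rho]; last first.
    rewrite big1 // => b _; rewrite [U^T b j]mxE [U j b]mxE.
    case: eqP => [j_b|_]; last by rewrite mulr0.
    by rewrite j_b clh in j_rho.
  rewrite codom_h => /codomP [b0 ->]; rewrite (bigD1 b0) //= !mxE eqxx mulr1.
  rewrite big1 ?addr0 ?(inj_eq inj_h) // => b /negPf ne_b.
  by rewrite [U^T b _]mxE [U _ b]mxE (inj_eq inj_h) eq_sym ne_b mulr0.
rewrite det_sylvester -mulmxA; have -> : U^T *m U = 1%:M.
  apply/matrixP => a b; rewrite !mxE (bigD1 (h a)) //= !mxE eqxx mul1r (inj_eq inj_h).
  by rewrite big1 ?addr0 // => i /negPf ne_i; rewrite !mxE ne_i mul0r.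
by rewrite mulmx1 addrC subrK.
Qed.

Let X_mul rho sigma : rho != sigma -> X rho *m X sigma = 0.
Proof.
move=> ne_rs; apply/matrixP => i j; rewrite !mxE big1 // => k _; rewrite !mxE.
have [k_rho|_] := eqVneq (cl k) rho; last by rewrite andbF mul0r.
by rewrite k_rho (negPf ne_rs) mulr0.
Qed.

Lemma det_blocks_prod : \det N = \prod_rho \det (1%:M + X rho).
Proof.
have -> : N = 1%:M + \sum_rho X rho.
  apply/matrixP => i j; rewrite !mxE summxE (bigD1 (cl i)) //= !mxE eqxx /=.
  rewrite big1 ?addr0 => [|rho /negPf ne_rho]; last first.
    by rewrite mxE eq_sym ne_rho.
  have [eq_ij|ne_ij] := eqVneq (cl j) (cl i); first by rewrite addrC subrK.
  rewrite N_block 1?eq_sym // addr0; case: (eqVneq j i) ne_ij => [->|//].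
  by rewrite eqxx.
suff IH (s : seq L) : uniq s ->
    \det (1%:M + \sum_(rho <- s) X rho) = \prod_(rho <- s) \det (1%:M + X rho).
  exact/IH/index_enum_uniq.
elim: s => [_|rho s IHs].
  by rewrite !big_nil addr0 det1.
rewrite cons_uniq => /andP[rho_s uniq_s]; rewrite !big_cons -IHs // -det_mulmx.
congr (\det _); rewrite mulmxDl mul1mx mulmxDr mulmx1 mulmx_sumr.
rewrite [X in _ = _ + (_ + X)]big_seq [X in _ = _ + (_ + X)]big1; last first.
  by move=> sigma sigma_s; apply: X_mul; apply: contraNneq rho_s => ->.
by rewrite addr0 -addrA [_ + X rho]addrC.
Qed.

Lemma det_blocks (n : L -> nat) (h : forall rho, 'I_(n rho) -> 'I_m) :
  (forall rho, injective (h rho)) ->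
  (forall rho i, (cl i == rho) = (i \in codom (h rho))) ->
  \det N = \prod_rho \det (\matrix_(a, b) N (h rho a) (h rho b)).
Proof.
move=> inj_h codom_h; rewrite det_blocks_prod.
by apply: eq_bigr => rho _; apply: det_block_class.
Qed.

End ClassBlocks.

Section ParitySplit.
Variable R : comNzRingType.
Implicit Types c : nat -> R.

Lemma half_even_lt n (a : 'I_(uphalf n)) : (2 * a < n)%N.
Proof. by case: a => a /=; lia. Qed.
Lemma half_odd_lt n (a : 'I_(n./2)) : (2 * a + 1 < n)%N.
Proof. by case: a => a /=; lia. Qed.

(** Exchanges 2a and 2a + 1, so that i + flip j is odd exactly when i and j have the same parity. *)
Definition flip (j : nat) := if odd j then j.-1 else j.+1.

Lemma det_flip n c : (forall s, ~~ odd s -> c s = 0) ->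
  \det (\matrix_(i < n, j < n) c (i + flip j)%N)
  = \det (\matrix_(a < uphalf n, b < uphalf n) c (2 * a + 2 * b + 1)%N) *
    \det (\matrix_(a < n./2, b < n./2) c (2 * a + 2 * b + 1)%N).
Proof.
move=> c_even; pose sz (b : bool) := if b then n./2 else uphalf n.
pose h (b : bool) : 'I_(sz b) -> 'I_n :=
  if b as b0 return 'I_(sz b0) -> 'I_n then fun a => Ordinal (half_odd_lt a)
  else fun a => Ordinal (half_even_lt a).
rewrite (@det_blocks _ _ bool (fun i => odd i) _ _ sz h) /=.
- rewrite big_bool /= mulrC.
  congr (_ * _); apply: (congr1 (@determinant R _)); apply/matrixP => a b;
    rewrite !mxE /flip /=; congr c.
    by have -> : odd (2 * b) = false by [lia]; lia.
  by have -> : odd (2 * b + 1) = true by [lia]; lia.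
- move=> i j; rewrite !mxE /flip => ij; apply: c_even; case: ifP ij; lia.
- by case=> a b /(congr1 val) /= eq_ab; apply: val_inj => /=; lia.
case=> i; apply/idP/codomP => /= [i_odd|[a ->] /=]; try lia.
  have lt_i : (i./2 < n./2)%N by have := ltn_ord i; lia.
  by exists (Ordinal lt_i); apply: val_inj => /=; lia.
have lt_i : (i./2 < uphalf n)%N by have := ltn_ord i; lia.
by exists (Ordinal lt_i); apply: val_inj => /=; lia.
Qed.

(** For odd n the last index has no partner below n and stays fixed. *)
Fact flip_perm_subproof n (j : 'I_n) : ((if flip j < n then flip j else j) < n)%N.
Proof. by case: ifP. Qed.
Definition flip_ord n (j : 'I_n) := Ordinal (flip_perm_subproof j).

Lemma flip_ordK n : involutive (@flip_ord n).
Proof.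
move=> j; apply: val_inj; rewrite /= /flip; case: j => j /= lt_jn.
by case: (boolP (odd j)) => odd_j; do !case: ifP => /=; lia.
Qed.

Definition flip_perm n : 'S_n := perm (inv_inj (@flip_ordK n)).

Lemma odd_flip_perm u : odd_perm (flip_perm u.*2) = odd u.
Proof.
apply: (@signr_inj int); rewrite signr_odd -det_perm.
have lt_half (i : 'I_u.*2) : (i./2 < u)%N by have := ltn_ord i; lia.
have lt_h (b : 'I_u) (a : 'I_2) : (2 * b + a < u.*2)%N.
  by have := ltn_ord a; have := ltn_ord b; lia.
have flip_lt (i : 'I_u.*2) : (flip i < u.*2)%N.
  by have := ltn_ord i; rewrite /flip; case: ifP; lia.
have perm_mxE (i j : 'I_u.*2) : perm_mx (flip_perm u.*2) i j = (flip i == j)%:R :> int.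
  by rewrite !mxE permE -val_eqE /= flip_lt.
rewrite (@det_blocks _ _ 'I_u (fun i => Ordinal (lt_half i)) _ _ (fun=> 2%N)
  (fun b a => Ordinal (lt_h b a))).
- rewrite (eq_bigr (fun=> -1)) ?prodr_const ?card_ord // => b _.
  have -> : \matrix_(a < 2, a' < 2) perm_mx (flip_perm u.*2) (Ordinal (lt_h b a))
      (Ordinal (lt_h b a')) = \matrix_(a < 2, a' < 2) (flip (2 * b + a) == 2 * b + a')%N%:R
      :> 'M[int]_2.
    by apply/matrixP => a a'; rewrite mxE perm_mxE mxE.
  rewrite det_mx2 !mxE /= /flip /bump /=.
  have -> : odd (2 * b + 0) = false by lia.
  have -> : odd (2 * b + 1) = true by lia.
  have -> : ((2 * b + 0).+1 == 2 * b + 0)%N = false by lia.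
  have -> : ((2 * b + 0).+1 == 2 * b + 1)%N = true by lia.
  by have -> : ((2 * b + 1).-1 == 2 * b + 0)%N = true by [lia]; rewrite mul0r sub0r mulr1.
- move=> i j; rewrite perm_mxE -val_eqE /flip /= => ne_ij.
  by case: eqP => // eq_ij; case: ifP eq_ij ne_ij; lia.
- by move=> b a a' /(congr1 val) /= /addnI /val_inj.
move=> b i; apply/idP/codomP => [/eqP <-|[a ->]]; last first.
  by rewrite -val_eqE /=; have := ltn_ord a; lia.
have lt_i : (i %% 2 < 2)%N by lia.
by exists (Ordinal lt_i); apply: val_inj => /=; lia.
Qed.

End ParitySplit.

Definition odd_hankel (c : nat -> qser) n :=
  \det (\matrix_(a < n, b < n) c (2 * a + 2 * b + 1)%N).

(** After permuting the columns by [flip_perm] only odd moments can survive, and the blocks of even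
    and of odd indices coincide. *)
Lemma hankel_parity (c : nat -> qser) u : (forall s, ~~ odd s -> c s = 0) ->
  hankel c u.*2 = (-1) ^+ u * odd_hankel c u ^+ 2.
Proof.
move=> c_even; have := det_flip u.*2 c_even.
rewrite uphalf_double doubleK -/(odd_hankel c u) => eq_odd.
have -> : hankel c u.*2 = (-1) ^+ odd_perm (flip_perm u.*2) *
    ((-1) ^+ odd_perm (flip_perm u.*2) * hankel c u.*2).
  by rewrite mulrA -signr_addb addbb mul1r.
rewrite odd_flip_perm signr_odd; congr (_ * _); rewrite expr2 -eq_odd.
rewrite -signr_odd -odd_flip_perm mulrC -odd_permV -det_perm -det_mulmx -col_permE.
congr (\det _); apply/matrixP => i j; rewrite !mxE permE /=; congr (c (_ + _)%N).
have := ltn_ord j; rewrite /flip; case: ifP; case: ifP => //; lia.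
Qed.

(** In odd size the last column has no partner; its shift by one is exactly what [flip] asks for
    there. The sign is left open and is recovered later from positivity. *)
Lemma hankel_shift_parity (c : nat -> qser) u : (forall s, ~~ odd s -> c s = 0) ->
  exists b : bool,
  hankel_shift c u.*2.+1 = (-1) ^+ b * (odd_hankel c u.+1 * odd_hankel c u).
Proof.
move=> c_even; have := det_flip u.*2.+1 c_even.
rewrite /= doubleK uphalf_double -/(odd_hankel c u) -/(odd_hankel c u.+1) => eq_odd.
exists (odd_perm (flip_perm u.*2.+1)).
rewrite -eq_odd; set s := flip_perm _.
have -> : \matrix_(i < u.*2.+1, j < u.*2.+1) c (i + flip j)%N =
   col_perm s (\matrix_(i < u.*2.+1, j < u.*2.+1) c (i + (j + (j.+1 == u.*2.+1)))%N).
  apply/matrixP => i j; rewrite !mxE permE /=; congr (c (_ + _)%N).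
  have := ltn_ord j; rewrite /flip; case: ifP; case: ifP => //; lia.
by rewrite col_permE det_mulmx det_perm odd_permV mulrC -mulrA -signr_addb addbb mulr1.
Qed.

(** * Positivity and the closed form of the self-dual Hankel determinants *)

Definition nonneg (f : qser) := forall n, 0 <= fcoef f n.

Lemma nonnegM f g : nonneg f -> nonneg g -> nonneg (f * g).
Proof. by move=> f0 g0 n; rewrite coef_fpsM sumr_ge0 // => i _; rewrite mulr_ge0. Qed.

Lemma nonneg_nat n : nonneg n%:R.
Proof.
by move=> k; rewrite coef_fpsMn coef_fps1 -mulrnA ler0n.
Qed.

Lemma nonneg_int (z : int) : 0 <= z -> nonneg z%:~R.
Proof. by case: z => n // _; apply: nonneg_nat. Qed.

Lemma nonneg1 : nonneg 1. Proof. exact: (nonneg_nat 1). Qed.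

Lemma nonneg_prod (I : Type) (r : seq I) (P : pred I) (F : I -> qser) :
  (forall i, P i -> nonneg (F i)) -> nonneg (\prod_(i <- r | P i) F i).
Proof.
by move=> F0; elim/big_rec: _ => [|i f /F0 Fi f0]; [exact: nonneg1|exact: nonnegM].
Qed.

Lemma nonnegX f n : nonneg f -> nonneg (f ^+ n).
Proof.
move=> f0; elim: n => [|n IHn]; first exact: nonneg1.
by rewrite exprS; apply: nonnegM.
Qed.

Lemma nonneg_Sum (I : choiceType) (F : I -> qser) :
  (forall i, nonneg (F i)) -> nonneg (Sum F).
Proof. by move=> F0 n; apply: fsumr_ge0 => i _; apply: F0. Qed.

Lemma nonneg_natI n f : (0 < n)%N -> nonneg (n%:R * f) -> nonneg f.
Proof.
by move=> n_gt0 nf k; have := nf k; rewrite coef_natM pmulr_rge0 // ltr0n.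
Qed.

Lemma nonneg_opp f : nonneg f -> nonneg (- f) -> f = 0.
Proof.
move=> f0 nf0; apply: fpsP => n; apply/eqP; rewrite eq_le f0 andbT.
by rewrite -oppr_ge0; apply: nf0.
Qed.

Lemma nonneg_sign (b : bool) f g : nonneg f -> nonneg g -> f <> 0 ->
  f = (-1) ^+ b * g -> f = g.
Proof.
case: b => f_ge0 g_ge0 f0; rewrite ?expr0 ?mul1r // expr1 mulN1r => fg.
by case: f0; apply: nonneg_opp => //; rewrite fg opprK.
Qed.

Lemma nonneg_int_wser (a : int) k : odd k -> nonneg (a%:~R ^+ k * wser a).
Proof.
move=> odd_k n; rewrite -rmorphXn coef_intM /= mulrA -intrM.
rewrite mulr_ge0 ?ler0n // ler0z.
have -> : k = (k./2.*2.+1)%N by rewrite -[LHS]odd_double_half odd_k.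
rewrite exprS -muln2 exprM -mulrA mulrC -mulrA.
by rewrite mulr_ge0 ?sqr_ge0 // -normrEsg normr_ge0.
Qed.

(** Andréief's identity in the variable a^2 with weight a w(a) gives a sum of squared Vandermonde
    products times nonnegative series. *)
Lemma odd_hankel_ge0 (w : int -> qser) n : summable w ->
  (forall a, nonneg (a%:~R * w a)) -> nonneg (odd_hankel (mom w) n).
Proof.
move=> sumw w_ge0; apply: (@nonneg_natI n`!); first exact: fact_gt0.
have := @andreief _ _ n (fun j a => a%:~R ^+ (2 * j)) (fun j a => a%:~R ^+ (2 * j)) _
  (summableMl (fun a => a%:~R) sumw).
rewrite /odd_hankel.
have -> : \matrix_(i < n, j < n) mom w (2 * i + 2 * j + 1) =
   \matrix_(i, j) Sum (fun a : int => a%:~R ^+ (2 * i) * a%:~R ^+ (2 * j) * (a%:~R * w a)).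
  apply/matrixP => i j; rewrite !mxE; apply: eq_Sum => a.
  by rewrite mulrA -exprD -exprSr addn1.
move=> <-; apply: nonneg_Sum => e; apply: nonnegM; last by apply: nonneg_prod.
rewrite -expr2; have -> : \matrix_(i < n, j < n) ((e i)%:~R : qser) ^+ (2 * j) =
   \matrix_(i, j) (((e i) ^+ 2)%:~R : qser) ^+ (j : 'I_n).
  by apply/matrixP => i j; rewrite !mxE exprM rmorphXn.
rewrite (@det_vdm _ n (fun i => ((e i) ^+ 2)%:~R)) (@vdm_int n (fun i => (e i) ^+ 2)).
move: (vdm _) => z; have -> : z%:~R ^+ 2 = (z ^+ 2)%:~R :> qser by rewrite rmorphXn.
by apply: nonneg_int; apply: sqr_ge0.
Qed.

Definition superfact k := (\prod_(1 <= l < k) l`!)%N.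

Lemma superfactS k : superfact k.+1 = (superfact k * k`!)%N.
Proof.
case: k => [|k]; first by rewrite /superfact !big_geq.
by rewrite /superfact big_nat_recr.
Qed.

Lemma superfact_gt0 k : (0 < superfact k)%N.
Proof. by rewrite prodn_gt0 // => l; rewrite fact_gt0. Qed.

(** The solution of z_k z_{k+2} = M (k + 1) z_{k+1}^2 with z_0 = z_1 = 1. *)
Definition hankel_const M k := (M ^ 'C(k, 2) * superfact k)%N.

Section HankelEvaluation.
Variables (d : nat) (p : qser).
Hypothesis d_gt0 : (0 < d)%N.
Local Notation M := (2 * d)%N.
Hypothesis p_ge0 : nonneg p.
Hypothesis p_neq0 : p <> 0.
Hypothesis cmom1 : cmom M d 1 = M%:R * p.

Let M_gt0 : (0 < M)%N. Proof. by rewrite muln_gt0. Qed.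

Let d_ndvd : ~~ (M %| d%:Z)%Z.
Proof. by apply/negP => /dvdzP[k]; have [k_gt0|k_le0] := ltrP 0 k; nia. Qed.

Lemma cmom_even r s : (M %| r + r)%Z -> ~~ odd s -> cmom M r s = 0.
Proof.
move=> dvd_2r even_s; apply: fps_eq_opp0.
have sum_s : summable (fun a : int => a%:~R ^+ s * wser a : qser).
  by apply: summable_mom; apply: summable_wser.
have cmomE t : cmom M t s = Sum (on_class M t (fun a => a%:~R ^+ s * wser a)).
  by apply: eq_Sum => a; rewrite /on_class; case: ifP => //; rewrite mulr0.
rewrite !cmomE -Sum_on_class_odd //.
  by congr Sum; apply: on_class_mod; rewrite opprK.
move=> a; have -> : (- a)%:~R ^+ s = a%:~R ^+ s :> qser.
  by rewrite mulrNz exprNn -signr_odd (negPf even_s) mul1r.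
by rewrite wserN mulrN.
Qed.

Local Notation cd := (cmom M d).
Local Notation c0 := (fun s => cmom M 0 s.+2).

Let cd_even s : ~~ odd s -> cd s = 0.
Proof. by apply: cmom_even; apply/dvdzP; exists 1; lia. Qed.

Let c0_even s : ~~ odd s -> c0 s = 0.
Proof. by move=> even_s; apply: cmom_even; rewrite ?addr0 ?dvdz0 //= negbK. Qed.

Let sum_w r : summable (on_class M r wser).
Proof. by apply: summable_on_class; apply: summable_wser. Qed.

Let class_ge0 r k a : odd k -> nonneg (a%:~R ^+ k * on_class M r wser a).
Proof.
move=> odd_k; rewrite /on_class; case: ifP => _; first exact: nonneg_int_wser.
by rewrite mulr0; apply: (nonneg_nat 0).
Qed.

Let A_ge0 u : nonneg (odd_hankel cd u).
Proof.
apply: odd_hankel_ge0 => // a; rewrite -[a%:~R]expr1.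
exact: class_ge0.
Qed.

Let B_ge0 u : nonneg (odd_hankel c0 u).
Proof.
have -> : c0 = mom (fun a => a%:~R ^+ 2 * on_class M 0 wser a).
  by apply: funext => s; apply: eq_Sum => a; rewrite mulrA -exprD addn2.
apply: odd_hankel_ge0 => [|a]; first exact: summableMl.
by rewrite mulrA -exprS; apply: class_ge0.
Qed.

(** Parity splitting of [hankel_shift_odd] at r = d in size 2u + 1. *)
Let stepA u : odd_hankel cd u.+1 * odd_hankel cd u =
  (2 * u + 1)%:R * odd_hankel c0 u ^+ 2 * (M%:R * p) \/
  odd_hankel cd u.+1 * odd_hankel cd u =
  - ((2 * u + 1)%:R * odd_hankel c0 u ^+ 2 * (M%:R * p)).
Proof.
have odd_u : odd u.*2.+1 by rewrite /= odd_double.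
have := hankel_shift_odd odd_u d_ndvd (@cd_even 0 isT).
rewrite (hankel_parity _ c0_even) [cd 1]cmom1.
have [b ->] := hankel_shift_parity u cd_even.
move: (odd_hankel cd u.+1 * odd_hankel cd u) (odd_hankel c0 u) => x y.
have -> : u.*2.+1 = (2 * u + 1)%N by lia.
rewrite -[(-1) ^+ u]signr_odd; case: b; case: (odd u); rewrite !(expr0, expr1, mul1r, mulN1r) => eq_x.
- by left; apply: oppr_inj; rewrite eq_x; ring.
- by right; apply: oppr_inj; rewrite eq_x; ring.
- by right; rewrite eq_x; ring.
- by left; rewrite eq_x; ring.
Qed.

(** Parity splitting of [hankel_even] at r = d in size 2u + 2. *)
Let stepB u : odd_hankel c0 u.+1 * odd_hankel c0 u =
  (M * (2 * u + 2))%:R * odd_hankel cd u.+1 ^+ 2 \/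
  odd_hankel c0 u.+1 * odd_hankel c0 u =
  - ((M * (2 * u + 2))%:R * odd_hankel cd u.+1 ^+ 2).
Proof.
have odd_u : odd u.*2.+1 by rewrite /= odd_double.
have := hankel_even M_gt0 odd_u d_ndvd.
rewrite -doubleS (hankel_parity _ cd_even).
have [b ->] := hankel_shift_parity u c0_even.
move: (odd_hankel c0 u.+1 * odd_hankel c0 u) (odd_hankel cd u.+1) => x y.
have -> : u.+1.*2 = (2 * u + 2)%N by lia.
rewrite -natrM -[(-1) ^+ u.+1]signr_odd.
case: b; case: (odd u.+1); rewrite !(expr0, expr1, mul1r, mulN1r, opprK) => eq_x.
- by right; rewrite -eq_x; ring.
- by left; rewrite -eq_x; ring.
- by left; apply: oppr_inj; rewrite -eq_x; ring.
- by right; apply: oppr_inj; rewrite -eq_x; ring.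
Qed.

Local Notation z := (hankel_const M).

Let z_step k : (z k * z k.+2 = M * k.+1 * z k.+1 ^ 2)%N.
Proof.
have bin2S n : 'C(n.+1, 2) = ('C(n, 2) + n)%N by rewrite binS bin1.
rewrite /hankel_const !superfactS factS !bin2S !expnD expnS.
by move: (M ^ 'C(k, 2))%N (M ^ k)%N (superfact k) k`! => a b c e; ring.
Qed.

Let z_neq0 k : (z k)%:R * p ^+ 0 <> 0.
Proof.
by rewrite expr0 mulr1; apply: nat_fps_neq0; rewrite muln_gt0 expn_gt0 M_gt0 superfact_gt0.
Qed.

Let zp_neq0 k e : (z k)%:R * p ^+ e <> 0.
Proof.
elim: e => [|e IHe]; first exact: z_neq0.
by rewrite exprS mulrCA => /fps_mulf_eq0[].
Qed.

(** The interleaved sequence A_0, B_0, A_1, B_1, ... obeys the recursion of z_0, z_1, z_2, ... up to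
    powers of p and signs. All terms have nonnegative coefficients, so the signs are plus, and each
    step divides by an already known nonzero value. *)
Lemma odd_hankel_eval u :
  odd_hankel cd u = (z (2 * u)%N)%:R * p ^+ (u * u)%N /\
  odd_hankel c0 u = (z (2 * u + 1)%N)%:R * p ^+ (u * u + u)%N.
Proof.
have eq_pm f g : nonneg f -> nonneg g -> g <> 0 -> f = g \/ f = - g -> f = g.
  move=> f_ge0 g_ge0 g0 [//|fg]; case: g0; apply: nonneg_opp => //.
  by rewrite -fg.
have nonneg_zp k e : nonneg ((z k)%:R * p ^+ e).
  by apply: nonnegM; [apply: nonneg_nat|apply: nonnegX].
have M_neq0 : (M%:R : qser) <> 0 by apply: nat_fps_neq0.
have getB v : odd_hankel cd v = (z (2 * v)%N)%:R * p ^+ (v * v)%N ->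
    (v = 0%N \/ exists2 v', v = v'.+1 &
       odd_hankel c0 v' = (z (2 * v' + 1)%N)%:R * p ^+ (v' * v' + v')%N) ->
  odd_hankel c0 v = (z (2 * v + 1)%N)%:R * p ^+ (v * v + v)%N.
  move=> Av [->|[v' v_eq Bv']].
    by rewrite /odd_hankel det_mx00 /hankel_const superfactS /superfact big_geq // mulr1.
  have := eq_pm _ _ _ _ _ (stepB v'); rewrite -v_eq Av Bv' => eqB.
  apply: (fps_mulfI (@zp_neq0 (2 * v' + 1)%N (v' * v' + v')%N)).
  rewrite mulrC eqB.
  - rewrite v_eq; have -> : (2 * v'.+1 + 1 = (2 * v' + 1).+2)%N by lia.
    have -> : (2 * v'.+1 = (2 * v' + 1).+1)%N by lia.
    set k := (2 * v' + 1)%N.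
    transitivity ((z k * z k.+2)%:R
      * (p ^+ (v' * v' + v')%N * p ^+ (v'.+1 * v'.+1 + v'.+1)%N)).
      rewrite z_step exprMn -exprM -exprD.
      have -> : (v' * v' + v' + (v'.+1 * v'.+1 + v'.+1) = v'.+1 * v'.+1 * 2)%N by lia.
      have -> : (2 * v' + 2 = k.+1)%N by lia.
      by rewrite [(_ * z _ ^ 2)%:R]natrM natrX mulrA.
    by rewrite [(z _ * z _)%:R]natrM; move: (z k)%:R (z k.+2)%:R => x y; ring.
  - by apply: nonnegM; [apply: B_ge0|apply: nonneg_zp].
  - by apply: nonnegM; [apply: nonneg_nat|apply: nonnegX; apply: nonneg_zp].
  move=> /fps_mulf_eq0[|/fps_mulf_eq0[]//]; try exact: zp_neq0.
  by apply: nat_fps_neq0; rewrite muln_gt0 M_gt0 addn_gt0 orbT.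
elim: u => [|u [IHA IHB]].
  have A0 : odd_hankel cd 0 = (z (2 * 0)%N)%:R * p ^+ (0 * 0).
    by rewrite /odd_hankel det_mx00 /hankel_const /superfact big_geq // mulr1.
  by split=> //; apply: getB => //; left.
suff Au : odd_hankel cd u.+1 = (z (2 * u.+1)%N)%:R * p ^+ (u.+1 * u.+1)%N.
  by split=> //; apply: getB => //; right; exists u.
have := eq_pm _ _ _ _ _ (stepA u); rewrite IHA IHB => eqA.
apply: (fps_mulfI (@zp_neq0 (2 * u)%N (u * u)%N)).
rewrite mulrC eqA.
- have -> : (2 * u.+1 = (2 * u).+2)%N by lia.
  set k := (2 * u)%N.
  transitivity ((z k * z k.+2)%:R * (p ^+ (u * u)%N * p ^+ (u.+1 * u.+1)%N)).
    rewrite z_step exprMn -exprM -exprD.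
    have -> : (u * u + u.+1 * u.+1 = ((u * u + u) * 2).+1)%N by lia.
    have -> : (2 * u + 1 = k.+1)%N by lia.
    rewrite [p ^+ _.+1]exprS [(_ * z _ ^ 2)%:R]natrM natrX [(M * k.+1)%:R]natrM.
    move: (z k.+1)%:R M%:R => x y; ring.
  by rewrite [(z _ * z _)%:R]natrM; move: (z k)%:R (z k.+2)%:R => x y; ring.
- by apply: nonnegM; [apply: A_ge0|apply: nonneg_zp].
- apply: nonnegM; last by apply: nonnegM => //; apply: nonneg_nat.
  by apply: nonnegM; [apply: nonneg_nat|apply: nonnegX; apply: nonneg_zp].
move=> /fps_mulf_eq0[|/fps_mulf_eq0[]//].
move=> /fps_mulf_eq0[|/fps_mulf_eq0[]]; try exact: zp_neq0.
by apply: nat_fps_neq0; rewrite addn_gt0 orbT.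
Qed.

End HankelEvaluation.

(** * Theta functions and the evaluation of the first moment *)

Definition int_of_signed (p : bool * nat) : int := if p.1 then Negz p.2 else Posz p.2.

Lemma int_of_signed_bij : bijective int_of_signed.
Proof.
exists (fun a : int => if a is Negz n then (true, n) else (false, `|a|%N)).
  by case=> -[] n.
by case.
Qed.

Lemma Sum_bool (I : choiceType) (F : bool -> I -> qser) :
  summable (fun p : bool * I => F p.1 p.2) ->
  Sum (fun p : bool * I => F p.1 p.2) = Sum (F false) + Sum (F true).
Proof.
move=> sumF; rewrite Sum_pair // (@Sum_seq _ _ _ [:: false; true]) //.
  by rewrite big_cons big_seq1.
by case.
Qed.

Lemma Sum_int_split (F : int -> qser) : summable F ->
  Sum F = Sum (fun n : nat => F n) + Sum (fun n : nat => F (Negz n)).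
Proof.
move=> sumF; rewrite (reindex_Sum _ int_of_signed_bij).
have sumF' := summable_bij int_of_signed_bij sumF.
exact: (@Sum_bool _ (fun b n => F (int_of_signed (b, n)))).
Qed.

Lemma nat_of_parity_bij : bijective (fun p : bool * nat => (p.1 + p.2.*2)%N).
Proof.
exists (fun n => (odd n, n./2)) => [[b n]|n] /=; last exact: odd_double_half.
by rewrite oddD odd_double addbF oddb half_bit_double.
Qed.

Lemma Sum_nat_split (F : nat -> qser) : summable F ->
  Sum F = Sum (fun n : nat => F n.*2) + Sum (fun n : nat => F n.*2.+1).
Proof.
move=> sumF; rewrite (reindex_Sum _ nat_of_parity_bij).
have sumF' := summable_bij nat_of_parity_bij sumF.
exact: (@Sum_bool _ (fun b n => F (b + n.*2)%N)).
Qed.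

Lemma summable_nat (F : nat -> qser) : (forall n, ord_ge n (F n)) -> summable F.
Proof.
move=> F_ord N; exists (iota 0 N) => n; rewrite mem_iota /= add0n -leqNgt => le_Nn.
exact: ord_geW (F_ord n).
Qed.

Lemma Sum_on_class_param (M : nat) (r : int) (F : int -> qser) : (0 < M)%N -> summable F ->
  Sum (on_class M r F) = Sum (fun k : int => F (r + k * M)).
Proof.
move=> M_gt0 sumF; apply: fpsP => n.
have [s /(_ n (leqnn n)) [s_n _]] := summable_coef n sumF.
have inj_h : injective (fun k : int => r + k * M%:Z).
  by move=> k l /addrI /mulIf; apply; lia.
pose t := undup [seq ((a - r) %/ M)%Z | a <- s & (M %| a - r)%Z].
rewrite (@coef_Sum _ _ (fun k : int => F (r + k * M)) t) => [|k k_t]; last first.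
  apply: s_n; apply: contra k_t => k_s; rewrite mem_undup; apply/mapP.
  exists (r + k * M); rewrite ?mem_filter ?k_s addrAC subrr add0r ?dvdz_mull //.
  by rewrite mulzK //; lia.
rewrite (@coef_Sum _ _ _ [seq r + k * M%:Z | k <- t]) => [|a a_t].
  rewrite !undup_id ?undup_uniq //; last by rewrite map_inj_uniq ?undup_uniq.
  rewrite big_map !coef_fps_sum; apply: eq_bigr => k _.
  by rewrite /on_class addrAC subrr add0r dvdz_mull.
rewrite /on_class; case: ifP => // ar; apply: s_n; apply: contra a_t => a_s.
apply/mapP; exists ((a - r) %/ M)%Z; last by rewrite divzK // subrKC.
by rewrite mem_undup; apply/mapP; exists a; rewrite // mem_filter ar.
Qed.

Lemma summable_shift_mul (M : nat) (r : int) (F : int -> qser) : (0 < M)%N -> summable F ->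
  summable (fun k : int => F (r + k * M)).
Proof.
move=> M_gt0 sumF; apply: (summable_comp (h := fun k : int => r + k * M)) sumF.
  by move=> k l /addrI /mulIf; apply; lia.
move=> s; exists [seq ((a - r) %/ M)%Z | a <- s] => k k_s.
apply/mapP; exists (r + k * M) => //.
by rewrite addrAC subrr add0r mulzK //; lia.
Qed.

Lemma coef_signM k (f : qser) n : fcoef ((-1) ^+ k * f) n = (-1) ^+ k * fcoef f n.
Proof.
rewrite -signr_odd -[in RHS]signr_odd; case: (odd k); rewrite ?expr0 ?mul1r //.
by rewrite !expr1 !mulN1r.
Qed.

Section EtaIdentity.

Lemma summable_qX_mul (I : choiceType) (F : I -> qser) (h : I -> nat) :
  summable (fun i => qX (h i)) -> summable (fun i => F i * qX (h i)).
Proof. exact: summableMl. Qed.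

Lemma summable_odd_powers m : (0 < m)%N -> summable (fun k => qX (m * (2 * k + 1))%N).
Proof.
move=> m_gt0; apply: summable_nat => k; apply: ord_geW (@ord_geX _ _).
by nia.
Qed.

Lemma coef_odd_powers m (F : nat -> rat) n : (0 < m)%N ->
  fcoef (Sum (fun k => Fps (fun i => F k * (i == m * (2 * k + 1))%N%:R))) n =
  if (m %| n)%N && odd (n %/ m) then F (n %/ m)./2 else 0.
Proof.
move=> m_gt0; rewrite (@coef_Sum _ _ _ [:: (n %/ m)./2]) /=.
  rewrite big_seq1 /=; case: ifP => [/andP[/dvdnP[k ->]]|n_m].
    rewrite mulnK // => odd_k; have -> : (k * m == m * (2 * k./2 + 1))%N.
      by apply/eqP; rewrite mulnC; congr (_ * _)%N; lia.
    by rewrite mulr1.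
  case: eqP => [n_eq|_]; last exact: mulr0.
  by move: n_m; rewrite [X in (_ %| X)%N]n_eq dvdn_mulr // [X in (X %/ _)%N]n_eq mulKn //=; lia.
move=> k; rewrite inE => ne_k /=; case: eqP => [n_eq|_]; last exact: mulr0.
by case/eqP: ne_k; rewrite n_eq mulKn //; lia.
Qed.

Lemma wser_odd_powers m : (0 < m)%N -> wser m%:Z = Sum (fun k => qX (m * (2 * k + 1))%N).
Proof.
move=> m_gt0; apply: fpsP => n; rewrite [LHS]/= gtr0_sgz ?ltz_nat // mul1r.
transitivity (fcoef (Sum (fun k => Fps (fun i => 1 * (i == m * (2 * k + 1))%N%:R) : qser)) n).
  by rewrite (coef_odd_powers (fun=> 1)) //; case: ifP.
by congr (fcoef _ n); apply: eq_Sum => k; apply: fpsP => i /=; rewrite mul1r.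
Qed.

Lemma xser_odd_powers m : (0 < m)%N ->
  xser m%:Z = Sum (fun k => (-1) ^+ k * qX (m * (2 * k + 1))%N).
Proof.
move=> m_gt0; apply: fpsP => n; rewrite [LHS]/=.
have -> : (m%:Z == 0) = false by lia.
transitivity (fcoef (Sum (fun k => Fps (fun i => (-1) ^+ k * (i == m * (2 * k + 1))%N%:R) : qser)) n).
  rewrite (coef_odd_powers (fun k => (-1) ^+ k)) //.
  by case: ifP => _; rewrite ?mul1r ?mul0r.
congr (fcoef _ n); apply: eq_Sum => k; apply: fpsP => i.
by rewrite coef_signM.
Qed.

(** Both sides come from the double series (-1)^j q^(c(2k+1)(2j+1)). Summing over j first gives the
    values of [xser]; summing over k first gives (-1)^j w(c(2j+1)), where by oddness of w the sign
    moves the argument into the class of c modulo 4c. *)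
Lemma Sum_xser_half c : (0 < c)%N ->
  Sum (on_class (2 * c)%N c xser) = 2%:R * Sum (on_class (4 * c)%N c wser).
Proof.
move=> c_gt0; have [c2 c4] : (0 < 2 * c)%N /\ (0 < 4 * c)%N by split; lia.
have sumx := summable_xser; have sumw := summable_wser.
rewrite (Sum_on_class_param _ c2 sumx) (Sum_on_class_param _ c4 sumw).
rewrite (Sum_int_split (summable_shift_mul _ c2 sumx)).
rewrite (Sum_int_split (summable_shift_mul _ c4 sumw)).
pose E (k j : nat) := (-1) ^+ j * qX (c * (2 * k + 1) * (2 * j + 1))%N.
have sumE : summable (fun p : nat * nat => E p.1 p.2).
  apply: summableMl; move=> N.
  exists [seq (k, j) | k <- iota 0 N, j <- iota 0 N] => -[k j] kj /=.
  apply: ord_geW (@ord_geX _ _); rewrite leqNgt; apply: contra kj => lt_N.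
  by apply/allpairsP; exists (k, j); rewrite !mem_iota /=; split=> //; nia.
pose swap (p : nat * nat) := (p.2, p.1).
have swap_bij : bijective swap by exists swap => -[].
have sumE' : summable (fun p : nat * nat => E p.2 p.1) := summable_bij swap_bij sumE.
have xE k : Sum (E k) = xser (c * (2 * k + 1))%N%:Z.
  have ck : (0 < c * (2 * k + 1))%N by rewrite muln_gt0 c_gt0 addn1.
  by rewrite (xser_odd_powers ck).
have wE j : Sum (E^~ j) = (-1) ^+ j * wser (c * (2 * j + 1))%N%:Z.
  have cj : (0 < c * (2 * j + 1))%N by rewrite muln_gt0 c_gt0 addn1.
  rewrite wser_odd_powers // -SumMl; last exact: summable_odd_powers.
  by apply: eq_Sum => k; rewrite /E mulnAC.
have -> : Sum (fun n : nat => xser (c%:Z + n%:Z * (2 * c)%N)) = Sum (fun k => Sum (E k)).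
  by apply: eq_Sum => k; rewrite xE; congr xser; lia.
have -> : Sum (fun n : nat => xser (c%:Z + Negz n * (2 * c)%N)) = Sum (fun k => Sum (E k)).
  by apply: eq_Sum => k; rewrite xE -xserN; congr xser; lia.
have E_swap : Sum (fun k => Sum (E k)) = Sum (fun j => Sum (E^~ j)).
  rewrite -(Sum_pair sumE) -(@Sum_pair _ _ _ (fun j k => E k j)) //.
  by rewrite (reindex_Sum _ swap_bij).
rewrite E_swap; have sum_in : summable (fun j => Sum (E^~ j)) := summable_outer (F := fun j k => E k j) sumE'.
rewrite (Sum_nat_split sum_in) -mulr2n mulr_natl; congr ((_ + _) *+ _).
  apply: eq_Sum => j; rewrite wE -signr_odd odd_double mul1r; congr wser; lia.
apply: eq_Sum => j; rewrite wE -signr_odd /= odd_double mulN1r -wserN; congr wser; lia.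
Qed.

End EtaIdentity.

(** The polynomial a(a + 1)/2 on all integers; n and -(n + 1) have the same value. *)
Definition int_tri (a : int) : nat := match a with Posz n => triangular n | Negz n => triangular n end.

Lemma triangularE n : (2 * triangular n = n * (n + 1))%N.
Proof. by rewrite /triangular mulnC divnK // dvdn2 oddM oddD; case: (odd n). Qed.

Lemma int_triE a : 2 * (int_tri a)%:Z = a * (a + 1).
Proof. by case: a => n /=; have := triangularE n; rewrite ?NegzE; nia. Qed.

Lemma absz_sqrE a : (`|a| ^ 2)%N%:Z = a * a.
Proof. by nia. Qed.

(* Doubling clears the denominators of triangular numbers. *)
Lemma eq_nat_double (m n : nat) : 2 * m%:Z = 2 * n%:Z -> m = n.
Proof. by lia. Qed.

(** Together with [phi], Ramanujan's theta functions at q^k. *)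
Definition psi k := Sum (fun n => qX (k * triangular n)%N).
Definition phi k := Sum (fun a : int => qX (k * `|a| ^ 2)%N).
Definition bilateral_psi k := Sum (fun a : int => qX (k * int_tri a)%N).

Lemma leq_triangular n : (n <= triangular n)%N.
Proof. by have := triangularE n; nia. Qed.

Lemma summable_psi k : (0 < k)%N -> summable (fun n => qX (k * triangular n)%N).
Proof.
move=> k_gt0; apply: summable_nat => n; apply: ord_geW (@ord_geX _ _).
by have := leq_triangular n; nia.
Qed.

Lemma summable_phi k : (0 < k)%N -> summable (fun a : int => qX (k * `|a| ^ 2)%N).
Proof.
move=> k_gt0; apply: summable_int => n; apply: ord_geW (@ord_geX _ _).
by nia.
Qed.

Lemma summable_bilateral_psi k : (0 < k)%N -> summable (fun a : int => qX (k * int_tri a)%N).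
Proof.
move=> k_gt0 N; exists [seq (n%:Z - N%:Z) | n <- iota 0 (2 * N)] => a a_s.
apply: ord_geW (@ord_geX _ _); rewrite leqNgt; apply: contra a_s => lt_N.
apply/mapP; exists (absz (a + N%:Z)); last by have := int_triE a; nia.
by rewrite mem_iota; have := int_triE a; nia.
Qed.

Lemma bilateral_psiE k : (0 < k)%N -> bilateral_psi k = 2%:R * psi k.
Proof.
by move=> k_gt0; rewrite /bilateral_psi Sum_int_split ?mulr_natl //; exact: summable_bilateral_psi.
Qed.

(* (a, b) = (u + v + s, u - v) parametrizes the pairs with a + b of parity s. *)
Definition rotate (p : bool * (int * int)) : int * int :=
  (p.2.1 + p.2.2 + (p.1 : nat)%:Z, p.2.1 - p.2.2).

Lemma rotate_bij : bijective rotate.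
Proof.
exists (fun p : int * int => let s := (p.1 + p.2 - 2 * ((p.1 + p.2) %/ 2)%Z == 1) in
   let u := ((p.1 + p.2) %/ 2)%Z in (s, (u, u - p.2))) => [[s [u v]]|[a b]] /=.
  have -> : u + v + s + (u - v) = 2 * u + (s : nat)%:Z by ring.
  have -> : ((2 * u + (s : nat)%:Z) %/ 2)%Z = u by case: s; lia.
  by congr (_, (_, _)); [case: s; lia|ring].
rewrite /rotate /=; case: eqP => h; congr (_, _); lia.
Qed.

Lemma Sum_rotate (F : int * int -> qser) : summable F ->
  Sum F = Sum (fun p : int * int => F (p.1 + p.2, p.1 - p.2))
        + Sum (fun p : int * int => F (p.1 + p.2 + 1, p.1 - p.2)).
Proof.
move=> sumF; rewrite (reindex_Sum _ rotate_bij).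
have sumF' := summable_bij rotate_bij sumF.
rewrite (@Sum_bool _ (fun s p => F (rotate (s, p)))) //.
by congr (_ + _); apply: eq_Sum => p; rewrite /rotate /= addr0.
Qed.

(** Rotating the square lattice: (u+v)^2 + (u-v)^2 = 2u^2 + 2v^2 for pairs of even sum, and
    (u+v+1)^2 + (u-v)^2 is 1 plus four times two triangular numbers for odd sum. *)
Lemma phi_sqr c : (0 < c)%N ->
  phi c ^+ 2 = phi (2 * c) ^+ 2 + 4%:R * (qX c * psi (4 * c) ^+ 2).
Proof.
move=> c_gt0; have [c2 c4] : (0 < 2 * c)%N /\ (0 < 4 * c)%N by split; lia.
have sphi := summable_phi c_gt0; have sphi2 := summable_phi c2.
have spsi := summable_bilateral_psi c4.
rewrite expr2 (Sum_mul sphi sphi) (Sum_rotate (summable_pair sphi sphi)).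
congr (_ + _).
  rewrite expr2 (Sum_mul sphi2 sphi2); apply: eq_Sum => -[u v] /=.
  rewrite -!fpsXD; congr fpsX; apply: eq_nat_double.
  by rewrite !(absz_sqrE, PoszD, PoszM); ring.
have -> : 4%:R * (qX c * psi (4 * c) ^+ 2) = qX c * (bilateral_psi (4 * c) * bilateral_psi (4 * c)).
  by rewrite bilateral_psiE //; ring.
rewrite (Sum_mul spsi spsi) -(SumMl _ (summable_pair spsi spsi)).
apply: eq_Sum => -[u v] /=; rewrite -!fpsXD; congr fpsX.
apply: eq_nat_double; rewrite !(absz_sqrE, PoszD, PoszM).
rewrite [RHS](_ : _ = 2 * c%:Z + 4 * c%:Z * (2 * (int_tri u)%:Z) + 4 * c%:Z * (2 * (int_tri v)%:Z)).
  by rewrite !int_triE; ring.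
by ring.
Qed.

(** The same rotation turns two triangular exponents into a square plus twice a triangular number,
    in both parities. *)
Lemma psi_sqr k : (0 < k)%N -> psi k ^+ 2 = phi k * psi (2 * k).
Proof.
move=> k_gt0; have k2 : (0 < 2 * k)%N by lia.
have sphi := summable_phi k_gt0; have spsi := summable_bilateral_psi k_gt0.
have spsi2 := summable_bilateral_psi k2.
apply: (@fps_natI 4) => //.
have -> : 4%:R * psi k ^+ 2 = bilateral_psi k * bilateral_psi k.
  by rewrite bilateral_psiE //; ring.
have -> : 4%:R * (phi k * psi (2 * k)) = bilateral_psi (2 * k) * phi k + phi k * bilateral_psi (2 * k).
  by rewrite bilateral_psiE //; ring.
rewrite (Sum_mul spsi spsi) (Sum_rotate (summable_pair spsi spsi)).
congr (_ + _).
  rewrite (Sum_mul spsi2 sphi); apply: eq_Sum => -[u v] /=.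
  rewrite -!fpsXD; congr fpsX.
  apply: eq_nat_double; rewrite !(absz_sqrE, PoszD, PoszM).
  rewrite [LHS](_ : _ = k%:Z * (2 * (int_tri (u + v))%:Z) + k%:Z * (2 * (int_tri (u - v))%:Z)).
    rewrite [RHS](_ : _ = 2 * k%:Z * (2 * (int_tri u)%:Z) + 2 * k%:Z * (v * v)).
      by rewrite !int_triE; ring.
    by ring.
  by ring.
(* For pairs of odd sum the square is (u + 1)^2, hence the reindexing by u + 1. *)
pose h (p : int * int) := (p.1 + 1, p.2).
have h_bij : bijective h.
  by exists (fun p => (p.1 - 1, p.2)) => -[a b]; rewrite /h /= ?addrK ?subrK.
rewrite (Sum_mul sphi spsi2) [RHS](reindex_Sum _ h_bij); apply: eq_Sum => -[u v] /=.
rewrite -!fpsXD; congr fpsX.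
apply: eq_nat_double; rewrite !(absz_sqrE, PoszD, PoszM).
rewrite [LHS](_ : _ = k%:Z * (2 * (int_tri (u + v + 1))%:Z) + k%:Z * (2 * (int_tri (u - v))%:Z)).
  rewrite [RHS](_ : _ = 2 * k%:Z * (2 * (int_tri v)%:Z) + 2 * k%:Z * ((u + 1) * (u + 1))).
    by rewrite !int_triE; ring.
  by ring.
by ring.
Qed.

Lemma ord_ge_cancel (R : idomainType) a b (f g : fps R) :
  ord_ge b g -> fcoef g b != 0 -> ord_ge (a + b)%N (f * g) -> ord_ge a f.
Proof.
move=> g_b gb0 fg_ab n; have [m] := ubnP n; elim: m n => // m IHm n lt_nm lt_na.
have := fg_ab (n + b)%N; rewrite ltn_add2r => /(_ lt_na).
rewrite coef_fpsM (bigD1 (inord n)) //= inordK ?ltnS ?leq_addr // addKn.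
rewrite big1 ?addr0 => [|i].
  by move/eqP; rewrite mulf_eq0 (negPf gb0) orbF => /eqP.
rewrite -val_eqE /= inordK ?ltnS ?leq_addr // => ne_in.
have [lt_in|le_ni] := ltnP i n.
  by rewrite IHm ?mul0r //; [apply: leq_trans lt_in _|apply: ltn_trans lt_na].
have lt_ni : (n < i)%N by rewrite ltn_neqAle eq_sym ne_in.
by rewrite g_b ?mulr0 //; have := ltn_ord i; lia.
Qed.

Section FunctionalEquation.
Variables h L h' L' : nat -> qser.
Hypothesis L_eq : forall c, (0 < c)%N -> L c = L (2 * c)%N + 4%:R * h c.
Hypothesis h_eq : forall c, (0 < c)%N -> h c ^+ 2 = L (4 * c)%N * h (2 * c)%N.
Hypothesis h_init : forall c, (0 < c)%N -> ord_ge (2 * c) (h c - qX c).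
Hypothesis L_init : forall c, (0 < c)%N -> ord_ge c (L c - 1).
Hypothesis L_eq' : forall c, (0 < c)%N -> L' c = L' (2 * c)%N + 4%:R * h' c.
Hypothesis h_eq' : forall c, (0 < c)%N -> h' c ^+ 2 = L' (4 * c)%N * h' (2 * c)%N.
Hypothesis h_init' : forall c, (0 < c)%N -> ord_ge (2 * c) (h' c - qX c).
Hypothesis L_init' : forall c, (0 < c)%N -> ord_ge c (L' c - 1).

Let h_ord c : (0 < c)%N -> ord_ge c (h c).
Proof.
move=> c_gt0; rewrite -[h c](subrK (qX c)); apply: ord_geD; last exact: ord_geX.
by apply: ord_geW (h_init c_gt0); lia.
Qed.

(** Agreement to order c(k+2) for h and c(k+1) for L, for all c at once, improves by one step. The
    equation for h^2 involves only the arguments 2c and 4c, where the known orders are larger;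
    dividing h^2 - h'^2 by h + h', which starts with 2 q^c, costs only c. *)
Lemma functional_equation_unique c : (0 < c)%N -> h c = h' c /\ L c = L' c.
Proof.
suff key k : forall c, (0 < c)%N ->
    ord_ge (c * k.+2)%N (h c - h' c) /\ ord_ge (c * k.+1)%N (L c - L' c).
  move=> c_gt0; split; apply: fpsP => n; apply/eqP; rewrite -subr_eq0 -coef_fpsB; apply/eqP.
    have [-> //] := key n c c_gt0.
    by apply: leq_trans (leq_pmull _ c_gt0).
  have [_ -> //] := key n c c_gt0.
  by apply: leq_trans (leq_pmull _ c_gt0).
elim: k => [|k IHk] {}c c_gt0.
  split; rewrite ?muln1.
    rewrite -[h c](subrK (qX c)) -addrA -[qX c - _]opprB mulnC.
    by apply: ord_geD; [exact: h_init|apply: ord_geN; exact: h_init'].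
  rewrite -[L c](subrK 1) -addrA -[1 - _]opprB.
  by apply: ord_geD; [exact: L_init|apply: ord_geN; exact: L_init'].
have c2 : (0 < 2 * c)%N by lia.
have c4 : (0 < 4 * c)%N by lia.
have h_step : ord_ge (c * k.+3)%N (h c - h' c).
  have : ord_ge (c * k.+3 + c)%N ((h c - h' c) * (h c + h' c)).
    have -> : (h c - h' c) * (h c + h' c) =
       (L (4 * c)%N - L' (4 * c)%N) * h (2 * c)%N
       + L' (4 * c)%N * (h (2 * c)%N - h' (2 * c)%N).
      rewrite -[RHS](_ : h c ^+ 2 - h' c ^+ 2 = _); first by ring.
      by rewrite h_eq // h_eq' //; ring.
    apply: ord_geD.
      apply: ord_geW (ord_geM (IHk _ c4).2 (h_ord c2)); nia.
    by apply: ord_geMl; apply: ord_geW (IHk _ c2).1; nia.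
  apply: ord_ge_cancel.
    have -> : h c + h' c = (h c - qX c) + (h' c - qX c) + (qX c + qX c) by ring.
    apply: ord_geD; last by apply: ord_geD; apply: ord_geX.
    by apply: ord_geD; [apply: ord_geW (h_init c_gt0)|apply: ord_geW (h_init' c_gt0)]; lia.
  have -> : h c + h' c = (h c - qX c) + (h' c - qX c) + (qX c + qX c) by ring.
  have lt_c : (c < 2 * c)%N by lia.
  by rewrite 2!coef_fpsD (h_init c_gt0 lt_c) (h_init' c_gt0 lt_c) addr0 add0r /= eqxx.
split=> //.
have -> : L c - L' c = (L (2 * c)%N - L' (2 * c)%N) + 4%:R * (h c - h' c).
  by rewrite (L_eq c_gt0) (L_eq' c_gt0); ring.
apply: ord_geD; first by apply: ord_geW (IHk _ c2).2; nia.
by apply: ord_geMl; apply: ord_geW h_step; nia.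
Qed.

End FunctionalEquation.

Lemma dvdz_small (M s : int) : 0 < s -> s < M -> ~~ (M %| s)%Z.
Proof.
move=> s_gt0 s_lt; apply/negP => /dvdzP[k s_eq].
by have [k_gt0|k_le0] := ltrP 0 k; nia.
Qed.

(** The Lambert series of Jacobi's two-square theorem, equal to phi(q^c)^2 by [hser_psi]. *)
Definition lattice_ser c := 2%:R * Sum (on_class c 0 xser).
Definition weighted_ser d := Sum (on_class (2 * d)%N d (fun a => a%:~R * wser a)).

(** The self-paired case r = c = d - r of [hser_mul], for d = 2c. *)
Lemma hser_sqr c : (0 < c)%N ->
  (4 * c)%:R * hser (2 * c)%N c ^+ 2 = weighted_ser (2 * c)%N.
Proof.
move=> c_gt0; have c2 : (0 < 2 * c)%N by lia.
rewrite /weighted_ser -(@hser_mul (2 * c)%N c2 c); [|lia..].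
have -> : (2 * c)%N%:Z - c%:Z = c by lia.
by rewrite expr2 mulnA.
Qed.

Lemma lattice_ser_eq c : (0 < c)%N ->
  lattice_ser c = lattice_ser (2 * c)%N + 4%:R * hser (2 * c)%N c.
Proof.
move=> c_gt0; rewrite /lattice_ser.
have -> : Sum (on_class c 0 xser) =
    Sum (on_class (2 * c)%N 0 xser) + Sum (on_class (2 * c)%N c xser).
  rewrite -SumD; [|by apply: summable_on_class; apply: summable_xser..].
  apply: eq_Sum => a; rewrite /on_class !subr0.
  have [/dvdzP[k ->]|ndvd] := boolP (c %| a)%Z; last first.
    rewrite ifF ?ifF ?addr0 //; apply/negP => /dvdzP[k ak]; case/negP: ndvd; apply/dvdzP.
      by exists (2 * k + 1); move: ak; lia.
    by exists (2 * k); move: ak; lia.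
  have -> : (2 * c)%N%:Z = 2 * c%:Z by lia.
  have -> : k * c%:Z - c%:Z = (k - 1) * c%:Z by ring.
  rewrite !dvdz_mul2r //; [|lia..].
  have -> : (2 %| k - 1)%Z = ~~ (2 %| k)%Z by lia.
  by case: (2 %| k)%Z; rewrite ?addr0 ?add0r.
rewrite mulrDr Sum_xser_half // /hser.
have -> : (2 * (2 * c) = 4 * c)%N by lia.
by move: (Sum _) (Sum _) => x y; ring.
Qed.

(** The convolution of the classes 0 and c modulo 2c for [xser]. For g = c + 2ck the sign
    contribution is -1 - 2k = -g/c, the -1 coming from a = 0; the constant part drops out by
    [Sum_on_class_half]. *)
Lemma weighted_ser_eq c : (0 < c)%N ->
  weighted_ser c = (2 * c)%:R * (lattice_ser (2 * c)%N * hser (2 * c)%N c).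
Proof.
move=> c_gt0; have c2 : (0 < 2 * c)%N by lia.
have conv := @Sum_on_class_mul (2 * c)%N (- 1) xser yser ytail 0 c
  summable_xser summable_ytail (fun=> erefl).
have side a b : ((2 * c)%N %| a - 0)%Z -> ((2 * c)%N %| b - c%:Z)%Z ->
    2%:R * (xser a * xser b) = - 1 * (wser (b - a) * (yser a - yser b)).
  move=> a0 bc; rewrite mulN1r xser_mul //.
  apply: contraTneq a0 => ->; rewrite subr0; apply: contraTN bc => dvd_b.
  by rewrite addrC dvdz_addl_eq // dvdz_oppr dvdz_small //; lia.
move: {conv side}(conv side).
rewrite subr0 mulN1r => conv.
set cst := 2%:R * (_ - _) in conv.
rewrite Sum_xser_half // in conv.
have -> : hser (2 * c)%N c = Sum (on_class (4 * c)%N c wser).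
  by rewrite /hser; have -> : (2 * (2 * c) = 4 * c)%N by lia.
rewrite /lattice_ser.
transitivity (c%:R * (2%:R * (Sum (on_class (2 * c)%N 0 xser) *
   (2%:R * Sum (on_class (4 * c)%N c wser))))); last first.
  by move: (Sum _) (Sum _) => x y; rewrite natrM; ring.
rewrite conv /weighted_ser mulrN.
have sumc : summable (on_class (2 * c)%N c (fun g => wser g * (sgn_shift (2 * c)%N 0 g + cst))).
  by apply: summable_on_class; apply: summableMr; apply: summable_wser.
rewrite -SumMl // -SumN; last exact: (summableMl (fun=> _)).
transitivity (Sum (fun a => on_class (2 * c)%N c (fun a => a%:~R * wser a) a
   + (- (c%:R * cst)) * on_class (2 * c)%N c wser a)).
  rewrite SumD; first last.
  - by apply: (summableMl (fun=> _)); apply: summable_on_class; apply: summable_wser.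
  - by apply: summable_on_class; apply: summable_id_wser.
  rewrite SumMl; last by apply: summable_on_class; apply: summable_wser.
  by rewrite (@Sum_on_class_half c c_gt0 _ wserN summable_wser) mulr0 addr0.
apply: eq_Sum => g; rewrite /on_class; case: ifP => [/dvdzP[k]|_]; last by ring.
move/eqP; rewrite subr_eq => /eqP ->.
have shift_c : sgn_shift (2 * c)%N 0 c = - 1.
  rewrite /sgn_shift (@Sum_single _ _ _ 0); last first.
    move=> a a0; rewrite /on_class subr0; case: ifP => // /dvdzP[l a_eq].
    have l0 : l != 0 by apply: contraNneq a0 => l0; rewrite a_eq l0 mul0r.
    have [l_gt0|l_le0] := ltrP 0 l.
      by rewrite !gtr0_sgz ?subrr //; nia.
    have {l0}l_lt0 : l < 0 by lia.
    by rewrite !ltr0_sgz ?subrr //; nia.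
  by rewrite /on_class subrr dvdz0 add0r (gtr0_sgz (_ : 0 < c%:Z)) ?ltz_nat.
rewrite [k * _ + _]addrC sgn_shiftD shift_c add0r sgn_shift_multiple //; last first.
  by apply: dvdz_small; lia.
by rewrite intrD intrM -!pmulrn natrM; ring.
Qed.

Lemma hser_init c : (0 < c)%N -> ord_ge (2 * c) (hser (2 * c)%N c - qX c).
Proof.
move=> c_gt0 n lt_n; rewrite coef_fpsB (@coef_Sum _ _ _ [:: c%:Z]) => [|a].
  rewrite /= big_seq1 /on_class subrr dvdz0 /= gtr0_sgz ?ltz_nat // mul1r.
  have [->|n_c] := eqVneq n c; first by rewrite dvdnn divnn c_gt0 subrr.
  have [/dvdnP[k n_eq]|//] := boolP (c %| n)%N.
  case: k n_eq => [|[|k]] n_eq.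
  - by rewrite n_eq mul0n div0n subrr.
  - by rewrite n_eq mul1n eqxx in n_c.
  by exfalso; move: lt_n; rewrite n_eq ltn_pmul2r.
rewrite inE => a_c; rewrite /on_class; case: ifP => // /dvdzP[k a_eq].
apply: wser_ord; have [k0|k0] := eqVneq k 0.
  by case/eqP: a_c; move: a_eq; rewrite k0; lia.
by nia.
Qed.

Lemma lattice_ser_init c : (0 < c)%N -> ord_ge c (lattice_ser c - 1).
Proof.
move=> c_gt0 n lt_n; rewrite coef_fpsB coef_natM (@coef_Sum _ _ _ [:: 0]) => [|a].
  by rewrite /= big_seq1 /on_class subrr dvdz0 /= mulrC divfK // subrr.
rewrite inE => a0; rewrite /on_class; case: ifP => // /dvdzP[k a_eq].
apply: xser_ord; rewrite subr0 in a_eq; have [k0|k0] := eqVneq k 0.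
  by case/eqP: a0; rewrite a_eq k0 mul0r.
by nia.
Qed.

Lemma psi_init k : (0 < k)%N -> ord_ge k (psi k - 1).
Proof.
move=> k_gt0 n lt_n; rewrite coef_fpsB (@coef_Sum _ _ _ [:: 0%N]) => [|m].
  by rewrite /= big_seq1 /= /triangular muln0 subrr.
rewrite inE => m0; apply: ord_geX; apply: leq_trans lt_n _.
have := leq_triangular m; nia.
Qed.

Lemma phi_init k : (0 < k)%N -> ord_ge k (phi k - 1).
Proof.
move=> k_gt0 n lt_n; rewrite coef_fpsB (@coef_Sum _ _ _ [:: 0]) => [|m].
  by rewrite /= big_seq1 /= muln0 subrr.
rewrite inE => m0; apply: ord_geX; apply: leq_trans lt_n _.
by nia.
Qed.

(** Lambert series and theta functions satisfy the same system L(c) = L(2c) + 4 h(c), h(c)^2 = L(4c)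
    h(2c), with the same leading terms. *)
Lemma hser_psi c : (0 < c)%N ->
  hser (2 * c)%N c = qX c * psi (4 * c)%N ^+ 2 /\ lattice_ser c = phi c ^+ 2.
Proof.
apply: (@functional_equation_unique (fun c => hser (2 * c)%N c) lattice_ser
  (fun c => qX c * psi (4 * c)%N ^+ 2) (fun c => phi c ^+ 2)) => {}c c_gt0.
- exact: lattice_ser_eq.
- apply: (@fps_natI (4 * c)%N); first by lia.
  rewrite hser_sqr // weighted_ser_eq; last by lia.
  by have -> : (2 * (2 * c) = 4 * c)%N by lia.
- exact: hser_init.
- exact: lattice_ser_init.
- by rewrite phi_sqr.
- have c4 : (0 < 4 * c)%N by lia.
  rewrite exprMn (psi_sqr c4) exprMn; have -> : (4 * (2 * c) = 2 * (4 * c))%N by lia.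
  by rewrite mulrCA -fpsXM [(c * 2)%N]mulnC.
- rewrite -[X in _ - X]mulr1 -mulrBr; apply: ord_geMl.
  have -> : psi (4 * c)%N ^+ 2 - 1 = (psi (4 * c)%N - 1) * (psi (4 * c)%N + 1) by ring.
  apply: ord_geMr; apply: ord_geW (@psi_init (4 * c)%N _); lia.
have -> : phi c ^+ 2 - 1 = (phi c - 1) * (phi c + 1) by ring.
by apply: ord_geMr; apply: phi_init.
Qed.

(** Legendre's theorem on four triangular numbers; psi(q^(2c))^2 = phi(q^(2c)) psi(q^(4c)) merges
    the two theta factors. *)
Lemma weighted_ser_psi c : (0 < c)%N ->
  weighted_ser c = (2 * c)%:R * (qX c * psi (2 * c)%N ^+ 4).
Proof.
move=> c_gt0; have c2 : (0 < 2 * c)%N by lia.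
rewrite weighted_ser_eq // (hser_psi c_gt0).1 (hser_psi c2).2.
have -> : psi (2 * c)%N ^+ 4 = (psi (2 * c)%N ^+ 2) ^+ 2 by rewrite -exprM.
rewrite (psi_sqr c2); have -> : (2 * (2 * c) = 4 * c)%N by lia.
by move: (phi _) (psi _) (qX _) => x y z; ring.
Qed.

(** * Andréief's identity for tuples with prescribed class counts *)

Lemma Sum_fin (R : idomainType) (T : finType) (F : T -> fps R) : Sum F = \sum_t F t.
Proof.
by apply: Sum_seq => [|t]; [apply: index_enum_uniq|rewrite mem_index_enum].
Qed.

Lemma summable_fin (R : idomainType) (T : finType) (F : T -> fps R) : summable F.
Proof. by apply: (@summable_seq _ _ _ (index_enum T)) => t; rewrite mem_index_enum. Qed.

Lemma enum_val_mono m (P : pred 'I_m) (a b : 'I_#|P|) :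
  (enum_val a < enum_val b)%N = (a < b)%N.
Proof.
suff mono (i j : 'I_#|P|) : (i < j)%N -> (enum_val i < enum_val j)%N.
  by case: (ltngtP a b) => [/mono|/mono/ltnW|/val_inj->];
    rewrite ?ltnn // [RHS]/=; case: ltngtP.
move=> lt_ij; have x0 := enum_val i; rewrite !(enum_val_nth x0).
have sorted_P : sorted ltn [seq val k | k <- enum P].
  rewrite -[enum P]/(filter P _).
  apply: (subseq_sorted ltn_trans (map_subseq _ (filter_subseq _ _))).
  by rewrite -enumT val_enum_ord iota_ltn_sorted.
have := sorted_ltn_nth ltn_trans 0%N sorted_P i j.
rewrite !inE size_map -cardE !ltn_ord => /(_ isT isT lt_ij).
by rewrite !(nth_map x0) -?cardE.
Qed.

Lemma det_mul_tall (R : comNzRingType) m n (V : 'M[R]_(m, n)) (U : 'M[R]_(n, m)) :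
  (n < m)%N -> \det (V *m U) = 0.
Proof.
move=> lt_nm; have -> : V *m U = (V *m (pid_mx n : 'M_(n, m))) *m ((pid_mx n : 'M_(m, n)) *m U).
  rewrite mulmxA -[V *m _ *m _]mulmxA mul_pid_mx minnn (minn_idPr (ltnW lt_nm)).
  by rewrite pid_mx_1 mulmx1.
rewrite det_mulmx; have -> : \det (V *m (pid_mx n : 'M_(n, m))) = 0; last by rewrite mul0r.
rewrite (expand_det_col _ (Ordinal lt_nm)) big1 // => i _.
rewrite mxE big1 ?mul0r // => k _; rewrite [X in _ * X]mxE /= (ltn_eqF (ltn_ord k)).
exact: mulr0.
Qed.

Lemma det_vdm_gram (R : comNzRingType) m n (y : 'I_m -> R)
    (V := \matrix_(i < m, s < n) y i ^+ s) : m = n -> \det (V *m V^T) = vdm y ^+ 2.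
Proof.
move=> eq_mn; move: @V; rewrite -eq_mn => V.
by rewrite det_mulmx det_tr -expr2 det_vdm.
Qed.

Section ClassAndreief.
Variables (R : idomainType) (m : nat) (T L : finType) (cl : T -> L) (lam : 'I_m -> L).
Variables (y u : T -> fps R).

Local Notation fib rho := [pred a | lam a == rho].

Definition same_counts (kappa : 'I_m -> L) :=
  [forall rho, #|[pred i | kappa i == rho]| == #|fib rho|].

Definition class_vdm (k : 'I_m -> T) :=
  \prod_(i < m) \prod_(j < m | (i < j)%N && (cl (k i) == cl (k j))) (y (k j) - y (k i)).

(** Position of an index inside its class. The functions [phi a] are monomials of degree [rank a]
    restricted to one class, which makes their Gram matrix block diagonal. *)
Let rank a := index a (enum (fib (lam a))).
Let phi a x : fps R := (cl x == lam a)%:R * y x ^+ rank a.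

Let rank_enum_val rho (a : 'I_#|fib rho|) : rank (enum_val a) = a.
Proof.
have := enum_valP a; rewrite inE => /eqP lam_a; rewrite /rank lam_a.
by rewrite (enum_val_nth (enum_val a)) index_uniq ?enum_uniq // -cardE.
Qed.

Let fib_codom rho i : (lam i == rho) = (i \in codom (fun a : 'I_#|fib rho| => enum_val a)).
Proof.
apply/idP/codomP => [i_rho|[a ->]]; last by have := enum_valP a.
have i_in : i \in fib rho by [].
by exists (enum_rank_in i_in i); rewrite enum_rankK_in.
Qed.

Lemma det_class_moments :
  \det (\matrix_(a < m, b < m) \sum_x phi a x * phi b x * u x) =
  \prod_rho \det (\matrix_(a < #|fib rho|, b < #|fib rho|)
    \sum_(x | cl x == rho) y x ^+ (a + b) * u x).
Proof.
rewrite (@det_blocks _ _ L lam _ _ (fun rho => #|fib rho|) (fun rho a => enum_val a)).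
- apply: eq_bigr => rho _; congr (\det _); apply/matrixP => a b; rewrite !mxE.
  rewrite [RHS]big_mkcond; apply: eq_bigr => x _; rewrite /phi !rank_enum_val.
  have := enum_valP a; have := enum_valP b; rewrite !inE => /eqP -> /eqP ->.
  by case: eqP => _; rewrite ?mul0r // !mul1r exprD.
- move=> a b ne_ab; rewrite mxE big1 // => x _; rewrite /phi.
  have [->|_] := eqVneq (cl x) (lam a); last by rewrite !mul0r.
  by rewrite (negPf ne_ab) mul0r mulr0 mul0r.
- by move=> rho; apply: enum_val_inj.
exact: fib_codom.
Qed.

(** The square is the determinant of A A^T, block diagonal with blocks V V^T, where V has one row
    per entry of k in the class and one column per prescribed entry. If the counts differ, some
    class has too many entries, the totals being equal, and its block is singular; otherwise each V
    is a square Vandermonde matrix. *)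
Lemma det_class_sqr (k : 'I_m -> T) :
  \det (\matrix_(i < m, a < m) phi a (k i)) ^+ 2 =
  if same_counts (fun i => cl (k i)) then class_vdm k ^+ 2 else 0.
Proof.
set kappa := fun i => cl (k i); pose J rho := [pred i | kappa i == rho].
set A := \matrix_(i, a) phi a (k i).
pose V rho : 'M[fps R]_(#|J rho|, #|fib rho|) := \matrix_(i, s) y (k (enum_val i)) ^+ s.
have kappa_val rho (i : 'I_#|J rho|) : cl (k (enum_val i)) = rho.
  by have := enum_valP i; rewrite inE => /eqP.
have detA : \det A ^+ 2 = \prod_rho \det (V rho *m (V rho)^T).
  rewrite expr2 -[X in _ * X]det_tr -det_mulmx.
  rewrite (@det_blocks _ _ L kappa _ _ (fun rho => #|J rho|) (fun rho a => enum_val a)).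
  - apply: eq_bigr => rho _; congr (\det _); apply/matrixP => i j; rewrite !mxE.
    rewrite (bigID (fib rho)) /= [X in _ + X]big1 ?addr0 => [|a lam_a]; last first.
      by rewrite !mxE /phi kappa_val eq_sym (negPf lam_a) !mul0r.
    rewrite (big_enum_val (A := fib rho)) /=; apply: eq_bigr => a _.
    rewrite !mxE /phi !kappa_val rank_enum_val.
    by rewrite (eqP (enum_valP a : lam (enum_val a) == rho)) eqxx !mul1r.
  - move=> i j ne_ij; rewrite mxE big1 // => a _; rewrite !mxE /phi.
    rewrite -/(kappa i) -/(kappa j); have [<-|_] := eqVneq (kappa i) (lam a).
      by rewrite eq_sym (negPf ne_ij) mul0r mulr0.
    by rewrite !mul0r.
  - by move=> rho; apply: enum_val_inj.
  move=> rho i; apply/idP/codomP => [i_rho|[a ->]]; last by have := enum_valP a.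
  have i_in : i \in J rho by [].
  by exists (enum_rank_in i_in i); rewrite enum_rankK_in.
have card_sum (kap : 'I_m -> L) : (\sum_rho #|[pred i | kap i == rho]| = m)%N.
  rewrite -[RHS]card_ord -sum1_card (partition_big kap xpredT) //=.
  by apply: eq_bigr => rho _; rewrite sum1_card.
case: ifP => [/forallP counts|/negbT counts]; last first.
  have [rho lt_rho] : exists rho, (#|fib rho| < #|J rho|)%N.
    apply/existsP; apply: contraR counts; rewrite negb_exists => /forallP le_J.
    have {}le_J rho : (#|J rho| <= #|fib rho|)%N by rewrite leqNgt.
    have [_] := leqif_sum (fun rho (_ : xpredT rho) => leqif_eq (le_J rho)).
    rewrite !card_sum eqxx => /esym /forall_inP eq_J.
    by apply/forallP => rho; apply: eq_J.
  by rewrite detA (bigD1 rho) //= det_mul_tall ?mul0r.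
rewrite detA.
have -> : class_vdm k ^+ 2 =
    \prod_rho (vdm (fun i : 'I_#|J rho| => y (k (enum_val i)))) ^+ 2.
  rewrite prodrXl; congr (_ ^+ 2); rewrite /class_vdm.
  rewrite (partition_big kappa xpredT) //=; apply: eq_bigr => rho _.
  rewrite (big_enum_val (A := J rho)) /=; apply: eq_bigr => a _.
  transitivity (\prod_(j in J rho | (enum_val a < j)%N) (y (k j) - y (k (enum_val a)))).
    by apply: eq_bigl => j; rewrite kappa_val andbC eq_sym.
  rewrite big_enum_val_cond /=; apply: eq_bigl => b.
  exact: enum_val_mono.
by apply: eq_bigr => rho _; apply: det_vdm_gram; apply/eqP; apply: counts.
Qed.

Lemma class_andreief :
  \sum_(k : {ffun 'I_m -> T} | same_counts (fun i => cl (k i)))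
     class_vdm k ^+ 2 * \prod_i u (k i)
  = m`!%:R * \prod_rho \det (\matrix_(a < #|fib rho|, b < #|fib rho|)
      \sum_(x | cl x == rho) y x ^+ (a + b) * u x).
Proof.
rewrite -det_class_moments.
have := @andreief R T m phi phi u (summable_fin _).
have -> : \matrix_(i, j) Sum (fun x => phi i x * phi j x * u x) =
          \matrix_(a < m, b < m) \sum_x phi a x * phi b x * u x.
  by apply/matrixP => i j; rewrite !mxE Sum_fin.
move=> <-; rewrite Sum_fin big_mkcond; apply: eq_bigr => k _.
rewrite -expr2 det_class_sqr; case: ifP => // _.
by rewrite mul0r.
Qed.

End ClassAndreief.

(** * Rational constants and congruences modulo powers of q *)

Definition fconst (c : rat) : qser := Fps (fun n => if n is 0 then c else 0).

Lemma coef_fconstM c f n : fcoef (fconst c * f) n = c * fcoef f n.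
Proof.
rewrite coef_fpsM big_ord_recl subn0 big1 ?addr0 // => i _.
exact: mul0r.
Qed.

Fact fconst_is_zmod_morphism : zmod_morphism fconst.
Proof. by move=> a b; apply: fpsP => -[|n]; rewrite coef_fpsB //= subr0. Qed.

Fact fconst_is_monoid_morphism : monoid_morphism fconst.
Proof.
split; first by apply: fpsP => -[].
by move=> a b; apply: fpsP => n; rewrite coef_fconstM /=; case: n => //; rewrite mulr0.
Qed.

HB.instance Definition _ := GRing.isZmodMorphism.Build rat qser fconst fconst_is_zmod_morphism.
HB.instance Definition _ := GRing.isMonoidMorphism.Build rat qser fconst fconst_is_monoid_morphism.

(* Restated without the canonical morphism, so that rewriting leaves [fconst] syntactically intact. *)
Lemma fconstM a b : fconst (a * b) = fconst a * fconst b.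
Proof. exact: rmorphM. Qed.

Lemma fconstX a n : fconst (a ^+ n) = fconst a ^+ n.
Proof. exact: rmorphXn. Qed.

Lemma fconstN a : fconst (- a) = - fconst a.
Proof. exact: rmorphN. Qed.

Lemma fconstB a b : fconst (a - b) = fconst a - fconst b.
Proof. exact: rmorphB. Qed.

Lemma fconst1 : fconst 1 = 1.
Proof. exact: rmorph1. Qed.

Lemma fconst_nat n : fconst n%:R = n%:R.
Proof. exact: rmorph_nat. Qed.

Lemma fconst_prod (I : Type) (r : seq I) (P : pred I) (F : I -> rat) :
  fconst (\prod_(i <- r | P i) F i) = \prod_(i <- r | P i) fconst (F i).
Proof. exact: rmorph_prod. Qed.

Definition eqmodX K (f g : qser) := ord_ge K (f - g).

Lemma eqmodX_refl K f : eqmodX K f f.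
Proof. by move=> n _; rewrite subrr. Qed.

Lemma eqmodX_coef K f g n : eqmodX K f g -> (n < K)%N -> fcoef f n = fcoef g n.
Proof. by move=> fg lt_n; apply/eqP; rewrite -subr_eq0 -coef_fpsB fg. Qed.

Lemma eqmodX_sum K (I : Type) (r : seq I) (P : pred I) (F G : I -> qser) :
  (forall i, P i -> eqmodX K (F i) (G i)) ->
  eqmodX K (\sum_(i <- r | P i) F i) (\sum_(i <- r | P i) G i).
Proof. by move=> FG; rewrite /eqmodX -sumrB; apply: ord_ge_sum. Qed.

Lemma eqmodXM K f g f' g' : eqmodX K f g -> eqmodX K f' g' -> eqmodX K (f * f') (g * g').
Proof.
move=> fg fg'; rewrite /eqmodX.
have -> : f * f' - g * g' = (f - g) * f' + g * (f' - g') by ring.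
by apply: ord_geD; [apply: ord_geMr|apply: ord_geMl].
Qed.

Lemma eqmodX_prod K (I : Type) (r : seq I) (P : pred I) (F G : I -> qser) :
  (forall i, P i -> eqmodX K (F i) (G i)) ->
  eqmodX K (\prod_(i <- r | P i) F i) (\prod_(i <- r | P i) G i).
Proof.
move=> FG; elim/big_rec2: _ => [|i f g Pi fg]; first exact: eqmodX_refl.
by apply: eqmodXM => //; apply: FG.
Qed.

Lemma eqmodX_det K n (A B : 'M[qser]_n) :
  (forall i j, eqmodX K (A i j) (B i j)) -> eqmodX K (\det A) (\det B).
Proof.
move=> AB; apply: eqmodX_sum => s _; apply: eqmodXM; first exact: eqmodX_refl.
by apply: eqmodX_prod.
Qed.

(** Only the multiples ±ex with x at most N can contribute up to order eN. The index 0 is listed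
    twice, which is harmless because F 0 = 0. *)
Lemma coef_Sum_int e N (F : int -> qser) n : (0 < e)%N ->
  (forall a, ord_ge `|a| (F a)) -> F 0 = 0 -> (forall a, ~~ (e %| a)%Z -> F a = 0) ->
  (n <= e * N)%N ->
  fcoef (Sum F) n = fcoef (\sum_(x < N.+1) (F (e * x)%N%:Z + F (- (e * x)%N%:Z))) n.
Proof.
move=> e_gt0 F_ord F0 F_dvd le_n.
have sumF : summable F by apply: summable_int.
pose s := [seq (e * x)%N%:Z | x <- iota 0 N.+1] ++ [seq - (e * x.+1)%N%:Z | x <- iota 0 N].
have uniq_s : uniq s.
  rewrite cat_uniq; apply/and3P; split.
  - by rewrite map_inj_uniq ?iota_uniq // => x y; nia.
  - by apply/hasPn => _ /mapP[x _ ->]; apply/negP => /mapP[y _]; nia.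
  by rewrite map_inj_uniq ?iota_uniq // => x y; nia.
rewrite (@coef_Sum _ _ _ s) => [|a a_s]; last first.
  have [/dvdzP[k a_eq]|ndvd] := boolP (e %| a)%Z; last by rewrite F_dvd.
  apply: F_ord; apply: leq_ltn_trans le_n _; rewrite ltnNge; apply: contra a_s => le_a.
  rewrite mem_cat; apply/orP; have [k_ge0|k_lt0] := leP 0 k; [left|right].
    by apply/mapP; exists `|k|%N; rewrite ?mem_iota; nia.
  by apply/mapP; exists `|k|.-1; rewrite ?mem_iota; nia.
congr (fcoef _ n); rewrite undup_id // big_cat !big_map /= big_split /=.
congr (_ + _).
  by rewrite -[RHS](big_mkord xpredT (fun x => F (e * x)%N%:Z)) /index_iota subn0.
rewrite big_ord_recl /= muln0 oppr0 F0 add0r.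
by rewrite -(big_mkord xpredT (fun x => F (- (e * x.+1)%N%:Z))) /index_iota subn0.
Qed.

(** * Residue classes up to sign, nodes, weights and truncated moments *)

Section SignedClasses.
Variable d : nat.
Hypothesis d_gt0 : (0 < d)%N.
Local Notation M := (2 * d)%N.

(* The class of [v] modulo [2 * d] up to sign, represented in [0 .. d]. *)
Definition cls v : 'I_d.+1 := inord (minn (v %% M) (M - v %% M)).
Definition negative_cls v := (d < v %% M)%N.

Lemma clsE v : cls v = minn (v %% M) (M - v %% M) :> nat.
Proof. by rewrite inordK // ltnS; case: leqP; lia. Qed.

Let M_gt0 : (0 < M)%N. Proof. by rewrite muln_gt0. Qed.

Lemma dvdz_sub_class v r : (r < M)%N -> (M %| v%:Z - r%:Z)%Z = (v %% M == r)%N.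
Proof. by move=> lt_r; rewrite -eqz_mod_dvd !modz_nat [(r %% _)%N]modn_small. Qed.

Lemma dvdz_opp_class v r : (0 < r < M)%N -> (M %| - v%:Z - r%:Z)%Z = (v %% M == M - r)%N.
Proof.
move=> lt_r; rewrite -opprD dvdz_oppr -PoszD dvdzE /= {1}(divn_eq v M) -addnA.
rewrite dvdn_addr; last exact: dvdn_mull.
have := ltn_pmod v M_gt0.
move: (v %% M)%N => t lt_t; apply/dvdnP/eqP => [[k]|->]; last by exists 1%N; lia.
by case: k => [|[|k]]; nia.
Qed.

Lemma cls_generic v (r : 'I_d.+1) : (0 < r < d)%N ->
  (M %| v%:Z - r%:Z)%Z = (cls v == r) && ~~ negative_cls v /\
  (M %| - v%:Z - r%:Z)%Z = (cls v == r) && negative_cls v.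
Proof.
move=> r_in; rewrite dvdz_sub_class ?dvdz_opp_class; [|lia..].
rewrite -val_eqE /= clsE /negative_cls; have := ltn_pmod v M_gt0.
by move: (v %% M)%N => t; split; lia.
Qed.

Lemma cls_selfdual v (r : 'I_d.+1) : (r == 0 :> nat) || (r == d :> nat) ->
  (M %| v%:Z - r%:Z)%Z = (cls v == r) /\ (M %| - v%:Z - r%:Z)%Z = (cls v == r).
Proof.
have := ltn_pmod v M_gt0; rewrite -val_eqE /= clsE => lt_v.
case/orP=> /eqP ->.
  rewrite !subr0 dvdz_oppr dvdzE /= /dvdn; move: (v %% M)%N lt_v => t; split; lia.
rewrite dvdz_sub_class ?dvdz_opp_class; [|lia..].
move: (v %% M)%N lt_v => t; split; lia.
Qed.

(** In a generic class r the sign makes ±v congruent to r, so differences of nodes are, up to sign,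
    half differences or half sums of the entries. In the classes 0 and d both congruences hold, and
    squaring makes a difference of nodes the product of the two. *)
Definition node v : rat :=
  if (0 < cls v < d)%N then (-1) ^+ negative_cls v * v%:R / 2 else (v%:R / 2) ^+ 2.
(** The factors of the summand outside the squared differences. In generic classes the sign is that
    of w(-v) = -w(v), for v folded to its representative. *)
Definition weight v : rat :=
  if cls v == 0%N :> nat then v%:R ^+ 3 / 4
  else if cls v == d :> nat then v%:R else (-1) ^+ negative_cls v.

Section Moments.
Variables (e N : nat).
Hypothesis e_gt0 : (0 < e)%N.
Hypothesis e_dvd : (e %| M)%N.
Local Notation K := (e * N).+1.

(** The matrix entries produced by [class_andreief] for v = e x: e = 1 serves the first identity and
    e = 2 the second. *)
Definition moment (r : 'I_d.+1) s : qser :=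
  \sum_(x < N.+1 | cls (e * x) == r)
    fconst (node (e * x)) ^+ s * (fconst (weight (e * x)) * wser (e * x)%N).

Lemma cmom_eqmodX (r : 'I_d.+1) s : (e %| r)%N ->
  eqmodX K (cmom M r s) (\sum_(x < N.+1)
    (on_class M r (fun a => a%:~R ^+ s * wser a) (e * x)%N%:Z +
     on_class M r (fun a => a%:~R ^+ s * wser a) (- (e * x)%N%:Z))).
Proof.
move=> e_r n lt_n; rewrite coef_fpsB.
have -> : cmom M r s = Sum (on_class M r (fun a => a%:~R ^+ s * wser a)).
  by apply: eq_Sum => a; rewrite /on_class; case: ifP => //; rewrite mulr0.
rewrite (@coef_Sum_int e N) ?subrr //.
- by move=> a; apply: on_class_ord; apply: ord_geMl; apply: wser_ord.
- rewrite /on_class; case: ifP => // _; rewrite (_ : wser 0 = 0) ?mulr0 //.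
  by apply: fpsP => k; rewrite /= mul0r.
move=> a ndvd; rewrite /on_class; case: ifP => // dvd_a; case/negP: ndvd.
have : (e%:Z %| a - r%:Z)%Z by apply: dvdz_trans dvd_a.
have e_r' : (e%:Z %| - r%:Z)%Z by rewrite dvdz_oppr.
by rewrite dvdz_addl_eq.
Qed.

Lemma fconst_mulKn (n : nat) f : (0 < n)%N -> fconst n%:R^-1 * (n%:R * f) = f.
Proof.
move=> n_gt0; rewrite mulrA -fconst_nat -fconstM mulVf ?fconst1 ?mul1r //.
by rewrite pnatr_eq0 -lt0n.
Qed.

Lemma coef_sub_eq0 (f g : qser) n : f = g -> fcoef (f - g) n = 0.
Proof. by move=> ->; rewrite subrr coef_fps0. Qed.

Lemma fconst_intX (a : int) c s : fconst ((a%:~R * c) ^+ s) = fconst (c ^+ s) * a%:~R ^+ s.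
Proof. by rewrite exprMn fconstM mulrC (fconstX a%:~R) -(rmorph_int fconst a). Qed.

(** A positive v of class r accounts for exactly one of the integers ±v in the full residue
    class. *)
Lemma moment_generic (r : 'I_d.+1) s : (e %| r)%N -> (0 < r < d)%N ->
  eqmodX K (moment r s) (fconst (2^-1 ^+ s) * cmom M r s).
Proof.
move=> e_r r_in; rewrite /moment big_mkcond /=.
have := eqmodXM (eqmodX_refl (fconst (2^-1 ^+ s))) (cmom_eqmodX s e_r).
rewrite mulr_sumr => eq_r n lt_n; rewrite coef_fpsB.
rewrite [X in _ - X](eqmodX_coef eq_r lt_n) -coef_fpsB -sumrB.
rewrite coef_fps_sum big1 // => x _; apply: coef_sub_eq0.
rewrite /on_class; have [-> ->] := cls_generic (e * x) r_in.
have [xr|_] := eqVneq (cls (e * x)) r; last by rewrite addr0 mulr0.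
rewrite /node /weight xr r_in; have [/negPf -> /negPf ->] : (r != 0 :> nat) /\ (r != d :> nat) by lia.
move: (e * x)%N => v; rewrite -fconstX; case: (negative_cls v).
  rewrite andbF andbT add0r wserN !expr1 fconstN fconst1 !mulN1r !mulrN.
  have -> : - v%:R = (- v%:Z)%:~R :> rat by rewrite mulrNz.
  by rewrite fconst_intX mulrA.
rewrite andbF andbT addr0 !expr0 !mul1r fconst1 mul1r.
by rewrite -[v%:R]/(v%:Z%:~R) fconst_intX mulrA.
Qed.

(** Here v and -v are both in the residue class and contribute equally, the exponent 2s + t and the
    function w being odd; hence the factor 1/2. *)
Lemma moment_selfdual (r : 'I_d.+1) (c : rat) t s : (e %| r)%N -> ~~ (0 < r < d)%N -> odd t ->
  (forall v, cls v = r -> weight v = c * v%:R ^+ t) ->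
  eqmodX K (moment r s) (fconst (c / 2 * 4^-1 ^+ s) * cmom M r (2 * s + t)).
Proof.
move=> e_r r_in odd_t weight_r; rewrite /moment big_mkcond /=.
have := eqmodXM (eqmodX_refl (fconst (c / 2 * 4^-1 ^+ s))) (cmom_eqmodX (2 * s + t) e_r).
rewrite mulr_sumr => eq_r n lt_n; rewrite coef_fpsB.
rewrite [X in _ - X](eqmodX_coef eq_r lt_n) -coef_fpsB -sumrB.
rewrite coef_fps_sum big1 // => x _; apply: coef_sub_eq0.
have r_out : (r == 0 :> nat) || (r == d :> nat) by have := ltn_ord r; lia.
rewrite /on_class; have [-> ->] := cls_selfdual (e * x) r_out.
have [xr|_] := eqVneq (cls (e * x)) r; last by rewrite addr0 mulr0.
rewrite /node (weight_r _ xr) xr (negPf r_in).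
move: (e * x)%N => v.
have -> : (- v%:Z)%:~R ^+ (2 * s + t) * wser (- v%:Z) = v%:Z%:~R ^+ (2 * s + t) * wser v.
  rewrite wserN mulrNz exprNn -signr_odd oddD odd_t mul2n odd_double.
  by rewrite expr1 mulN1r mulrNN.
have -> : v%:Z%:~R = fconst v%:R :> qser by rewrite fconst_nat.
rewrite -[X in _ = _ * X]mulr2n -[X in _ = _ * X]mulr_natl -[X in _ = _ * (X * _)](fconst_nat 2) -!fconstX !mulrA -!fconstM.
congr (fconst _ * _).
have -> : v%:R ^+ (2 * s + t) = (v%:R ^+ 2) ^+ s * v%:R ^+ t :> rat by rewrite -exprM -exprD.
rewrite expr_div_n exprMn.
have -> : (2 ^+ 2)^-1 = 4^-1 :> rat by [].
by field.
Qed.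

End Moments.
End SignedClasses.

(** * Closed form of the determinant of one class *)

Lemma det_scale_hankel (R : comNzRingType) n (t : R) (c : nat -> R) :
  \det (\matrix_(a < n, b < n) (t ^+ (a + b) * c (a + b)%N)) =
  t ^+ (2 * 'C(n, 2)) * \det (\matrix_(a < n, b < n) c (a + b)%N).
Proof.
set C := \matrix_(a, b) c _; pose D : 'M[R]_n := diag_mx (\row_a t ^+ a).
have -> : \matrix_(a < n, b < n) (t ^+ (a + b) * c (a + b)%N) = D *m C *m D.
  apply/matrixP => a b; rewrite mul_mx_diag mul_diag_mx !mxE exprD.
  by rewrite mulrAC.
have detD : \det D = t ^+ 'C(n, 2).
  rewrite det_diag -triangular_sum big_mkord expr_sum.
  by apply: eq_bigr => a _; rewrite mxE.
by rewrite !det_mulmx detD mul2n -addnn exprD mulrAC.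
Qed.

Lemma det_scale (R : comNzRingType) n (t : R) (F : 'I_n -> 'I_n -> R) :
  \det (\matrix_(a, b) (t * F a b)) = t ^+ n * \det (\matrix_(a, b) F a b).
Proof.
by rewrite -detZ; congr (\det _); apply/matrixP => a b; rewrite !mxE.
Qed.

Lemma bin2_double n : 'C(2 * n, 2) = (n + 2 * (2 * 'C(n, 2)))%N.
Proof.
elim: n => // n IHn; have -> : (2 * n.+1 = (2 * n).+2)%N by lia.
by rewrite !binS !bin1 !bin0 IHn; lia.
Qed.

Lemma bin2_doubleS n : 'C(2 * n + 1, 2) = (n + 2 * n + 2 * (2 * 'C(n, 2)))%N.
Proof. by rewrite addn1 binS bin1 bin2_double; lia. Qed.

Section ClassDeterminants.
Variable d : nat.
Hypothesis d_gt0 : (0 < d)%N.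
Local Notation M := (2 * d)%N.

Definition base : qser := qX d * psi M ^+ 4.
Local Notation p := base.

Lemma psi_neq0 k : (0 < k)%N -> psi k <> 0.
Proof.
move=> k_gt0 psi0; have := psi_init k_gt0 k_gt0.
by rewrite psi0 sub0r coef_fpsN coef_fps1.
Qed.

Lemma fps_expf_neq0 (f : qser) k : f <> 0 -> f ^+ k <> 0.
Proof.
move=> f0; elim: k => [|k IHk]; last by rewrite exprS => /fps_mulf_eq0[].
by move/(congr1 (fun f => fcoef f 0)); rewrite expr0 coef_fps1.
Qed.

Lemma base_neq0 : p <> 0.
Proof.
move/fps_mulf_eq0 => [|]; first exact: fpsX_neq0.
by apply: fps_expf_neq0; apply: psi_neq0; rewrite muln_gt0.
Qed.

Lemma base_nonneg : nonneg p.
Proof.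
have qX_ge0 k : nonneg (qX k) by move=> n; rewrite ler0n.
by apply: nonnegM => //; apply: nonnegX; apply: nonneg_Sum => n.
Qed.

Lemma cmom_base : cmom M d 1 = M%:R * p.
Proof.
rewrite /base -weighted_ser_psi //; apply: eq_Sum => a.
by rewrite /on_class; case: ifP; rewrite ?mulr0.
Qed.

Let M_gt0 : (0 < M)%N. Proof. by rewrite muln_gt0. Qed.

Let eval := odd_hankel_eval d_gt0 base_nonneg base_neq0 cmom_base.

Let parity_cd s : ~~ odd s -> cmom M d s = 0.
Proof. by apply: cmom_even; apply/dvdzP; exists 1; lia. Qed.

Let parity_c0 s : ~~ odd s -> cmom M 0 s.+2 = 0.
Proof. by move=> even_s; apply: cmom_even; rewrite ?addr0 ?dvdz0 //= negbK. Qed.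

(** Odd sizes come from [hankel_odd] and the value of B_u. For even sizes [hankel_even] shows that r
    may be replaced by d, and the value of A_u applies. *)
Lemma hankel_generic (r : nat) n : (0 < r < d)%N ->
  hankel (cmom M r) n = (-1) ^+ n./2 * (hankel_const M n)%:R ^+ 2
    * (p ^+ (n./2 * uphalf n * 2) * (if odd n then hser d r else 1)).
Proof.
move=> r_in; have ndvd s : (0 < s < M)%N -> ~~ (M %| s%:Z)%Z.
  by move=> s_in; apply: dvdz_small; lia.
have r_ndvd : ~~ (M %| r%:Z)%Z by apply: ndvd; lia.
have d_ndvd : ~~ (M %| d%:Z)%Z by apply: ndvd; lia.
have [odd_n|even_n] := boolP (odd n).
  have -> : n = n./2.*2.+1 by rewrite -[LHS]odd_double_half odd_n.
  move: n./2 => u; have odd_u : odd u.*2.+1 by rewrite /= odd_double.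
  have [-> ->] : u.*2.+1./2 = u /\ uphalf u.*2.+1 = u.+1 by lia.
  rewrite hankel_odd // hankel_parity // (eval u).2.
  have -> : cmom M r 0 = hser d r by apply: eq_Sum => a; rewrite mul1r.
  have -> : (u * u.+1 * 2 = (u * u + u) * 2)%N by lia.
  have -> : u.*2.+1 = (2 * u + 1)%N by lia.
  rewrite exprMn -exprM !mulrA. reflexivity.
have -> : n = n./2.*2 by rewrite -[LHS]odd_double_half (negPf even_n).
move: n./2 => -[|v].
  have -> : hankel_const M 0.*2 = 1%N by rewrite /hankel_const /superfact big_geq.
  have -> : hankel (cmom M r) 0.*2 = 1 by apply: det_mx00.
  by rewrite -[0.*2]/0%N expr1n !expr0 !mul1r.
have odd_v : odd v.*2.+1 by rewrite /= odd_double.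
have -> : hankel (cmom M r) v.+1.*2 = hankel (cmom M d) v.+1.*2.
  apply: (@fps_natI (M * v.+1.*2)%N); first by lia.
  by rewrite natrM doubleS !hankel_even.
rewrite hankel_parity // (eval v.+1).1 uphalf_double doubleK mulr1.
rewrite exprMn -exprM -(mul2n v.+1) !mulrA; reflexivity.
Qed.

Definition class_det e N (r : 'I_d.+1) n :=
  \det (\matrix_(a < n, b < n) moment e N r (a + b)%N).

Section Truncated.
Variables (e N : nat).
Hypothesis e_gt0 : (0 < e)%N.
Hypothesis e_dvd : (e %| M)%N.
Local Notation K := (e * N).+1.

(** These powers of 2 cancel against the denominators of the nodes and weights, leaving constants in
    d instead of 2d. *)
Lemma hankel_const_double n : (hankel_const M n)%:R = 2 ^+ 'C(n, 2) * (hankel_const d n)%:R :> rat.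
Proof. by rewrite /hankel_const expnMn !natrM !natrX mulrA. Qed.

Lemma fconst_sign k : fconst ((-1) ^+ k) = (-1) ^+ k.
Proof. by rewrite fconstX fconstN fconst1. Qed.

Lemma class_det_generic (r : 'I_d.+1) n : (e %| r)%N -> (0 < r < d)%N ->
  eqmodX K (class_det e N r n)
    (fconst ((-1) ^+ n./2 * (hankel_const d n)%:R ^+ 2)
     * (p ^+ (n./2 * uphalf n * 2) * (if odd n then hser d r else 1))).
Proof.
move=> e_r r_in.
have -> : fconst ((-1) ^+ n./2 * (hankel_const d n)%:R ^+ 2)
     * (p ^+ (n./2 * uphalf n * 2) * (if odd n then hser d r else 1)) =
   \det (\matrix_(a < n, b < n) (fconst 2^-1 ^+ (a + b) * cmom M r (a + b))).
  rewrite det_scale_hankel -/(hankel _ n) hankel_generic // -fconst_sign.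
  rewrite -fconst_nat -!fconstX -!fconstM [RHS]mulrA -fconstM.
  set f := p ^+ _ * _; apply: (congr1 (fun c => fconst c * f)).
  rewrite hankel_const_double exprMn -exprM [('C(n, 2) * 2)%N]mulnC exprVn.
  have n0 : (2 : rat) ^+ (2 * 'C(n, 2)) != 0 by rewrite expf_neq0.
  by field.
by apply: eqmodX_det => a b; rewrite !mxE -fconstX; apply: moment_generic.
Qed.

Let class_det_selfdual (r : 'I_d.+1) (c : rat) t n : (e %| r)%N -> ~~ (0 < r < d)%N -> odd t ->
  (forall v, cls d v = r -> weight d v = c * v%:R ^+ t) ->
  eqmodX K (class_det e N r n)
    (fconst ((c / 2) ^+ n * 4^-1 ^+ (2 * 'C(n, 2))) *
     \det (\matrix_(a < n, b < n) cmom M r (2 * (a + b) + t))).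
Proof.
move=> e_r r_in odd_t weight_r.
rewrite fconstM !fconstX -mulrA.
rewrite -(@det_scale_hankel _ n _ (fun s => cmom M r (2 * s + t))) -det_scale.
apply: eqmodX_det => a b; rewrite !mxE mulrA -fconstX -fconstM.
exact: moment_selfdual.
Qed.

Lemma class_det_half n : (e %| d)%N ->
  eqmodX K (class_det e N ord_max n) (fconst (hankel_const d (2 * n))%:R * p ^+ (n * n)).
Proof.
move=> e_d; have := @class_det_selfdual ord_max 1 1 n e_d.
rewrite /= ltnn andbF => /(_ isT isT) eq_n.
have {}eq_n := eq_n _; move: eq_n.
have -> : \matrix_(a < n, b < n) cmom M d (2 * (a + b) + 1) =
   \matrix_(a < n, b < n) cmom M d (2 * a + 2 * b + 1).
  by apply/matrixP => a b; rewrite !mxE mulnDr.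
rewrite -/(odd_hankel _ n) (eval n).1 -fconst_nat mulrA -fconstM.
rewrite hankel_const_double => eq_n.
have -> : (hankel_const d (2 * n))%:R = (1 / 2) ^+ n * 4^-1 ^+ (2 * 'C(n, 2)) *
     (2 ^+ 'C(2 * n, 2) * (hankel_const d (2 * n))%:R) :> rat.
  rewrite bin2_double exprD [2 ^+ (2 * _)]exprM div1r !exprVn.
  have n0 : (2 : rat) ^+ n != 0 by rewrite expf_neq0.
  have -> : (2 : rat) ^+ 2 = 4 by [].
  have n4 : (4 : rat) ^+ (2 * 'C(n, 2)) != 0 by rewrite expf_neq0.
  by field; rewrite n0 n4.
apply: eq_n => v v_d.
rewrite /weight v_d /= (gtn_eqF d_gt0) eqxx mul1r expr1 //.
Qed.

Lemma class_det_zero n :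
  eqmodX K (class_det e N ord0 n) (fconst (hankel_const d (2 * n + 1))%:R * p ^+ (n * n + n)).
Proof.
have := @class_det_selfdual ord0 4^-1 3 n (dvdn0 e) isT isT.
have -> : \matrix_(a < n, b < n) cmom M (ord0 : 'I_d.+1) (2 * (a + b) + 3) =
   \matrix_(a < n, b < n) cmom M 0 (2 * a + 2 * b + 1).+2.
  by apply/matrixP => a b; rewrite !mxE; congr cmom; lia.
rewrite -/(odd_hankel (fun s => cmom M 0 s.+2) n) (eval n).2 -fconst_nat mulrA -fconstM.
rewrite hankel_const_double => eq_n.
have -> : (hankel_const d (2 * n + 1))%:R = (4^-1 / 2) ^+ n * 4^-1 ^+ (2 * 'C(n, 2)) *
     (2 ^+ 'C(2 * n + 1, 2) * (hankel_const d (2 * n + 1))%:R) :> rat.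
  rewrite bin2_doubleS (exprD 2 (n + 2 * n)) (exprD 2 n) !(exprM 2 2) exprMn !exprVn.
  have n0 : (2 : rat) ^+ n != 0 by rewrite expf_neq0.
  have -> : (2 : rat) ^+ 2 = 4 by [].
  have n4 : (4 : rat) ^+ (2 * 'C(n, 2)) != 0 by rewrite expf_neq0.
  have n4' : (4 : rat) ^+ n != 0 by rewrite expf_neq0.
  by field; rewrite n0 n4 n4'.
apply: eq_n => v v_0.
by rewrite /weight v_0 /= mulrC.
Qed.

End Truncated.
End ClassDeterminants.

(** * The product of the determinants over all classes *)

Definition unitary_lead (f : qser) := exists2 k, ord_ge k f & fcoef f k = 1.

Lemma unitary_leadM f g : unitary_lead f -> unitary_lead g -> unitary_lead (f * g).
Proof.
move=> [k f_k fk1] [l g_l gl1]; exists (k + l)%N; first exact: ord_geM.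
have lt_k : (k < (k + l).+1)%N by lia.
rewrite coef_fpsM (bigD1 (Ordinal lt_k)) //= addKn fk1 gl1 mulr1 big1 ?addr0 // => i.
rewrite -val_eqE /= => i_k; have [lt_ik|ge_ik] := ltnP i k; first by rewrite f_k ?mul0r.
by rewrite [fcoef g _]g_l ?mulr0 //; have := ltn_ord i; lia.
Qed.

Lemma unitary_lead_small k (f : qser) : ord_ge k.+1 (f - qX k) -> unitary_lead f.
Proof.
move=> f_k; exists k => [i lt_i|].
  have := f_k i (ltnW lt_i); rewrite coef_fpsB /= (ltn_eqF lt_i) subr0 //.
by have := f_k k (ltnSn k); rewrite coef_fpsB /= eqxx => /eqP; rewrite subr_eq0 => /eqP.
Qed.

Lemma unitary_lead_prod (I : Type) (r : seq I) (P : pred I) (F : I -> qser) :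
  (forall i, P i -> unitary_lead (F i)) -> unitary_lead (\prod_(i <- r | P i) F i).
Proof.
move=> F_lead; elim/big_rec: _ => [|i f Pi f_lead]; last first.
  by apply: unitary_leadM => //; apply: F_lead.
by apply: (@unitary_lead_small 0) => i; rewrite fpsX0 subrr coef_fps0.
Qed.

Lemma unitary_lead_sqr_inj f g : unitary_lead f -> unitary_lead g ->
  f ^+ 2 = g ^+ 2 -> f = g.
Proof.
move=> [k f_k fk1] [l g_l gl1] /eqP; rewrite -subr_eq0 subr_sqr => /eqP eq0.
apply/eqP; rewrite -subr_eq0; apply/negP => /negP neq; have [/eqP|] := fps_mulf_eq0 eq0; first exact/negP.
move/eqP; rewrite addr_eq0 => /eqP fg; have one0 : (1 : rat) = 0 -> False by [].
case: (ltngtP k l) => [lt_kl|lt_lk|eq_kl]; apply: one0.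
- by rewrite -fk1 fg coef_fpsN g_l ?oppr0.
- by rewrite -gl1 -[g]opprK -fg coef_fpsN f_k ?oppr0.
have : (1 : rat) = - 1 by rewrite -{1}fk1 fg coef_fpsN eq_kl gl1.
by move=> /eqP; rewrite -addr_eq0.
Qed.

Section ClassProduct.
Variable d : nat.
Hypothesis d_gt0 : (0 < d)%N.
Local Notation M := (2 * d)%N.
Local Notation p := (base d).

Lemma hser_lead (r : nat) : (0 < r < d)%N -> unitary_lead (hser d r).
Proof.
move=> r_in; apply: (@unitary_lead_small r) => n lt_n; rewrite coef_fpsB.
rewrite (@coef_Sum _ _ _ [:: r%:Z]) /= => [|a]; last first.
  rewrite inE /on_class => a_r; case: ifP => // /dvdzP[k a_eq].
  apply: wser_ord; have [k_gt0|k_le0] := ltrP 0 k; first by nia.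
  have k0 : k != 0 by apply: contraNneq a_r => k0; apply/eqP; nia.
  by nia.
rewrite big_seq1 /on_class subrr dvdz0 /= mulrC.
have -> : (r %| n)%N && odd (n %/ r) = (n == r).
  apply/andP/eqP => [[/dvdnP[k n_eq]]|->]; last by rewrite dvdnn divnn; lia.
  by rewrite n_eq mulnK; [case: k n_eq => [|[|k]]; nia|lia].
rewrite gtr0_sgz ?ltz_nat; last by lia.
by case: (n == r); rewrite ?mul0r ?mul1r subrr.
Qed.

(** Pairing r with d - r makes the square of the product a power of p, by [hser_mul]; leading
    coefficient 1 selects the square root. *)
Lemma prod_hser (P : pred 'I_d.+1) : ~~ odd d -> (forall r, P r -> (0 < r < d)%N) ->
  (forall r, P (rev_ord r) = P r) ->
  \prod_(r | P r) hser d r = qX (d./2 * #|P|)%N * psi M ^+ (2 * #|P|).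
Proof.
move=> even_d P_in P_rev; apply: unitary_lead_sqr_inj.
- by apply: unitary_lead_prod => r /P_in; apply: hser_lead.
- apply: unitary_leadM; first by apply: (@unitary_lead_small (d./2 * #|P|)%N) => i _; rewrite subrr coef_fps0.
  rewrite -[X in _ ^+ X]card_ord -prodr_const; apply: unitary_lead_prod => i _; apply: (@unitary_lead_small 0).
  rewrite fpsX0; apply: ord_geW (@psi_init M _); lia.
have -> : (qX (d./2 * #|P|)%N * psi M ^+ (2 * #|P|)) ^+ 2 = p ^+ #|P|.
  rewrite /base exprMn [RHS]exprMn -!exprM -!fpsXM; congr (qX _ * _ ^+ _); last by lia.
  by have := odd_double_half d; rewrite (negPf even_d); nia.
rewrite expr2 [X in _ * X](reindex_inj rev_ord_inj) /=.
rewrite [X in _ * X](eq_bigl _ _ P_rev) -big_split /= -prodr_const.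
apply: eq_bigr => r /P_in r_in; apply: (@fps_natI M); first by lia.
rewrite subSS; have -> : (d - r)%N%:Z = d%:Z - r%:Z by lia.
rewrite hser_mul //; [|lia|lia].
by rewrite -[Sum _]/(weighted_ser d) weighted_ser_psi.
Qed.

Definition generic_class b := [pred r : 'I_d.+1 | (0 < r < d)%N && (odd r == b)].

Lemma card_generic_class b : #|generic_class b| = ((d - ~~ b)./2)%N.
Proof.
have count k : (\sum_(r < k) ((0 < r) && (odd r == b)) = (k - ~~ b)./2)%N.
  elim: k => [|k IHk]; first by rewrite big_ord0; case: (b).
  by rewrite big_ord_recr /= IHk; case: (b); lia.
rewrite -sum1_card big_mkcond /= -count big_ord_recr /= inE /= ltnn andbF addn0.
by apply: eq_bigr => r _; rewrite inE /= ltn_ord andbT; case: ifP.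
Qed.

Section Truncated.
Variables (e N : nat) (b : bool) (n n0 nd : nat) (count : 'I_d.+1 -> nat).
Hypothesis e_gt0 : (0 < e)%N.
Hypothesis e_dvd : (e %| M)%N.
Hypothesis e_half : (0 < nd)%N -> (e %| d)%N.
Hypothesis e_generic : forall r : 'I_d.+1, odd r == b -> (e %| r)%N.
Hypothesis even_d : odd n -> ~~ odd d.
Hypothesis count0 : count ord0 = n0.
Hypothesis countd : count ord_max = nd.
Hypothesis count_generic : forall r : 'I_d.+1, (0 < r < d)%N ->
  count r = if odd r == b then n else 0%N.
Local Notation K := (e * N).+1.
Local Notation hc k := ((hankel_const d k)%:R : rat).
Local Notation g := #|generic_class b|.

(** E is the exponent of p collected from the determinants. For odd n the zeroth moments of the
    generic classes contribute in addition the formal power p^(g/2). *)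
Lemma prod_class_det :
  let E := (n0 * n0 + n0 + nd * nd + n./2 * uphalf n * 2 * g)%N in
  eqmodX K (\prod_r class_det e N r (count r))
    (fconst (hc (2 * n0 + 1)%N * hc (2 * nd)%N * ((-1) ^+ n./2 * hc n ^+ 2) ^+ g) *
     (qX (d * E + odd n * (d./2 * g))%N * psi M ^+ (4 * E + odd n * (2 * g)))).
Proof.
move=> E; pose T r := fconst ((-1) ^+ n./2 * hc n ^+ 2) *
  (p ^+ (n./2 * uphalf n * 2) * (if odd n then hser d (r : 'I_d.+1) else 1)).
have -> : fconst (hc (2 * n0 + 1)%N * hc (2 * nd)%N * ((-1) ^+ n./2 * hc n ^+ 2) ^+ g) *
     (qX (d * E + odd n * (d./2 * g))%N * psi M ^+ (4 * E + odd n * (2 * g))) =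
   (fconst (hc (2 * n0 + 1)%N) * p ^+ (n0 * n0 + n0)) *
   ((fconst (hc (2 * nd)%N) * p ^+ (nd * nd)) * \prod_(r | generic_class b r) T r).
  rewrite /T !big_split /= !prodr_const.
  have -> : \prod_(r | generic_class b r) (if odd n then hser d r else 1) =
      qX (odd n * (d./2 * g))%N * psi M ^+ (odd n * (2 * g)).
    have [odd_n|_] := boolP (odd n); last by rewrite big1 // !mul0n fpsX0 mul1r expr0.
    rewrite !mul1n; apply: prod_hser; first exact: even_d.
      by move=> r /andP[].
    move=> r; rewrite /= subSS; have := even_d odd_n; have := ltn_ord r => /=.
    by case: (b); lia.
  rewrite 2!fconstM fconstX fpsXD exprD (fpsXM _ d E) (exprM _ 4 E).
  have -> : qX d ^+ E * qX (odd n * (d./2 * g))%N *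
            ((psi M ^+ 4) ^+ E * psi M ^+ (odd n * (2 * g))) =
      p ^+ E * (qX (odd n * (d./2 * g))%N * psi M ^+ (odd n * (2 * g))).
    by rewrite mulrACA /base [(qX d * _) ^+ E]exprMn.
  rewrite /E 2!exprD (exprM p (n./2 * uphalf n * 2)).
  move: (qX _ * psi _ ^+ _) (fconst _) (fconst _) (fconst _ ^+ _) => h x y z.
  by move: (p ^+ _) (p ^+ (nd * nd)) (_ ^+ g) => u v w; ring.
have d_n0 : ord_max != ord0 :> 'I_d.+1 by rewrite -val_eqE /= -lt0n.
rewrite (bigD1 ord0) //= (bigD1 ord_max) //= count0 countd.
apply: eqmodXM; first exact: class_det_zero.
apply: eqmodXM.
  (* An empty class has determinant 1, whether or not e divides d. *)
  have [nd0|nd_gt0] := posnP nd; last by apply: class_det_half => //; apply: e_half.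
  rewrite nd0 /class_det det_mx00 /hankel_const /superfact big_geq // fconst1 mul1r.
  exact: eqmodX_refl.
rewrite (bigID (generic_class b)) /= [X in _ * X]big1 ?mulr1 => [|r]; last first.
  rewrite -!val_eqE /= => /andP[r_in]; have r_lt := ltn_ord r.
  have r_gen : (0 < r < d)%N by lia.
  rewrite count_generic // r_gen /= => /negPf ->.
  exact: det_mx00.
rewrite (eq_bigl (generic_class b)) => [|r]; last first.
  by rewrite -!val_eqE /=; have := ltn_ord r; case: (odd r == b); lia.
apply: eqmodX_prod => r /andP[r_in r_b]; rewrite count_generic // r_b.
by apply: class_det_generic => //; apply: e_generic.
Qed.

End Truncated.
End ClassProduct.

(** * From congruence up to order and sign to class counts, and coefficient extraction *)

Lemma same_counts_perm m (L : finType) (lam kappa : 'I_m -> L) :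
  same_counts lam kappa = [exists s : 'S_m, [forall i, kappa (s i) == lam i]].
Proof.
apply/forallP/existsP => [counts|[s /forallP kappa_s] rho]; last first.
  apply/eqP; rewrite -!sum1_card (reindex_inj (@perm_inj _ s)) /=.
  by apply: eq_bigl => i; rewrite !inE (eqP (kappa_s i)).
have : perm_eq [tuple lam i | i < m] [tuple kappa i | i < m].
  apply/allP => rho _; apply/eqP.
  have count_enum (mu : 'I_m -> L) : count_mem rho [seq mu i | i <- enum 'I_m] =
      #|[pred i | mu i == rho]|.
    by rewrite count_map enumT cardE /enum_mem size_filter; apply: eq_count => i.
  by rewrite !count_enum (eqP (counts rho)).
case/tuple_permP => s eq_s; exists s; apply/forallP => i; apply/eqP.
have := congr1 (fun t : seq L => nth (lam i) t i) eq_s.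
rewrite -tnth_nth tnth_mktuple => ->.
have := @tnth_nth _ _ (lam i) [tuple tnth [tuple kappa j | j < m] (s j) | j < m] i.
by move=> <-; rewrite !tnth_mktuple.
Qed.

Lemma cls_eq d a b : (0 < d)%N ->
  (cls d a == cls d b) = ((2 * d)%N%:Z %| a%:Z - b%:Z)%Z || ((2 * d)%N%:Z %| a%:Z + b%:Z)%Z.
Proof.
move=> d_gt0; have M_gt0 : (0 < 2 * d)%N by rewrite muln_gt0.
rewrite -val_eqE /= !clsE // -eqz_mod_dvd !modz_nat -PoszD dvdzE /= eqz_nat.
rewrite -[(_ %| _)%N]/((a + b) %% (2 * d) == 0)%N -modnDm.
have := ltn_pmod a M_gt0; have := ltn_pmod b M_gt0.
move: (a %% (2 * d))%N (b %% (2 * d))%N => s t lt_t lt_s.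
have -> : ((s + t) %% (2 * d) == 0)%N = ((s + t == 0)%N || (s + t == 2 * d)%N).
  have [lt_st|ge_st] := ltnP (s + t) (2 * d); first by rewrite modn_small //; lia.
  have -> : (s + t = (s + t - 2 * d) + 2 * d)%N by lia.
  by rewrite modnDr modn_small; lia.
by lia.
Qed.

Lemma dvdz_scale e n d (z : int) : (0 < e)%N -> (e * n = 2 * d)%N ->
  ((2 * d)%N%:Z %| e%:Z * z)%Z = (n%:Z %| z)%Z.
Proof. by move=> e_gt0 <-; rewrite PoszM dvdz_mul2l //; lia. Qed.

Lemma cls_eq_scale d e n a b : (0 < d)%N -> (0 < e)%N -> (e * n = 2 * d)%N ->
  (cls d (e * a) == cls d (e * b)) =
  (a%:Z == b%:Z %[mod n])%Z || (a%:Z == - b%:Z %[mod n])%Z.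
Proof.
move=> d_gt0 e_gt0 en; rewrite cls_eq // !eqz_mod_dvd opprK.
by rewrite !PoszM -mulrBr -mulrDr !(dvdz_scale _ e_gt0 en).
Qed.

(** Since e n = 2d, congruence up to sign modulo n is equality of the classes of the multiples by e;
    this treats the moduli 2d and d together. *)
Lemma sim_mod_counts d e n m (k l : 'I_m -> nat) : (0 < d)%N -> (0 < e)%N -> (e * n = 2 * d)%N ->
  sim_mod n (fun i => (k i)%:Z) (fun i => (l i)%:Z) =
  same_counts (fun i => cls d (e * l i)) (fun i => cls d (e * k i)).
Proof.
move=> d_gt0 e_gt0 en; rewrite same_counts_perm /sim_mod.
apply: eq_existsb => s; apply/existsP/forallP => [[eps /forallP eq_i] i|eq_i].
  rewrite (cls_eq_scale _ _ d_gt0 e_gt0 en); have := eq_i i.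
  by case: (eps i); rewrite ?expr1 ?mulN1r ?expr0 ?mul1r => ->; rewrite ?orbT.
exists [ffun i => ~~ ((k (s i))%:Z == (l i)%:Z %[mod n])%Z]; apply/forallP => i.
have := eq_i i; rewrite (cls_eq_scale _ _ d_gt0 e_gt0 en) ffunE.
by case: eqP => [eq_kl _|_ /= eq_kl]; rewrite ?expr0 ?mul1r ?eq_kl // expr1 mulN1r eq_kl.
Qed.

Lemma coef_fpsX k n : fcoef (qX k) n = (n == k)%:R. Proof. by []. Qed.

(** Factors l above N exceed the order eN. A zero k_i makes the product vanish, which accounts for
    the positivity condition. *)
Lemma coef_prod_wser e N m (k : 'I_m -> nat) : (0 < e)%N ->
  fcoef (\prod_i wser (e * k i)%N%:Z) (e * N) =
  #|[set l : {ffun 'I_m -> 'I_N.+1} | [forall i, (0 < k i)%N] &&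
      [forall i, odd (l i)] && (\sum_i k i * l i == N)%N]|%:R.
Proof.
move=> e_gt0; have [/forallP k_gt0|] := boolP [forall i, (0 < k i)%N]; last first.
  rewrite negb_forall => /existsP[i]; rewrite -eqn0Ngt => /eqP ki.
  have wser0 : wser 0%N = 0 by apply: fpsP => n; rewrite /= mul0r.
  have -> : \prod_i wser (e * k i)%N%:Z = 0 by rewrite (bigD1 i) //= ki muln0 wser0 mul0r.
  rewrite coef_fps0.
  by rewrite eq_card0 // => l; rewrite inE.
have trunc i : eqmodX (e * N).+1 (wser (e * k i)%N%:Z)
    (\sum_(l < N.+1 | odd l) qX (e * k i * l)%N).
  have v_gt0 : (0 < e * k i)%N by rewrite muln_gt0 e_gt0 k_gt0.
  move=> n lt_n; rewrite coef_fpsB coef_fps_sum /= gtr0_sgz ?ltz_nat // mul1r.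
  have [/andP[/dvdnP[l n_eq] odd_l]|no] := boolP (_ && _).
    rewrite n_eq mulnK // in odd_l.
    have lt_l : (l < N.+1)%N by have := k_gt0 i; nia.
    rewrite (bigD1 (Ordinal lt_l)) //= n_eq mulnC eqxx big1 ?addr0 ?subrr // => l'.
    move=> /andP[_]; rewrite -val_eqE /= => ne; rewrite eqn_pmul2l // eq_sym.
    by rewrite (negPf ne).
  rewrite big1 ?subrr // => l odd_l; case: eqP => // n_eq; case/negP: no.
  by rewrite n_eq dvdn_mulr //= mulKn.
have -> := eqmodX_coef (eqmodX_prod _ (fun i _ => trunc i)) (ltnSn (e * N)).
rewrite bigA_distr_big /= coef_fps_sum -sum1_card natr_sum.
rewrite big_mkcond [RHS]big_mkcond /=; apply: eq_bigr => l _.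
rewrite [in RHS]inE; have -> : (l \in ffun_on (fun j : 'I_N.+1 => odd j)) = [forall i, odd (l i)].
  by apply/ffun_onP/forallP => odd_l i; have := odd_l i; rewrite ?inE.
case: ifP => _ //=; rewrite prod_fpsX coef_fpsX.
under eq_bigr do rewrite -mulnA; rewrite -big_distrr /= eqn_pmul2l // eq_sym.
by case: (_ == N).
Qed.

Lemma coef_psi_exp k K n : (0 < k)%N ->
  fcoef (psi k ^+ K) n = if (k %| n)%N then (ntriangle K (n %/ k))%:R else 0.
Proof.
move=> k_gt0; set y := (n %/ k)%N.
have lt_n : (n < k * y.+1)%N by rewrite mulnC -ltn_divLR.
have trunc : eqmodX n.+1 (psi k) (\sum_(t < y.+1) qX (k * triangular t)%N).
  move=> i lt_i; rewrite coef_fpsB (@coef_Sum _ _ _ (iota 0 y.+1)) => [|t]; last first.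
    rewrite mem_iota /= -leqNgt => ge_t; apply: ord_geX.
    by have := leq_triangular t; nia.
  rewrite undup_id ?iota_uniq // -[iota 0 y.+1]/(index_iota 0 y.+1) big_mkord subrr //.
rewrite -[K in LHS]card_ord -prodr_const.
have -> := eqmodX_coef (eqmodX_prod _ (fun _ _ => trunc)) (ltnSn n).
rewrite bigA_distr_bigA /= coef_fps_sum.
under eq_bigr => t _ do rewrite prod_fpsX coef_fpsX -big_distrr /=.
rewrite /ntriangle -sum1_card natr_sum; case: ifP => [/divnK n_eq|ndvd]; last first.
  by rewrite big1 // => t _; case: eqP => // n_eq; rewrite n_eq dvdn_mulr in ndvd.
rewrite [RHS]big_mkcond; apply: eq_bigr => t _; rewrite inE.
by rewrite -{1}n_eq mulnC eqn_pmul2l // eq_sym; case: (_ == y).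
Qed.

Definition node_vdm d m (v : 'I_m -> nat) : rat :=
  \prod_(i < m) \prod_(j < m | (i < j)%N && (cls d (v i) == cls d (v j)))
    (node d (v j) - node d (v i)) ^+ 2.

Lemma class_sum d e N m (lam : 'I_m -> 'I_d.+1) : (0 < e)%N ->
  \sum_(k : {ffun 'I_m -> 'I_N.+1} | same_counts lam (fun i => cls d (e * k i)))
    node_vdm d (fun i => (e * k i)%N) * \prod_i weight d (e * k i) *
    fcoef (\prod_i wser (e * k i)%N%:Z) (e * N) =
  m`!%:R * fcoef (\prod_r class_det e N r #|[pred i | lam i == r]|) (e * N).
Proof.
move=> e_gt0; rewrite -coef_natM.
rewrite -(@class_andreief _ m 'I_N.+1 _ (fun x : 'I_N.+1 => cls d (e * x)) lam
  (fun x => fconst (node d (e * x))) (fun x => fconst (weight d (e * x)) * wser (e * x)%N)).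
rewrite coef_fps_sum; apply: eq_bigr => k _; rewrite -coef_fconstM.
congr (fcoef _ _); rewrite fconstM -mulrA fconst_prod -big_split; congr (_ * _).
rewrite /node_vdm fconst_prod -prodrXl; apply: eq_bigr => i _.
rewrite fconst_prod -prodrXl; apply: eq_bigr => j _.
by rewrite fconstX fconstB.
Qed.

(** * Class counts of (1, 3, ..., 2m-1) and of (1, ..., m) *)

Lemma sum_nat_reflect (P Q : nat -> nat) T k : (k <= T.+1)%N ->
  (forall i, (i <= T)%N -> P i = Q (T - i)%N) ->
  (\sum_(0 <= i < k) P i = \sum_(T.+1 - k <= i < T.+1) Q i)%N.
Proof.
move=> + PQ; elim: k => [|k IHk] lt_k; first by rewrite !big_geq ?subn0.
rewrite big_nat_recr //= IHk ?(ltnW lt_k) // subSS [RHS]big_ltn; last by lia.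
by rewrite addnC PQ ?subSn.
Qed.

Lemma sum_residue_period d a q : (a < d)%N ->
  (\sum_(0 <= i < d * q) (i %% d == a) = q)%N.
Proof.
move=> lt_a; elim: q => [|q IHq]; first by rewrite muln0 big_geq.
rewrite mulnS addnC (@big_cat_nat _ _ _ (d * q)) ?leq_addr //= IHq.
rewrite -{1}[(d * q)%N]add0n big_addn addKn.
rewrite (@eq_big_nat _ _ _ _ _ _ (fun i => (i == a) : nat)) => [|i /andP[_ lt_i]]; last first.
  by rewrite mulnC addnC modnMDl modn_small.
rewrite big_mkord (bigD1 (Ordinal lt_a)) //= eqxx big1 ?addn0 ?addn1 // => i.
by rewrite -val_eqE /= => /negPf ->.
Qed.

Lemma dvdn_lt_double d u : (d %| u)%N -> (u < 2 * d)%N -> (u == 0)%N || (u == d).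
Proof. by move=> /dvdnP[[|[|k]] ->]; nia. Qed.

Lemma card_sum_nat m (P : pred nat) : #|[pred i : 'I_m | P i]| = (\sum_(0 <= i < m) P i)%N.
Proof. by rewrite -sum1_card big_mkcond big_mkord; apply: eq_bigr => i _; rewrite inE. Qed.

Section OddCounts.
Variables (d m n : nat).
Hypothesis d_gt0 : (0 < d)%N.
Hypothesis dn : (d * n = 2 * m)%N.

Let mod_odd i : ((2 * i + 1) %% (2 * d) = 2 * (i %% d) + 1)%N.
Proof.
rewrite {1}(divn_eq i d) mulnDr mulnCA -addnA modnMDl modn_small //.
by have := ltn_pmod i d_gt0; lia.
Qed.

Let count a := (\sum_(0 <= i < m) (i %% d == a))%N.

(** The reflection i -> 2m - 1 - i takes residue a to d - 1 - a and exchanges the two halves of [0,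
    2m), which consists of n full periods. *)
Let count_reflect a : (a < d)%N -> (count a + count (d - a.+1) = n)%N.
Proof.
move=> lt_a; have [m0|m_gt0] := posnP m; first by rewrite /count m0 !big_geq //; nia.
rewrite -(sum_residue_period n lt_a) dn (@big_cat_nat _ _ _ m) /=; [|lia|lia].
congr addn; rewrite /count (@sum_nat_reflect _ (fun i => (i %% d == a)%N : nat) (2 * m).-1).
- by have -> : ((2 * m).-1.+1 = 2 * m)%N by [lia]; have -> : (2 * m - m = m)%N by lia.
- by lia.
move=> i le_i; congr nat_of_bool.
have : (d %| (i %% d) + ((2 * m).-1 - i) %% d + 1)%N.
  rewrite /dvdn -modnDml modnDm modnDml -/(dvdn d _).
  by apply/dvdnP; exists n; lia.
move/dvdn_lt_double; have := ltn_pmod i d_gt0; have := ltn_pmod ((2 * m).-1 - i) d_gt0.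
move: (i %% d)%N (((2 * m).-1 - i) %% d)%N => s t; lia.
Qed.

Lemma odd_class_count (r : 'I_d.+1) :
  #|[pred i : 'I_m | cls d (2 * i + 1) == r]| =
  if odd r then if r == d :> nat then n./2 else n else 0%N.
Proof.
rewrite (card_sum_nat m (fun i => cls d (2 * i + 1) == r)).
have clsP i : (cls d (2 * i + 1) == r) = (2 * (i %% d) + 1 == r)%N ||
    (2 * (d - (i %% d).+1) + 1 == r)%N.
  rewrite -val_eqE /= clsE // mod_odd; have := ltn_pmod i d_gt0; have := ltn_ord r.
  by move: (i %% d)%N => t; lia.
case: ifP => [odd_r|/negbT even_r]; last first.
  by rewrite big1 // => i _; rewrite clsP; move: (i %% d)%N => t; lia.
have r_in := ltn_ord r; have lt_a : (r./2 < d)%N by lia.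
have := count_reflect lt_a; case: eqP => [r_d|r_d].
  have -> : (d - r./2.+1 = r./2)%N by lia.
  suff -> : (\sum_(0 <= i < m) (cls d (2 * i + 1) == r) = count r./2)%N by lia.
  apply: eq_bigr => i _; rewrite clsP; congr nat_of_bool.
  by have := ltn_pmod i d_gt0; move: (i %% d)%N => t; lia.
move=> <-; rewrite /count -big_split; apply: eq_bigr => i _; rewrite clsP /=.
have := ltn_pmod i d_gt0; move: (i %% d)%N => t; lia.
Qed.

End OddCounts.

Section EvenCounts.
Variables (d m n : nat).
Hypothesis d_gt0 : (0 < d)%N.

(** The index 0 is added to 1, ..., m so that the reflection i -> T - i applies; it only affects
    class 0, where it is subtracted again. *)
Let count a := (\sum_(0 <= i < m.+1) (i %% d == a))%N.

Let count_reflect T a : (d %| T)%N -> (m <= T)%N -> (a < d)%N ->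
  (count ((d - a) %% d) = \sum_(T.+1 - m.+1 <= i < T.+1) (i %% d == a))%N.
Proof.
move=> d_T le_T lt_a.
rewrite /count (@sum_nat_reflect _ (fun i => (i %% d == a)%N : nat) T) // => i le_i.
congr nat_of_bool; have : (d %| (i %% d) + (T - i) %% d)%N.
  by rewrite /dvdn modnDm -/(dvdn d _) subnKC.
move/dvdn_lt_double; have := ltn_pmod i d_gt0; have := ltn_pmod (T - i) d_gt0.
have -> : ((d - a) %% d = if a == 0 then 0 else d - a)%N.
  by case: a lt_a => [|a] lt_a; [rewrite subn0 modnn|rewrite modn_small //; lia].
move: (i %% d)%N ((T - i) %% d)%N => s t lt_t lt_s st.
have {}st : (s + t == 0)%N || (s + t == d)%N by apply: st; lia.
have [a0|a_gt0] := posnP a; first by rewrite a0; lia.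
by lia.
Qed.

Let sum_period a q : (a < d)%N ->
  (\sum_(0 <= i < (d * q).+1) (i %% d == a) = q + (a == 0))%N.
Proof.
by move=> lt_a; rewrite big_nat_recr //= sum_residue_period // mulnC modnMl eq_sym.
Qed.

(** [0, m] and its reflection [m, 2m] overlap in m. *)
Let count_even a : (a < d)%N -> (d * n = 2 * m)%N ->
  (count a + count ((d - a) %% d) = n + (a == 0) + (m %% d == a))%N.
Proof.
move=> lt_a dn; rewrite (@count_reflect (2 * m)) //; [|by rewrite -dn dvdn_mulr|lia].
have -> : ((2 * m).+1 - m.+1 = m)%N by lia.
rewrite -sum_period // dn [in RHS](@big_cat_nat _ _ _ m) /=; [|lia|lia].
by rewrite /count big_nat_recr //=; lia.
Qed.

(** [0, m] and its reflection [m + 2, 2m + 2] leave out m + 1. *)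
Let count_even' a : (a < d)%N -> (d * n = 2 * m + 2)%N ->
  (count a + count ((d - a) %% d) + (m.+1 %% d == a) = n + (a == 0))%N.
Proof.
move=> lt_a dn; rewrite (@count_reflect (2 * m + 2)) //; [|by rewrite -dn dvdn_mulr|lia].
have -> : ((2 * m + 2).+1 - m.+1 = m.+2)%N by lia.
rewrite -sum_period // dn [in RHS](@big_cat_nat _ _ _ m.+2) /=; [|lia|lia].
by rewrite [in RHS]big_nat_recr //=; rewrite /count; lia.
Qed.

Let even_clsP i (r : 'I_d.+1) : (cls d (2 * i) == r) =
  (2 * (i %% d) == r)%N || (2 * (d - i %% d) == r)%N.
Proof.
rewrite -val_eqE /= clsE // -muln_modr; have := ltn_pmod i d_gt0; have := ltn_ord r.
by move: (i %% d)%N => t; lia.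
Qed.

Let class_countE (r : 'I_d.+1) : ~~ odd r ->
  #|[pred i : 'I_m | cls d (2 * (i + 1)) == r]| =
  if r == 0 :> nat then (count 0).-1 else if r == d :> nat then count r./2
  else (count r./2 + count ((d - r./2) %% d))%N.
Proof.
move=> even_r; rewrite (card_sum_nat m (fun i => cls d (2 * (i + 1)) == r)).
have total : (\sum_(0 <= i < m.+1) (cls d (2 * i) == r) =
    (r == 0 :> nat) + \sum_(0 <= i < m) (cls d (2 * (i + 1)) == r))%N.
  rewrite big_nat_recl //=; congr (_ + _)%N.
    by rewrite even_clsP mod0n muln0 subn0; have := ltn_ord r; lia.
  by apply: eq_bigr => i _; rewrite addn1.
have r_in := ltn_ord r.
have [r0|r_gt0] := posnP r.
  suff <- : (\sum_(0 <= i < m.+1) (cls d (2 * i) == r))%N = count 0 by rewrite total r0.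
  apply: eq_bigr => i _; rewrite even_clsP; congr nat_of_bool.
  by have := ltn_pmod i d_gt0; move: (i %% d)%N => t; lia.
have -> : (\sum_(0 <= i < m) (cls d (2 * (i + 1)) == r))%N =
          (\sum_(0 <= i < m.+1) (cls d (2 * i) == r))%N by rewrite total; lia.
have [r_d|r_d] := eqVneq (r : nat) d.
  apply: eq_bigr => i _; rewrite even_clsP; congr nat_of_bool.
  by have := ltn_pmod i d_gt0; move: (i %% d)%N => t; lia.
rewrite /count -big_split; apply: eq_bigr => i _; rewrite even_clsP /=.
rewrite (@modn_small (d - r./2)); last by lia.
by have := ltn_pmod i d_gt0; move: (i %% d)%N => t; lia.
Qed.

Let half_mod T : (d %| 2 * T)%N -> (T %% d == 0)%N || (2 * (T %% d) == d)%N.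
Proof.
move=> dvd_T; have : (d %| 2 * (T %% d))%N by rewrite /dvdn modnMmr.
have := ltn_pmod T d_gt0; move: (T %% d)%N => t lt_t /dvdn_lt_double st.
have {}st : (2 * t == 0)%N || (2 * t == d)%N by apply: st; lia.
by lia.
Qed.

(** Decides whether the overlapping or missing index falls into class 0 or class d. *)
Let odd_half_mod T : (d * n = 2 * T)%N -> (2 * (T %% d) == d)%N = odd n.
Proof.
move=> dn; apply/eqP/idP => [td|odd_n].
  have := dn; rewrite {1}(divn_eq T d) mulnDr td => eq_n.
  have -> : n = ((T %/ d).*2.+1)%N by nia.
  by rewrite /= odd_double.
have eq_n := odd_double_half n; rewrite odd_n in eq_n.
have eq_d : (d = 2 * d./2)%N by have := odd_double_half d; nia.
have -> : T = (n./2 * d + d./2)%N by nia.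
by rewrite modnMDl modn_small; lia.
Qed.

Let zero_mod T : (d * n = 2 * T)%N -> (T %% d == 0)%N = ~~ odd n.
Proof.
move=> dn; have := half_mod (T := T); rewrite -dn dvdn_mulr // => /(_ isT).
rewrite -(odd_half_mod dn); move: (T %% d)%N => t; lia.
Qed.

Lemma even_class_count (r : 'I_d.+1) : (d * n = 2 * m)%N -> ~~ odd r ->
  #|[pred i : 'I_m | cls d (2 * (i + 1)) == r]| =
  if r == 0 :> nat then n./2 else if r == d :> nat then uphalf n else n.
Proof.
move=> dn even_r; rewrite class_countE //; have r_in := ltn_ord r.
have zm := zero_mod dn; have om := odd_half_mod dn; have hm : (d %| 2 * m)%N by rewrite -dn dvdn_mulr.
have {}hm := half_mod hm.
have [r0|r_gt0] := posnP r.
  by have := count_even d_gt0 dn; rewrite subn0 modnn zm eqxx; move: (count 0%N) => c; lia.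
have lt_a : (r./2 < d)%N by lia.
have := count_even lt_a dn; rewrite (@modn_small (d - r./2)); last by lia.
have [r_d|r_d] := eqVneq (r : nat) d.
  have -> : (d - r./2 = r./2)%N by lia.
  have -> : (m %% d == r./2)%N = odd n by rewrite -om; lia.
  by move: (count _) => c; lia.
have -> : (m %% d == r./2)%N = false by lia.
by move: (count _ + _)%N => c; lia.
Qed.

Lemma even_class_count' (r : 'I_d.+1) : (d * n = 2 * m + 2)%N -> ~~ odd r ->
  #|[pred i : 'I_m | cls d (2 * (i + 1)) == r]| =
  if r == 0 :> nat then (uphalf n).-1 else if r == d :> nat then n./2 else n.
Proof.
move=> dn' even_r; rewrite class_countE //; have r_in := ltn_ord r.
have dn : (d * n = 2 * m.+1)%N by lia.
have zm := zero_mod dn; have om := odd_half_mod dn.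
have hm : (d %| 2 * m.+1)%N by rewrite -dn dvdn_mulr.
have {}hm := half_mod hm.
have [r0|r_gt0] := posnP r.
  by have := count_even' d_gt0 dn'; rewrite subn0 modnn zm eqxx; move: (count 0%N) => c; lia.
have lt_a : (r./2 < d)%N by lia.
have := count_even' lt_a dn'; rewrite (@modn_small (d - r./2)); last by lia.
have [r_d|r_d] := eqVneq (r : nat) d.
  have -> : (d - r./2 = r./2)%N by lia.
  have -> : (m.+1 %% d == r./2)%N = odd n by rewrite -om; lia.
  by move: (count _) => c; lia.
have -> : (m.+1 %% d == r./2)%N = false by lia.
by move: (count _ + _)%N => c; lia.
Qed.

Lemma even_class_count_odd (r : 'I_d.+1) : odd r ->
  #|[pred i : 'I_m | cls d (2 * (i + 1)) == r]| = 0%N.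
Proof.
move=> odd_r; rewrite (card_sum_nat m (fun i => cls d (2 * (i + 1)) == r)).
by rewrite big1 // => i _; rewrite even_clsP; lia.
Qed.

End EvenCounts.

(** * The summand in terms of nodes and weights *)

Lemma dvdz_mod_opp (M a b : nat) : (0 < M)%N ->
  (a%:Z == - b%:Z %[mod M])%Z = (a %% M + b %% M == 0)%N || (a %% M + b %% M == M)%N.
Proof.
move=> M_gt0; rewrite eqz_mod_dvd opprK -PoszD dvdzE /= /dvdn -modnDm.
have := ltn_pmod a M_gt0; have := ltn_pmod b M_gt0.
move: (a %% M)%N (b %% M)%N => s t lt_t lt_s.
have [lt_st|ge_st] := ltnP (s + t) M; first by rewrite modn_small //; lia.
have -> : (s + t = (s + t - M) + M)%N by lia.
by rewrite modnDr modn_small; lia.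
Qed.

Section Summand.
Variable d : nat.
Hypothesis d_gt0 : (0 < d)%N.
Local Notation M := (2 * d)%N.

Let M_gt0 : (0 < M)%N. Proof. by rewrite muln_gt0. Qed.

Lemma nodeE v : node d v =
  if (v %% M == 0)%N || (v %% M == d)%N then (v%:R / 2) ^+ 2
  else if (d < v %% M)%N then - (v%:R / 2) else v%:R / 2.
Proof.
rewrite /node /negative_cls clsE //; have := ltn_pmod v M_gt0.
move: (v %% M)%N => t lt_t.
have -> : (0 < minn t (M - t) < d)%N = ~~ ((t == 0)%N || (t == d)%N) by lia.
case: ifP => //=; case: ifP => //; case: ifP => //=; rewrite ?mulN1r ?mul1r //.
by rewrite mulNr.
Qed.

Lemma weightE v : weight d v =
  (if (d < v %% M)%N then -1 else 1) * (if (v %% M == d)%N then v%:R else 1) *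
  (if (v %% M == 0)%N then v%:R ^+ 3 / 4 else 1).
Proof.
rewrite /weight /negative_cls clsE //; have := ltn_pmod v M_gt0.
move: (v %% M)%N => t lt_t.
have -> : (minn t (M - t) == 0)%N = (t == 0)%N by lia.
have -> : (minn t (M - t) == d)%N = (t == d)%N by lia.
have [t0|t0] := eqVneq t 0%N.
  by rewrite t0 ltn0 (ltn_eqF d_gt0) !mul1r.
have [->|td] := eqVneq t d; first by rewrite ltnn mul1r mulr1.
by rewrite !mulr1; case: ltnP.
Qed.

(** Both congruences hold together only in the classes 0 and d, where the difference of the squared
    nodes is the product of both factors; two entries of a generic class satisfy exactly one. *)
Lemma node_pair a b :
  (if cls d a == cls d b then (node d b - node d a) ^+ 2 else 1) =
  (if (a == b %[mod M])%N then ((b%:R - a%:R) / 2) ^+ 2 else 1) *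
  (if (a%:Z == - b%:Z %[mod M])%Z then ((b%:R + a%:R) / 2) ^+ 2 else 1).
Proof.
have -> : (cls d a == cls d b) = (a == b %[mod M])%N || (a%:Z == - b%:Z %[mod M])%Z.
  by rewrite cls_eq // [(a%:Z == - b%:Z %[mod _])%Z]eqz_mod_dvd opprK -eqz_mod_dvd !modz_nat.
rewrite dvdz_mod_opp // !nodeE; have := ltn_pmod a M_gt0; have := ltn_pmod b M_gt0.
move: (a %% M)%N (b %% M)%N => s t lt_t lt_s.
have [<-|ne_st] := eqVneq s t.
  rewrite /=; have -> : (s + s == 0)%N || (s + s == M)%N = (s == 0)%N || (s == d)%N by lia.
  by case: ifP => _; [field|case: ifP => _; field].
rewrite /=; have [st|] := boolP (_ || _); last by rewrite mulr1.
have [-> ->] : ((s == 0)%N || (s == d)%N) = false /\ ((t == 0)%N || (t == d)%N) = false by lia.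
have -> : (d < t)%N = ~~ (d < s)%N by lia.
by case: (d < s)%N => /=; field.
Qed.

Lemma node_vdmE m (v : 'I_m -> nat) : node_vdm d v =
  (\prod_(i < m) \prod_(j < m | (i < j)%N && (v i == v j %[mod M])%N)
     (((v j)%:R - (v i)%:R) / 2) ^+ 2) *
  (\prod_(i < m) \prod_(j < m | (i < j)%N && ((v i)%:Z == - (v j)%:Z %[mod M])%Z)
     (((v j)%:R + (v i)%:R) / 2) ^+ 2).
Proof.
rewrite -big_split; apply: eq_bigr => i _ /=.
rewrite !big_mkcondr -big_split; apply: eq_bigr => j _ /=.
exact: node_pair.
Qed.

Lemma prod_weightE m (v : 'I_m -> nat) : \prod_i weight d (v i) =
  (-1) ^+ #|[set i | (d < v i %% M)%N]| * (\prod_(i | (v i %% M == d)%N) (v i)%:R) *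
  (\prod_(i | (v i %% M == 0)%N) ((v i)%:R ^+ 3 / 4)).
Proof.
rewrite -prodr_const [X in X * _ * _]big_mkcond [X in _ * X * _]big_mkcond.
rewrite [X in _ * X]big_mkcond -!big_split; apply: eq_bigr => i _ /=.
by rewrite weightE inE.
Qed.

End Summand.

(** * Assembling the evaluation; signs, constants and exponents *)

Lemma odd_bin2 n : odd 'C(n, 2) = odd n./2.
Proof.
suff [] : odd 'C(n, 2) = odd n./2 /\ odd 'C(n.+1, 2) = odd n.+1./2 by [].
elim: n => // n [IH0 IH1]; split=> //.
by rewrite binS bin1 binS bin1 !oddD IH0 /=; case: (odd n); case: (odd n./2).
Qed.

Lemma bin2_mul n : (2 * 'C(n, 2) = n * n.-1)%N.
Proof. by elim: n => // n IHn; rewrite binS bin1 mulnDr IHn; case: n {IHn} => //=; lia. Qed.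

(** The sizes n0, nd and n belong to class 0, class d and the generic classes of parity b. X is the
    order left over after the power of q has been removed. *)
Lemma sum_evaluation d e N m (lam : 'I_m -> 'I_d.+1) (b : bool) n n0 nd K X
  (g := #|generic_class d b|) (E := (n0 * n0 + n0 + nd * nd + n./2 * uphalf n * 2 * g)%N) :
  (0 < d)%N -> (0 < e)%N -> (e %| 2 * d)%N -> ((0 < nd)%N -> (e %| d)%N) ->
  (forall r : 'I_d.+1, odd r == b -> (e %| r)%N) -> (odd n -> ~~ odd d) ->
  #|[pred i | lam i == ord0]| = n0 -> #|[pred i | lam i == ord_max]| = nd ->
  (forall r : 'I_d.+1, (0 < r < d)%N ->
     #|[pred i | lam i == r]| = if odd r == b then n else 0%N) ->
  (e * N = d * E + odd n * (d./2 * g) + X)%N -> K = (4 * E + odd n * (2 * g))%N ->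
  \sum_(k : {ffun 'I_m -> 'I_N.+1} | same_counts lam (fun i => cls d (e * k i)))
    node_vdm d (fun i => (e * k i)%N) * \prod_i weight d (e * k i) *
    fcoef (\prod_i wser (e * k i)%N%:Z) (e * N) =
  m`!%:R * ((hankel_const d (2 * n0 + 1))%:R * (hankel_const d (2 * nd))%:R *
    ((-1) ^+ n./2 * (hankel_const d n)%:R ^+ 2) ^+ g *
    (if (2 * d %| X)%N then (ntriangle K (X %/ (2 * d)))%:R else 0)).
Proof.
move=> d_gt0 e_gt0 e_dvd e_half e_generic even_d c0 cd cr eN ->.
rewrite class_sum // (eqmodX_coef (prod_class_det d_gt0 e_gt0 e_dvd e_half e_generic
  even_d c0 cd cr) (ltnSn _)) -/g -/E coef_fconstM; congr (_ * (_ * _)).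
by rewrite coef_fpsXM eN leq_addr addKn coef_psi_exp // muln_gt0.
Qed.

Lemma sum_over_multipliers e N m (S : pred {ffun 'I_m -> 'I_N.+1})
  (C : {ffun 'I_m -> 'I_N.+1} -> pred {ffun 'I_m -> 'I_N.+1}) (G H : {ffun 'I_m -> 'I_N.+1} -> rat) :
  (0 < e)%N -> (forall k, S k -> G k = H k) ->
  (forall k l, C k l = S k && ([forall i, (0 < k i)%N] && [forall i, odd (l i)] &&
      (\sum_i k i * l i == N)%N)) ->
  \sum_k \sum_(l | C k l) G k =
  \sum_(k | S k) H k * fcoef (\prod_i wser (e * k i)%N%:Z) (e * N).
Proof.
move=> e_gt0 GH CS; rewrite [RHS]big_mkcond; apply: eq_bigr => k _.
rewrite (eq_bigl _ _ (CS k)); case: ifP => [Sk|_]; last by rewrite big_pred0.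
rewrite coef_prod_wser // GH // sumr_const mulr_natr; congr (_ *+ _).
by apply: eq_card => l; rewrite [in RHS]inE.
Qed.

Lemma hankel_constE d k : (hankel_const d k)%:R = d%:R ^+ 'C(k, 2) * (superfact k)%:R :> rat.
Proof. by rewrite /hankel_const natrM natrX. Qed.

Lemma sign_prod (a b c c' : nat) : odd c = odd a -> odd c' = odd b ->
  ((-1) ^+ a) ^+ b = (-1) ^+ (c * c') :> rat.
Proof.
by move=> ca cb; rewrite -exprM -signr_odd -[RHS]signr_odd !oddM ca cb.
Qed.

Lemma generic_const a g n c c' : odd c = odd n./2 -> odd c' = odd g ->
  ((-1) ^+ n./2 * a ^+ 2) ^+ g = (-1) ^+ (c' * c) * a ^+ (2 * g) :> rat.
Proof.
move=> cn cg; rewrite exprMn (sign_prod cn cg) mulnC; congr (_ * _).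
by rewrite -exprM.
Qed.

Lemma hankel_const_small d k : (k < 2)%N -> hankel_const d k = 1%N.
Proof. by case: k => [|[|]] // _; rewrite /hankel_const /superfact big_geq. Qed.

Lemma superfact_prod d n k : n = k.+1 \/ (n = 0 /\ k = 0)%N ->
  (superfact n)%:R ^+ d = \prod_(1 <= l < k.+1) (l`!)%:R ^+ d :> rat.
Proof.
move=> nk; rewrite prodrXl -natr_prod; congr (_%:R ^+ _).
by case: nk => [->|[-> ->]] //; rewrite /superfact !big_geq.
Qed.

Section Constants.
Variables d m n : nat.
Hypothesis d_gt0 : (0 < d)%N.
Local Notation hc k := ((hankel_const d k)%:R : rat).

(** If d is odd then n is even, and class d supplies the one factor missing from the exponent 2
    floor(d/2) = d - 1. *)
Lemma odd_const : (d * n = 2 * m)%N ->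
  hc (2 * 0 + 1)%N * hc (2 * (if odd d then n./2 else 0))%N *
    ((-1) ^+ n./2 * hc n ^+ 2) ^+ (d./2) =
  (-1) ^+ ('C(d, 2) * 'C(n, 2)) * d%:R ^+ ((2 * m - d) * m %/ d) *
  \prod_(1 <= l < ((2 * m - d) %/ d).+1) (l`!)%:R ^+ d.
Proof.
move=> dn; rewrite (generic_const _ (odd_bin2 n) (odd_bin2 d)).
rewrite [hankel_const d (2 * 0 + 1)]hankel_const_small // mul1r mulrCA -mulrA; congr (_ * _).
have -> : hc (2 * (if odd d then n./2 else 0))%N * hc n ^+ (2 * d./2) = hc n ^+ d.
  have eq_d := odd_double_half d; case: ifP eq_d => odd_d eq_d.
    have -> : (2 * n./2 = n)%N by have := odd_double_half n; nia.
    by rewrite -exprS; congr (_ ^+ _); lia.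
  by rewrite hankel_const_small // mul1r; congr (_ ^+ _); lia.
rewrite hankel_constE exprMn -exprM; congr (_ ^+ _ * _).
  (* For n = 0, hence m = 0, the subtraction 2m - d is truncated, but both exponents are 0. *)
  have := bin2_mul n; case: n dn => [|n'] dn bn.
    by have -> : m = 0%N by [nia]; rewrite muln0 div0n.
  have -> : ((2 * m - d) * m = ('C(n'.+1, 2) * d) * d)%N by nia.
  by rewrite mulnK.
apply: superfact_prod; case: n dn => [|n'] dn; [right|left].
  by have -> : m = 0%N by [nia]; rewrite div0n.
by rewrite -dn mulnS addKn mulKn.
Qed.

(** The self-dual classes complete the generic ones to z_{n+1} z_n^(d-1), with z the sequence
    [hankel_const d]; the surplus of z_{n+1} over z_n is the source of n!. *)
Lemma even_const : (d * n = 2 * m)%N ->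
  hc (2 * n./2 + 1)%N * hc (2 * (if odd d then 0 else uphalf n))%N *
    ((-1) ^+ n./2 * hc n ^+ 2) ^+ ((d - 1)./2) =
  (-1) ^+ ('C(d - 1, 2) * 'C(n, 2)) * (n`!)%:R *
  (\prod_(1 <= l < ((2 * m - d) %/ d).+1) (l`!)%:R ^+ d) *
  d%:R ^+ ((2 * m + 2 - d) * m %/ d).
Proof.
move=> dn; rewrite (generic_const _ (odd_bin2 n) (odd_bin2 (d - 1))).
have -> : hc (2 * n./2 + 1)%N * hc (2 * (if odd d then 0 else uphalf n))%N *
    ((-1) ^+ ('C(d - 1, 2) * 'C(n, 2)) * hc n ^+ (2 * (d - 1)./2)) =
  (-1) ^+ ('C(d - 1, 2) * 'C(n, 2)) * (hc n.+1 * hc n ^+ (d - 1)).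
  rewrite mulrCA; congr (_ * _); have eq_d := odd_double_half d.
  have eq_n := odd_double_half n; case: ifP eq_d => odd_d eq_d.
    rewrite [hankel_const d (2 * 0)]hankel_const_small // mulr1.
    by congr (_%:R * _ ^+ _); [congr hankel_const; nia|lia].
  have -> : (d - 1 = (2 * (d - 1)./2).+1)%N by lia.
  rewrite exprS mulrA; congr (_ * _); last by congr (_ ^+ (2 * _)); lia.
  case: (boolP (odd n)) eq_n => odd_n eq_n.
    by rewrite mulrC; congr (_%:R * _%:R); congr hankel_const; lia.
  by congr (_%:R * _%:R); congr hankel_const; lia.
rewrite -!mulrA; congr (_ * _); rewrite !hankel_constE superfactS natrM exprMn -exprM.
have -> : \prod_(1 <= l < ((2 * m - d) %/ d).+1) (l`!)%:R ^+ d = (superfact n)%:R ^+ d :> rat.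
  symmetry; apply: superfact_prod; case: n dn => [|n'] dn; [right|left].
    by have -> : m = 0%N by [nia]; rewrite div0n.
  by rewrite -dn mulnS addKn mulKn.
have -> : ((2 * m + 2 - d) * m %/ d = 'C(n.+1, 2) + 'C(n, 2) * (d - 1))%N.
  have := bin2_mul n; case: n dn => [|n'] dn bn.
    by have -> : m = 0%N by [nia]; rewrite muln0 div0n.
  rewrite binS bin1; have -> : ((2 * m + 2 - d) * m =
      ('C(n'.+1, 2) + n'.+1 + 'C(n'.+1, 2) * (d - 1)) * d)%N; last by rewrite mulnK.
  have -> : (2 * m + 2 - d = d * n' + 2)%N by rewrite -dn mulnS; lia.
  have h1 : ((d * n' + 2) * (2 * m) = (d * n' + 2) * (d * n'.+1))%N by rewrite dn.
  have h2 : ((2 * 'C(n'.+1, 2)) * d * d = n'.+1 * n' * d * d)%N by rewrite bn.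
  by case: d d_gt0 h1 h2 => // d' _; rewrite subn1 /=; lia.
have -> : (superfact n)%:R ^+ d = (superfact n)%:R * (superfact n)%:R ^+ (d - 1) :> rat.
  by rewrite -exprS; congr (_ ^+ _); lia.
by rewrite exprD; move: (_ ^+ _) (_ ^+ _) (_ ^+ _) => u v w; ring.
Qed.

(** As in [even_const], but the self-dual classes now leave z_{n-1} z_n^(d-1), whence the division
    by (n - 1)!. *)
Lemma even_const' : (d * n = 2 * m + 2)%N ->
  hc (2 * (uphalf n).-1 + 1)%N * hc (2 * (if odd d then 0 else n./2))%N *
    ((-1) ^+ n./2 * hc n ^+ 2) ^+ ((d - 1)./2) =
  (-1) ^+ ('C(d - 1, 2) * 'C(n, 2)) * (1 / (((2 * m + 2 - d) %/ d)`!)%:R) *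
  (\prod_(1 <= l < ((2 * m + 2 - d) %/ d).+1) (l`!)%:R ^+ d) *
  d%:R ^+ ((2 * m + 2 - d) * m %/ d).
Proof.
case: n => [|n'] dn; first by lia.
rewrite (generic_const _ (odd_bin2 n'.+1) (odd_bin2 (d - 1))).
have -> : ((2 * m + 2 - d) %/ d = n')%N by rewrite -dn mulnS addKn mulKn.
rewrite -(@superfact_prod d n'.+1); last by left.
have -> : hc (2 * (uphalf n'.+1).-1 + 1)%N * hc (2 * (if odd d then 0 else n'.+1./2))%N *
    ((-1) ^+ ('C(d - 1, 2) * 'C(n'.+1, 2)) * hc n'.+1 ^+ (2 * (d - 1)./2)) =
  (-1) ^+ ('C(d - 1, 2) * 'C(n'.+1, 2)) * (hc n' * hc n'.+1 ^+ (d - 1)).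
  rewrite mulrCA; congr (_ * _); have eq_d := odd_double_half d.
  have eq_n := odd_double_half n'; case: ifP eq_d => odd_d eq_d.
    have odd_n : odd n'.
      by have := congr1 odd dn; rewrite oddM odd_d oddD mul2n odd_double /=; lia.
    rewrite [hankel_const d (2 * 0)]hankel_const_small // mulr1.
    congr (_%:R * _ ^+ _); last by lia.
    by congr hankel_const; move: odd_n; clear; lia.
  have -> : (d - 1 = (2 * (d - 1)./2).+1)%N by lia.
  rewrite exprS mulrA; congr (_ * _); last by congr (_ ^+ (2 * _)); lia.
  case: (boolP (odd n')) eq_n => odd_n eq_n.
    by congr (_%:R * _%:R); congr hankel_const; lia.
  by rewrite mulrC; congr (_%:R * _%:R); congr hankel_const; lia.
rewrite -!mulrA; congr (_ * _); rewrite !hankel_constE exprMn -exprM.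
have -> : ((2 * m + 2 - d) * m %/ d = 'C(n', 2) + 'C(n'.+1, 2) * (d - 1))%N.
  have bn := bin2_mul n'.+1; have bS : 'C(n'.+1, 2) = ('C(n', 2) + n')%N by rewrite binS bin1.
  have -> : ((2 * m + 2 - d) * m = ('C(n', 2) + 'C(n'.+1, 2) * (d - 1)) * d)%N; last first.
    by rewrite mulnK.
  have -> : (2 * m + 2 - d = d * n')%N by rewrite -dn mulnS; lia.
  have h1 : ((d * n') * (2 * m + 2) = (d * n') * (d * n'.+1))%N by rewrite dn.
  have h2 : ((2 * 'C(n'.+1, 2)) * d * d = n'.+1 * n' * d * d)%N by rewrite bn.
  by case: d d_gt0 h1 h2 => // d' _; rewrite subn1 /= bS; lia.
have -> : (superfact n'.+1)%:R ^+ d =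
    (superfact n')%:R * n'`!%:R * (superfact n'.+1)%:R ^+ (d - 1) :> rat.
  by rewrite -natrM -superfactS -exprS; congr (_ ^+ _); lia.
have n'0 : n'`!%:R != 0 :> rat by rewrite pnatr_eq0 -lt0n fact_gt0.
by rewrite exprD; move: (_ ^+ _) (_ ^+ _) (_ ^+ _) => u v w; field.
Qed.

End Constants.

(** The determinants contribute exactly q^(m^2), the offset in the equation for k and l, and this
    determines the power of psi. *)
Lemma odd_exponent d m n (g := d./2) (nd := if odd d then n./2 else 0%N)
  (E := (0 * 0 + 0 + nd * nd + n./2 * uphalf n * 2 * g)%N) : (d * n = 2 * m)%N ->
  (d * E + odd n * (d./2 * g) = m ^ 2)%N /\ (4 * m ^ 2 = (4 * E + odd n * (2 * g)) * d)%N.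
Proof.
rewrite /E /nd /g => dn; have := congr1 odd dn; rewrite oddM mul2n odd_double.
have := odd_double_half d; have := odd_double_half n; have -> := uphalf_half n.
move: dn; move: (odd d) (odd n) (d./2) (n./2) => [] [] c k dn //= eq_n eq_d _;
  rewrite ?add1n ?add0n -?muln2 in eq_n eq_d; subst n d.
- have -> : (m = (c * 2).+1 * k)%N by lia.
  by split; lia.
- have -> : (m = c * (k * 2).+1)%N by lia.
  by split; lia.
have -> : (m = c * 2 * k)%N by lia.
by split; lia.
Qed.

Lemma even_exponent d m n (g := (d - 1)./2) (n0 := n./2) (nd := if odd d then 0%N else uphalf n)
  (E := (n0 * n0 + n0 + nd * nd + n./2 * uphalf n * 2 * g)%N) : (0 < d)%N -> (d * n = 2 * m)%N ->
  (d * E + odd n * (d./2 * g) = m * (m + 1))%N /\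
  (4 * m * (m + 1) = (4 * E + odd n * (2 * g)) * d)%N.
Proof.
rewrite /E /nd /n0 /g {E nd n0 g} => d_gt0 dn; have := congr1 odd dn; rewrite oddM mul2n odd_double.
have := odd_double_half d; have := odd_double_half n; have -> := uphalf_half n.
have eq_g : ((d - 1)./2 = d./2 - ~~ odd d)%N by lia.
move: dn; rewrite eq_g {eq_g}.
move: d_gt0 (odd d) (odd n) (d./2) (n./2) => d_gt0 [] [] c k dn //= eq_n eq_d _;
  rewrite ?add1n ?add0n -?muln2 in eq_n eq_d; subst n d.
- have -> : (m = (c * 2).+1 * k)%N by lia.
  by rewrite subn0; split; lia.
- case: c dn d_gt0 => // c dn _; have -> : (m = c.+1 * (k * 2).+1)%N by lia.
  by rewrite subn1 /=; split; lia.
case: c dn d_gt0 => // c dn _; have -> : (m = c.+1 * 2 * k)%N by lia.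
by rewrite subn1 /=; split; lia.
Qed.

Lemma even_exponent' d m n (g := (d - 1)./2) (n0 := (uphalf n).-1)
  (nd := if odd d then 0%N else n./2)
  (E := (n0 * n0 + n0 + nd * nd + n./2 * uphalf n * 2 * g)%N) : (0 < d)%N ->
  (d * n = 2 * m + 2)%N ->
  (d * E + odd n * (d./2 * g) = m * (m + 1))%N /\
  (4 * m * (m + 1) = (4 * E + odd n * (2 * g)) * d)%N.
Proof.
rewrite /E /nd /n0 /g {E nd n0 g} => d_gt0 dn; have := congr1 odd dn; rewrite oddM oddD mul2n odd_double.
have := odd_double_half d; have := odd_double_half n; have -> := uphalf_half n.
have eq_g : ((d - 1)./2 = d./2 - ~~ odd d)%N by lia.
move: dn; rewrite eq_g {eq_g}.
move: d_gt0 (odd d) (odd n) (d./2) (n./2) => d_gt0 [] [] c k dn //= eq_n eq_d _;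
  rewrite ?add1n ?add0n -?muln2 in eq_n eq_d; subst n d.
- case: k dn => [|k] dn; first by lia.
  have -> : (m = (c * 2).+1 * k + c * 2)%N by lia.
  by rewrite subn0 /=; split; lia.
- case: c dn d_gt0 => // c dn _; have -> : (m = c.+1 * (k * 2) + c)%N by lia.
  by rewrite subn1 /=; split; lia.
case: k dn => [|k] dn; first by lia.
case: c dn d_gt0 => // c dn _; have -> : (m = c.+1 * 2 * k + c * 2 + 1)%N by lia.
by rewrite subn1 /=; split; lia.
Qed.

(** As 2d is even, classes have a parity; it forces all k_i to be odd in the first identity. *)
Lemma odd_cls d v : (0 < d)%N -> odd (cls d v) = odd v.
Proof.
move=> d_gt0; rewrite clsE //; have M_gt0 : (0 < 2 * d)%N by rewrite muln_gt0.
rewrite [in RHS](divn_eq v (2 * d)) oddD oddM [odd (2 * d)]oddM andbF /=.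
have := ltn_pmod v M_gt0; move: (v %% (2 * d))%N => t; lia.
Qed.

Lemma same_counts_mem m (L : finType) (lam kappa : 'I_m -> L) i : same_counts lam kappa ->
  exists j, lam j = kappa i.
Proof.
move=> /forallP /(_ (kappa i)) /eqP counts.
have : (0 < #|[pred j | lam j == kappa i]|)%N.
  by rewrite -counts; apply/card_gt0P; exists i; rewrite inE.
by case/card_gt0P => j; rewrite inE => /eqP; exists j.
Qed.

(** * The two identities *)

Section Main.
Variables (d m x : nat).
Hypothesis d_gt0 : (0 < d)%N.

Let M_gt0 : (0 < 2 * d)%N. Proof. by rewrite muln_gt0. Qed.

Lemma theorem4p1_odd : (d %| 2 * m)%N -> let N := (m ^ 2 + x)%N in
   \sum_(k : {ffun 'I_m -> 'I_N.+1})
   \sum_(l : {ffun 'I_m -> 'I_N.+1} |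
         [&& [forall i, odd (k i)], [forall i, odd (l i)],
             (\sum_(i < m) k i * l i == m ^ 2 + x)%N
           & sim_mod (2 * d) (fun i => (k i)%:Z) (fun i => (2 * i + 1)%N%:Z)])
     ((-1) ^+ #|[set i | (d + 1 <= k i %% (2 * d) <= 2 * d - 1)%N]|
      * (\prod_(i < m | (k i == d %[mod 2 * d])%N) (k i)%:R)
      * (\prod_(i < m)
         \prod_(j < m | (i < j)%N && (k i == k j %[mod 2 * d])%N)
            (((k j)%:R - (k i)%:R) / 2) ^+ 2)
      * (\prod_(i < m)
         \prod_(j < m | (i < j)%N
                        && ((k i)%:Z == - (k j)%:Z %[mod (2 * d)%N])%Z)
            (((k j)%:R + (k i)%:R) / 2) ^+ 2))
   = (if (2 * d %| x)%N then
        (-1) ^+ ('C(d, 2) * 'C(2 * m %/ d, 2))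
        * d%:R ^+ ((2 * m - d) * m %/ d)
        * (m`!)%:R
        * (\prod_(1 <= l < ((2 * m - d) %/ d).+1) (l`!)%:R ^+ d)
        * (ntriangle (4 * m ^ 2 %/ d) (x %/ (2 * d)))%:R
      else 0) :> rat.
Proof.
move=> dvd N; set n := (2 * m %/ d)%N.
have dn : (d * n = 2 * m)%N by rewrite mulnC divnK.
pose lam (i : 'I_m) := cls d (2 * i + 1).
pose S (k : {ffun 'I_m -> 'I_N.+1}) := same_counts lam (fun i => cls d (1 * k i)).
have S_odd k : S k -> forall i, odd (k i).
  move=> Sk i; have [j] := same_counts_mem i Sk; rewrite mul1n => eq_j.
  by rewrite -(odd_cls (k i) d_gt0) -eq_j odd_cls // oddD mul2n odd_double.
have simS (k : {ffun 'I_m -> 'I_N.+1}) : sim_mod (2 * d) (fun i => (k i)%:Z) (fun i => (2 * i + 1)%N%:Z) = S k.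
  rewrite (@sim_mod_counts d 1 (2 * d) m (fun i => k i) (fun i => 2 * i + 1)%N) ?mul1n //.
  by congr same_counts; apply: funext => i; rewrite mul1n.
rewrite (@sum_over_multipliers 1 N m S _ _
  (fun k : {ffun 'I_m -> 'I_N.+1} => node_vdm d (fun i => (1 * k i)%N) * \prod_i weight d (1 * k i))) //; first last.
- move=> k l; rewrite simS; case: (boolP (S k)) => [Sk|_]; last by rewrite !andbF.
  have -> : [forall i, odd (k i)] by apply/forallP; apply: S_odd.
  have -> : [forall i, (0 < k i)%N] by apply/forallP => i; rewrite odd_gt0 ?S_odd.
  by rewrite andbT.
- move=> k Sk; have -> : (fun i => 1 * k i)%N = (fun i => k i : nat).
    by apply: funext => i; rewrite mul1n.
  under [in RHS]eq_bigr do rewrite mul1n.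
  rewrite (node_vdmE d_gt0) (prod_weightE d_gt0 (fun i => k i : nat)).
  (* All k_i are odd, so class 0 is empty and the cubic factors disappear. *)
  rewrite [X in _ = _ * (_ * X)]big_pred0 => [|i]; last first.
    apply/eqP => ki; have := S_odd k Sk i.
    by rewrite (divn_eq (k i) (2 * d)) ki addn0 oddM [odd (2 * d)]oddM andbF.
  rewrite mulr1 [RHS]mulrC [RHS]mulrA; congr (_ * _ * _ * _).
    by congr (_ ^+ _); apply: eq_card => i; rewrite !inE; have := ltn_pmod (k i) M_gt0; lia.
  by apply: eq_bigl => i; rewrite [(d %% _)%N]modn_small //; lia.
have [expA expK] := odd_exponent dn; set nd := if odd d then _ else _ in expA expK.
have card_g : #|@generic_class d true| = d./2 by rewrite card_generic_class; lia.
have countE (r : 'I_d.+1) := odd_class_count d_gt0 dn r.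
have even_d : odd n -> ~~ odd d.
  by move=> odd_n; have := congr1 odd dn; rewrite oddM odd_n andbT mul2n odd_double => ->.
rewrite (@sum_evaluation d 1 N m lam true n 0 nd (4 * m ^ 2 %/ d) x) ?dvd1n //.
- rewrite card_g -/nd; have := odd_const d_gt0 dn; rewrite -/nd => ->.
  by case: ifP => _; [move: (ntriangle _ _)%:R => t; ring|rewrite !mulr0].
- by rewrite countE /= eqxx.
- by move=> r r_in; rewrite countE eqb_id; have -> : (r == d :> nat) = false by lia.
- by rewrite mul1n card_g expA.
by rewrite card_g expK mulnK.
Qed.

(** Common to both divisibility cases, which differ only in the sizes n0 and nd. It works with v =
    2k, for which v^3/4 = 2 k^3. *)
Lemma theorem4p1_even n n0 nd (g := (d - 1)./2)
    (E := (n0 * n0 + n0 + nd * nd + n./2 * uphalf n * 2 * g)%N) : (odd n -> ~~ odd d) ->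
  ((0 < nd)%N -> ~~ odd d) ->
  (forall r : 'I_d.+1, ~~ odd r -> #|[pred i : 'I_m | cls d (2 * (i + 1)) == r]| =
     if r == 0 :> nat then n0 else if r == d :> nat then nd else n) ->
  (odd d -> nd = 0%N) ->
  (d * E + odd n * (d./2 * g) = m * (m + 1))%N ->
  (4 * m * (m + 1) = (4 * E + odd n * (2 * g)) * d)%N ->
   let N := ((m * (m + 1)) %/ 2 + x)%N in
   \sum_(k : {ffun 'I_m -> 'I_N.+1})
   \sum_(l : {ffun 'I_m -> 'I_N.+1} |
         [&& [forall i, (0 < k i)%N], [forall i, odd (l i)],
             (\sum_(i < m) k i * l i == (m * (m + 1)) %/ 2 + x)%N
           & sim_mod d (fun i => (k i)%:Z) (fun i => (i + 1)%N%:Z)])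
     ((-1) ^+ #|[set i | (d + 1 <= 2 * (k i %% d))%N
                         && (k i %% d <= d - 1)%N]|
      * (\prod_(i < m | (k i == 0 %[mod d])%N) (2 * (k i)%:R ^+ 3))
      * (\prod_(i < m | (2 %| d)%N && (k i == d %/ 2 %[mod d])%N)
            (2 * (k i)%:R))
      * (\prod_(i < m)
         \prod_(j < m | (i < j)%N && (k i == k j %[mod d])%N)
            ((k j)%:R - (k i)%:R) ^+ 2)
      * (\prod_(i < m)
         \prod_(j < m | (i < j)%N && ((k i)%:Z == - (k j)%:Z %[mod d])%Z)
            ((k i)%:R + (k j)%:R) ^+ 2))
   = (if (d %| x)%N then
        (hankel_const d (2 * n0 + 1))%:R * (hankel_const d (2 * nd))%:R *
        ((-1) ^+ n./2 * (hankel_const d n)%:R ^+ 2) ^+ g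
        * (m`!)%:R
        * (ntriangle (4 * m * (m + 1) %/ d) (x %/ d))%:R
      else 0) :> rat.
Proof.
move=> even_d even_d' countE nd0 expA expK N.
pose lam (i : 'I_m) := cls d (2 * (i + 1)).
pose S (k : {ffun 'I_m -> 'I_N.+1}) := same_counts lam (fun i => cls d (2 * k i)).
have simS (k : {ffun 'I_m -> 'I_N.+1}) :
    sim_mod d (fun i => (k i)%:Z) (fun i => (i + 1)%N%:Z) = S k.
  by rewrite (@sim_mod_counts d 2 d m (fun i => k i) (fun i => i + 1)%N).
have mod_double (v : nat) : ((2 * v) %% (2 * d) = 2 * (v %% d))%N by rewrite muln_modr.
have double2 (v : nat) : (2 * v)%N%:R / 2 = v%:R :> rat by rewrite natrM mulrC mulKf.
rewrite (@sum_over_multipliers 2 N m S _ _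
  (fun k : {ffun 'I_m -> 'I_N.+1} =>
     node_vdm d (fun i => (2 * k i)%N) * \prod_i weight d (2 * k i))) //; first last.
- by move=> k l; rewrite simS; case: (S k); rewrite ?andbT ?andbF //= andbA.
- move=> k _; rewrite (node_vdmE d_gt0) (prod_weightE d_gt0 (fun i => 2 * k i)%N).
  rewrite [RHS]mulrC [X in _ = X * _]mulrAC [RHS]mulrA; congr (_ * _ * _ * _ * _).
  + congr (_ ^+ _); apply: eq_card => i; rewrite !inE mod_double.
    by have := ltn_pmod (k i) d_gt0; lia.
  + apply: eq_big => i; first by rewrite mod_double mod0n muln_eq0.
    by move=> _; rewrite natrM exprMn; field.
  + apply: eq_big => i; last by rewrite natrM.
    rewrite mod_double; have [d2|d2] := boolP (2 %| d)%N; last first.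
      by move: d2; rewrite dvdn2 negbK; move: (k i %% d)%N => t; lia.
    rewrite [(d %/ 2 %% d)%N]modn_small; last by lia.
    by move: (k i %% d)%N => t; lia.
  + apply: eq_bigr => i _; apply: eq_big => j; last by rewrite mulrBl !double2.
    by rewrite !mod_double eqn_pmul2l.
  apply: eq_bigr => i _; apply: eq_big => j; last by rewrite mulrDl !double2 addrC.
  congr (_ && _); rewrite !eqz_mod_dvd !opprK !PoszM -mulrDr.
  by rewrite (@dvdz_scale 2 d d).
have card_g : #|@generic_class d false| = g by rewrite card_generic_class /g; lia.
(* Doubling the equation for k and l gives 2N = m(m + 1) + 2x, so the remaining order is 2x. *)
rewrite (@sum_evaluation d 2 N m lam false n n0 nd (4 * m * (m + 1) %/ d) (2 * x)) //.
- rewrite card_g dvdn_pmul2l // divnMl //.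
  case: ifP => _; last by rewrite !mulr0.
  by move: (ntriangle _ _)%:R (_ ^+ g) => t u; ring.
- exact: dvdn_mulr.
- by move=> nd_gt0; rewrite dvdn2 even_d'.
- by move=> r; rewrite dvdn2 => /eqP ->.
- by rewrite countE.
- have [odd_dd|] := boolP (odd d).
    rewrite nd0 //; apply: eq_card0 => i; rewrite !inE.
    apply/negP => /eqP /(congr1 (fun r : 'I_d.+1 => odd r)).
    by rewrite odd_cls // oddM odd_dd.
  by move=> even_dd; rewrite countE //= eqxx; case: eqP d_gt0 => // ->.
- move=> r r_in; have [odd_r|even_r] := boolP (odd r).
    apply: eq_card0 => i; rewrite !inE; apply/negP => /eqP r_eq; move: odd_r.
    by rewrite -r_eq odd_cls // oddM.
  by rewrite countE //; case: eqP => [|_]; [lia|case: eqP => [|_]; [lia|]].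
- rewrite card_g expA /N mulnDr; congr addn.
  by rewrite mulnC divnK // dvdn2 oddM addn1 /=; case: (odd m).
by rewrite card_g expK mulnK.
Qed.

End Main.

(* The entries of k and l are positive with \sum_i k_i * l_i = N, hence each is
   at most N: letting them range over 'I_N.+1 loses no tuple.
   The subtractions on nat are exact, except that for m = 0 the quotient
   (2 * m - d) %/ d is 0 instead of -1; the product over l is empty in both
   cases, and the exponents of d are 0. *)
Theorem theorem4p1 (d m x : nat) (d_gt0 : (0 < d)%N) :
  ((d %| 2 * m)%N ->
   let N := (m ^ 2 + x)%N in
   \sum_(k : {ffun 'I_m -> 'I_N.+1})
   \sum_(l : {ffun 'I_m -> 'I_N.+1} |
         [&& [forall i, odd (k i)], [forall i, odd (l i)],
             (\sum_(i < m) k i * l i == m ^ 2 + x)%N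
           & sim_mod (2 * d) (fun i => (k i)%:Z) (fun i => (2 * i + 1)%N%:Z)])
     ((-1) ^+ #|[set i | (d + 1 <= k i %% (2 * d) <= 2 * d - 1)%N]|
      * (\prod_(i < m | (k i == d %[mod 2 * d])%N) (k i)%:R)
      * (\prod_(i < m)
         \prod_(j < m | (i < j)%N && (k i == k j %[mod 2 * d])%N)
            (((k j)%:R - (k i)%:R) / 2) ^+ 2)
      * (\prod_(i < m)
         \prod_(j < m | (i < j)%N
                        && ((k i)%:Z == - (k j)%:Z %[mod (2 * d)%N])%Z)
            (((k j)%:R + (k i)%:R) / 2) ^+ 2))
   = (if (2 * d %| x)%N then
        (-1) ^+ ('C(d, 2) * 'C(2 * m %/ d, 2))
        * d%:R ^+ ((2 * m - d) * m %/ d)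
        * (m`!)%:R
        * (\prod_(1 <= l < ((2 * m - d) %/ d).+1) (l`!)%:R ^+ d)
        * (ntriangle (4 * m ^ 2 %/ d) (x %/ (2 * d)))%:R
      else 0) :> rat)
  /\
  (forall C : rat,
   ((d %| 2 * m)%N /\
    C = (-1) ^+ ('C(d - 1, 2) * 'C(2 * m %/ d, 2))
        * ((2 * m %/ d)`!)%:R
        * \prod_(1 <= l < ((2 * m - d) %/ d).+1) (l`!)%:R ^+ d)
   \/
   ((d %| 2 * m + 2)%N /\
    C = (-1) ^+ ('C(d - 1, 2) * 'C(2 * (m + 1) %/ d, 2))
        * (1 / (((2 * m + 2 - d) %/ d)`!)%:R)
        * \prod_(1 <= l < ((2 * m + 2 - d) %/ d).+1) (l`!)%:R ^+ d) ->
   let N := ((m * (m + 1)) %/ 2 + x)%N in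
   \sum_(k : {ffun 'I_m -> 'I_N.+1})
   \sum_(l : {ffun 'I_m -> 'I_N.+1} |
         [&& [forall i, (0 < k i)%N], [forall i, odd (l i)],
             (\sum_(i < m) k i * l i == (m * (m + 1)) %/ 2 + x)%N
           & sim_mod d (fun i => (k i)%:Z) (fun i => (i + 1)%N%:Z)])
     ((-1) ^+ #|[set i | (d + 1 <= 2 * (k i %% d))%N
                         && (k i %% d <= d - 1)%N]|
      * (\prod_(i < m | (k i == 0 %[mod d])%N) (2 * (k i)%:R ^+ 3))
      * (\prod_(i < m | (2 %| d)%N && (k i == d %/ 2 %[mod d])%N)
            (2 * (k i)%:R))
      * (\prod_(i < m)
         \prod_(j < m | (i < j)%N && (k i == k j %[mod d])%N)
            ((k j)%:R - (k i)%:R) ^+ 2)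
      * (\prod_(i < m)
         \prod_(j < m | (i < j)%N && ((k i)%:Z == - (k j)%:Z %[mod d])%Z)
            ((k i)%:R + (k j)%:R) ^+ 2))
   = (if (d %| x)%N then
        C
        * d%:R ^+ ((2 * m + 2 - d) * m %/ d)
        * (m`!)%:R
        * (ntriangle (4 * m * (m + 1) %/ d) (x %/ d))%:R
      else 0) :> rat).
Proof.
split=> [|C C_cases]; first exact: theorem4p1_odd.
case: C_cases => -[dvd ->].
  set n := (2 * m %/ d)%N; have dn : (d * n = 2 * m)%N by rewrite mulnC divnK.
  have [expA expK] := even_exponent d_gt0 dn.
  have even_d : odd n -> ~~ odd d.
    by move=> odd_n; have := congr1 odd dn; rewrite oddM odd_n andbT mul2n odd_double => ->.
  move=> N; have countE (r : 'I_d.+1) : ~~ odd r -> #|[pred i : 'I_m | cls d (2 * (i + 1)) == r]| =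
      if r == 0 :> nat then n./2 else if r == d :> nat then if odd d then 0%N else uphalf n else n.
    move=> even_r; rewrite (even_class_count d_gt0 dn even_r).
    by case: eqP => // _; case: eqP => // <-; rewrite (negPf even_r).
  rewrite (@theorem4p1_even d m x d_gt0 n _ (if odd d then 0%N else uphalf n) even_d
    _ countE _ expA expK) //; first last.
  - by move=> ->.
  - by case: ifP.
  by rewrite (even_const d_gt0 dn); case: ifP => // _; move: (ntriangle _ _)%:R => t; ring.
set n := (2 * (m + 1) %/ d)%N; have dn : (d * n = 2 * m + 2)%N by rewrite mulnC divnK ?mulnDr.
have [expA expK] := even_exponent' d_gt0 dn.
have even_d : odd n -> ~~ odd d.
  move=> odd_n; have := congr1 odd dn; rewrite oddM odd_n andbT oddD mul2n odd_double.
  by move=> ->.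
move=> N; have countE (r : 'I_d.+1) : ~~ odd r -> #|[pred i : 'I_m | cls d (2 * (i + 1)) == r]| =
    if r == 0 :> nat then (uphalf n).-1 else if r == d :> nat then if odd d then 0%N else n./2 else n.
  move=> even_r; rewrite (even_class_count' d_gt0 dn even_r).
  by case: eqP => // _; case: eqP => // <-; rewrite (negPf even_r).
rewrite (@theorem4p1_even d m x d_gt0 n _ (if odd d then 0%N else n./2) even_d
  _ countE _ expA expK) //; first last.
- by move=> ->.
- by case: ifP.
by rewrite (even_const' d_gt0 dn); case: ifP => // _; move: (ntriangle _ _)%:R => t; ring.
Qed.
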